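(* There exists an interval exchange transformation $T$ on $6$ intervals such that: (i) $T$ is minimal and not uniquely ergodic; (ii) $T$ has exactly $2$ ergodic invariant Borel probability measures; and (iii) $T$ has an invariant Borel probability measure $\mu$ that is generic but is not ergodic.
   Context: An interval exchange transformation (IET) on $d$ intervals is a map $T$ of an interval $[0,|\lambda|)$, where $\lambda=(\lambda_\alpha)_{\alpha\in\mathcal A}$ is a vector of positive lengths indexed by an alphabet $\mathcal A$ of $d$ letters and $|\lambda|=\sum_\alpha\lambda_\alpha$: the interval is cut into $d$ consecutive half-open intervals (closed on the left) $I_\alpha$ of lengths $\lambda_\alpha$, ordered according to a bijection $\pi_t:\mathcal A\to\{1,\dots,d\}$, and these are rearranged by translations in the order given by a second bijection $\pi_b:\mathcal A\to\{1,\dots,d\}$. $T$ is minimal if every orbit is dense. Let $X$ be a $\sigma$-compact metric space, $\mu$ a Borel measure on $X$ and $T:X\to X$ a $\mu$-measure preserving map. A point $x\in X$ is generic for $\mu$ if for every continuous compactly supported $f:X\to\mathbb R$ one has $\frac1N\sum_{i=0}^{N-1}f(T^ix)\to\int f\,d\mu$ as $N\to\infty$. The measure $\mu$ is called generic if it has a generic point. *)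

(* Defs.v *)
From mathcomp Require Import all_boot all_order all_algebra.
From mathcomp Require Import all_classical all_reals all_analysis.

Set Implicit Arguments.
Unset Strict Implicit.
Unset Printing Implicit Defensive.

Import Order.TTheory GRing.Theory Num.Theory numFieldNormedType.Exports.

Local Open Scope classical_set_scope.
Local Open Scope ring_scope.

(* The positions 1, ..., d are numbered 0, ..., d - 1, i.e. lie in 'I_d.
   Bijectivity of iet_top forces #|A| = d. *)
Record iet_data (R : realType) (A : finType) (d : nat) := IETData {
  iet_len : A -> R ;
  iet_len_gt0 : forall a, 0 < iet_len a ;
  iet_top : A -> 'I_d ;
  iet_top_bij : bijective iet_top ;
  iet_bot : A -> 'I_d ;
  iet_bot_bij : bijective iet_bot }.

Section IET.
Variables (R : realType) (A : finType) (d : nat) (D : iet_data R A d).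

Definition iet_total : R := \sum_(a : A) iet_len D a.

Definition iet_dom : set R := `[0, iet_total[.

(* Left endpoint of the interval labelled a, before (top) and after (bot) the
   exchange. *)
Definition iet_top_left (a : A) : R :=
  \sum_(b : A | (iet_top D b < iet_top D a)%N) iet_len D b.

Definition iet_bot_left (a : A) : R :=
  \sum_(b : A | (iet_bot D b < iet_bot D a)%N) iet_len D b.

(* The exchange on iet_dom; outside iet_dom, where no interval contains x, the
   value x is a dummy. *)
Definition iet_map (x : R) : R :=
  if [pick a | iet_top_left a <= x < iet_top_left a + iet_len D a] is Some a
  then x - iet_top_left a + iet_bot_left a
  else x.

End IET.

(* Dynamics of T : X -> X for a subset X of the line. T and the observables are
   functions on all of R of which only the restriction to X is used. A Borel
   probability measure on X is encoded as a Borel probability measure on R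
   giving mass 1 to X; see borel_prob_eq for equality. *)
Section Dynamics.
Variables (R : realType) (X : set R) (T : R -> R).

Notation borel_prob := (probability (measurableTypeR R) R).

(* The library's measures are functions on all sets, with arbitrary values on
   nonmeasurable ones, so two measures are the same when they agree on
   measurable sets. *)
Definition borel_prob_eq (mu nu : borel_prob) : Prop :=
  forall B : set (measurableTypeR R), measurable B -> mu B = nu B.

Definition forward_orbit (x : R) : set R := [set iter n T x | n in [set: nat]].

Definition minimal_on : Prop :=
  forall x, X x -> X `<=` closure (forward_orbit x).

Definition invariant_prob (mu : borel_prob) : Prop :=
  mu X = 1%E /\
  forall B : set (measurableTypeR R), measurable B -> B `<=` X ->
    mu (X `&` T @^-1` B) = mu B.

Definition ergodic_prob (mu : borel_prob) : Prop :=
  invariant_prob mu /\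
  forall B : set (measurableTypeR R), measurable B -> B `<=` X ->
    X `&` T @^-1` B = B -> mu B = 0%E \/ mu B = 1%E.

Definition uniquely_ergodic : Prop :=
  exists2 mu : borel_prob, invariant_prob mu &
    forall nu : borel_prob, invariant_prob nu -> borel_prob_eq nu mu.

(* The support is the closure relative to X: in `[0, a[ a compactly supported
   function vanishes near a. *)
Definition compactly_supported (f : R -> R) : Prop :=
  compact (X `&` closure (X `&` [set x | f x != 0])).

Definition generic_point (mu : borel_prob) (x : R) : Prop :=
  forall f : R -> R, {within X, continuous f} -> compactly_supported f ->
    (fun N : nat => N%:R^-1 * \sum_(0 <= i < N) f (iter i T x)) @ \oo -->
      \int[mu]_(y in X) f y.

Definition generic_measure (mu : borel_prob) : Prop :=
  exists2 x, X x & generic_point mu x.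

End Dynamics.

(* Main.v *)
(* The exchange has intervals C D A1 A2 B1 B2, rearranged as A2 A1 B2 B1 D C, with
   |A1| = |B1| and |A2| = |B2|. For suitable lengths its first return to C is an
   exchange of the same kind: writing A, B for A2, B2 and a, b for A1, B1, the
   return words are
     C: CBA (DBA)^m    D: CBA (DBA)^(m+1)    A: CBA a^n A    a: CBA a^(n+1) A
                                             B: CB b^n BA    b: CB b^(n+1) BA.
   Iterating, we get at each level k towers over the six intervals, the n_k and
   m_k being free parameters; lengths realizing a given sequence of parameters
   are limits of increasing approximations. When n_k grows fast, almost all of a
   level k + 1 tower over A1 or A2 (B1 or B2) is made of level k towers over A1
   (B1), so Birkhoff averages along the A side and along the B side converge,
   and so does the mass of the two sides: the points eventually in towers of the
   A side and those eventually in towers of the B side both have half of the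
   Lebesgue measure. The normalized restrictions of Lebesgue measure to these two
   sets are the ergodic measures, and all others are combinations of them. When
   m_k grows as well, towers over C and D are very long concatenations of blocks
   DBA, in which the two sides balance and the towers over C and D of the
   previous level lose their weight. The orbit of 0 starts in the tower over C at
   every level, so it equidistributes for Lebesgue measure, the average of
   the two ergodic measures. *)
From HB Require Import structures.
Require Import Defs.
From mathcomp Require Import all_boot all_order all_algebra.
From mathcomp Require Import all_classical all_reals all_analysis.
From mathcomp Require Import measurable_realfun ring lra zify.

Set Implicit Arguments.
Unset Strict Implicit.
Unset Printing Implicit Defensive.

Import Order.TTheory GRing.Theory Num.Theory numFieldNormedType.Exports.

Local Open Scope classical_set_scope.
Local Open Scope ring_scope.

(** * A renormalizable exchange of six intervals *)

(** Two demands on [mm] pull against each other. On the orbit of 0 a broken block costs about the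
    height of [A2], so the ratio of the heights of C and [A2] must tend to infinity. But the towers
    over C and D forget the averages of earlier levels only if the share of B2 A2 in the blocks DBA
    has a divergent sum over the levels. A ratio growing linearly in k meets both demands: the share
    is then of order 1/k. The point 0 is singular: it starts the C tower of every level, while its
    preimage ends the towers over [A2]. The set of points of the A side is therefore invariant only
    once the backward orbit of 0, a null set, is removed. The ergodic theorem is never invoked. An
    invariant probability gives equal mass to the floors of a tower, so its integrals are governed
    in the limit by a single number, the share of the A side. This classifies the invariant
    probabilities, and ergodicity of the two components follows from the classification by
    conditioning on an invariant set. *)

Inductive letter := C | D | A1 | A2 | B1 | B2.

Section Exchange.
Variables (R : realType) (c d x y : R).

Definition len (l : letter) : R :=
  match l with C => c | D => d | A1 | B1 => y | A2 | B2 => x end.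

Definition lft (l : letter) : R :=
  match l with
  | C => 0 | D => c | A1 => c + d | A2 => c + d + y
  | B1 => c + d + y + x | B2 => c + d + y + x + y
  end.

Definition trans (l : letter) : R :=
  match l with
  | C => 2 * x + 2 * y + d | D => 2 * x + 2 * y - c
  | A1 | B1 => x - c - d | A2 | B2 => - (c + d + y)
  end.

Definition total : R := c + d + 2 * x + 2 * y.

Definition inI (l : letter) (z : R) : bool := lft l <= z < lft l + len l.

Definition exch (z : R) : R :=
  if z < c then z + trans C
  else if z < c + d then z + trans D
  else if z < c + d + y then z + trans A1
  else if z < c + d + y + x then z + trans A2
  else if z < c + d + y + x + y then z + trans B1
  else z + trans B2.

Hypotheses (c_gt0 : 0 < c) (d_gt0 : 0 < d) (x_gt0 : 0 < x) (y_gt0 : 0 < y).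

Ltac lens_pos := move: c_gt0 d_gt0 x_gt0 y_gt0 => ? ? ? ?.

Lemma exchE l z : inI l z -> exch z = z + trans l.
Proof.
lens_pos; rewrite /inI /exch; case: l => /= /andP[? ?].
all: repeat case: ltP => ?.
all: first [by lra | by exfalso; lra].
Qed.

Lemma inI_cover (z : R) : 0 <= z < total -> exists l, inI l z.
Proof.
lens_pos.
rewrite /total /inI => /andP[z0 zL].
have [?|?] := ltP z c; first by exists C => /=; lra.
have [?|?] := ltP z (c + d); first by exists D => /=; lra.
have [?|?] := ltP z (c + d + y); first by exists A1 => /=; lra.
have [?|?] := ltP z (c + d + y + x); first by exists A2 => /=; lra.
have [?|?] := ltP z (c + d + y + x + y); first by exists B1 => /=; lra.
by exists B2 => /=; lra.
Qed.

Lemma inI_range l z : inI l z -> 0 <= z < total.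
Proof. lens_pos; by rewrite /inI /total; case: l => /= /andP[? ?]; lra. Qed.

Lemma inI_uniq l l' z : inI l z -> inI l' z -> l = l'.
Proof.
lens_pos.
by rewrite /inI; case: l; case: l' => //= /andP[? ?] /andP[? ?]; exfalso; lra.
Qed.

Lemma exch_range (z : R) : 0 <= z < total -> 0 <= exch z < total.
Proof.
lens_pos.
move=> /inI_cover[l zl]; rewrite (exchE zl); move: zl.
by rewrite /inI /total; case: l => /= /andP[? ?]; lra.
Qed.

Lemma exch_inj (z z' : R) : 0 <= z < total -> 0 <= z' < total ->
  exch z = exch z' -> z = z'.
Proof.
lens_pos.
move=> /inI_cover[l zl] /inI_cover[l' zl']; rewrite (exchE zl) (exchE zl').
move: zl zl'; rewrite /inI.
by case: l; case: l' => /= /andP[? ?] /andP[? ?]; lra.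
Qed.

Lemma exch_surj (z : R) : 0 <= z < total -> exists2 w, 0 <= w < total & exch w = z.
Proof.
lens_pos; rewrite /total => /andP[z0 zL].
have key l : inI l (z - trans l) -> exists2 w, 0 <= w < total & exch w = z.
  by move=> h; exists (z - trans l); [exact: inI_range h|rewrite (exchE h); lra].
have [?|?] := ltP z x; first by apply: (key A2); rewrite /inI /=; lra.
have [?|?] := ltP z (x + y); first by apply: (key A1); rewrite /inI /=; lra.
have [?|?] := ltP z (x + y + x); first by apply: (key B2); rewrite /inI /=; lra.
have [?|?] := ltP z (x + y + x + y); first by apply: (key B1); rewrite /inI /=; lra.
have [?|?] := ltP z (x + y + x + y + d); first by apply: (key D); rewrite /inI /=; lra.
by apply: (key C); rewrite /inI /=; lra.
Qed.

End Exchange.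

(* The first return of the exchange to I_C is an exchange of the same kind, and
   [word n m l] is the itinerary of its interval I_l until that return. *)
Definition word (n m : nat) (l : letter) : seq letter :=
  match l with
  | C => [:: C; B2; A2] ++ flatten (nseq m [:: D; B2; A2])
  | D => [:: C; B2; A2] ++ flatten (nseq m.+1 [:: D; B2; A2])
  | A2 => [:: C; B2; A2] ++ nseq n A1 ++ [:: A2]
  | A1 => [:: C; B2; A2] ++ nseq n.+1 A1 ++ [:: A2]
  | B2 => [:: C; B2] ++ nseq n B1 ++ [:: B2; A2]
  | B1 => [:: C; B2] ++ nseq n.+1 B1 ++ [:: B2; A2]
  end.

Section Route.
Variables (R : realType) (c d x y : R).

(** Steps are written with the translations [trans] and not with [exch], so that a whole itinerary
    reduces to linear inequalities. *)
Fixpoint route (w : seq letter) (z z' : R) : Prop :=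
  if w is l :: w' then inI c d x y l z /\ route w' (z + trans c d x y l) z'
  else z' = z.

Lemma route_cat w1 w2 z z1 z2 :
  route w1 z z1 -> route w2 z1 z2 -> route (w1 ++ w2) z z2.
Proof.
elim: w1 z => [|l w1 ih] z /=; first by move=> ->.
by move=> [hl h1] h2; split=> //; apply: ih.
Qed.

End Route.

(** * The first return to the interval C *)

Section Renormalization.
Variables (R : realType) (c d x y c' d' x' y' : R) (n m : nat).
Hypotheses (c'_gt0 : 0 < c') (d'_gt0 : 0 < d') (x'_gt0 : 0 < x') (y'_gt0 : 0 < y').
Hypothesis m_gt0 : (0 < m)%N.
Hypothesis n_gt0 : (0 < n)%N.
Hypothesis Ec : c = c' + d' + 2 * (x' + y').
Hypothesis Ed : d = m%:R * (c' + d') + d'.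
Hypothesis Ex : x = (m%:R + 1) * (c' + d') + d' + 3 * (x' + y').
Hypothesis Ey : y = n%:R * (x' + y') + y'.

Let T := exch c d x y.
Let s := c' + d'.
Let u := x' + y'.

Let s_le : s <= m%:R * s.
Proof. by rewrite ler_peMl ?ler1n // ltW // addr_gt0. Qed.
Let u_le : u <= n%:R * u.
Proof. by rewrite ler_peMl ?ler1n // ltW // addr_gt0. Qed.
Let Ec' : c = s + 2 * u. Proof. exact: Ec. Qed.
Let Ed' : d = m%:R * s + d'. Proof. exact: Ed. Qed.
(** This makes [A1] and [B1] translations by [u] and, since [c = s + 2 * u], the word D B2 A2 a
    translation by [- s]. The equations for [y] and [d] are divisions with remainder by these steps,
    with quotients [n] and [m]. *)
Let Ex' : x = c + d + u. Proof. rewrite Ex Ec Ed /u; ring. Qed.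
Let Ey' : y = n%:R * u + y'. Proof. exact: Ey. Qed.
Let Es : s = c' + d'. Proof. by []. Qed.
Let Eu : u = x' + y'. Proof. by []. Qed.

Ltac facts := move: c'_gt0 d'_gt0 x'_gt0 y'_gt0 s_le u_le Ec' Ed' Ex' Ey' Es Eu
  => ? ? ? ? ? ? ? ? ? ? ? ?.
Ltac go := facts; rewrite /inI /=; try (apply/andP; split); lra.

Lemma lens_gt0 : [/\ 0 < c, 0 < d, 0 < x & 0 < y].
Proof. by facts; split; lra. Qed.

Lemma total_renorm : total c' d' x' y' = c.
Proof. by facts; rewrite /total; lra. Qed.

Lemma route_A1 j z : c + d <= z -> z + j%:R * u < c + d + y + u ->
  route c d x y (nseq j A1) z (z + j%:R * u).
Proof.
elim: j z => [|j ih] z h1 h2 /=; first by rewrite mul0r addr0.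
have ju : 0 <= j%:R * u by rewrite mulr_ge0 // addr_ge0 // ltW.
move: h2; rewrite -natr1 mulrDl mul1r => h2.
split; first by go.
have -> : z + (j%:R * u + u) = z + (x - c - d) + j%:R * u by facts; lra.
by apply: ih; go.
Qed.

Lemma route_B1 j z : c + d + y + x <= z -> z + j%:R * u < c + d + y + x + y + u ->
  route c d x y (nseq j B1) z (z + j%:R * u).
Proof.
elim: j z => [|j ih] z h1 h2 /=; first by rewrite mul0r addr0.
have ju : 0 <= j%:R * u by rewrite mulr_ge0 // addr_ge0 // ltW.
move: h2; rewrite -natr1 mulrDl mul1r => h2.
split; first by go.
have -> : z + (j%:R * u + u) = z + (x - c - d) + j%:R * u by facts; lra.
by apply: ih; go.
Qed.

Lemma route_DBA j z : c + j%:R * s <= z + s -> z < c + d ->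
  route c d x y (flatten (nseq j [:: D; B2; A2])) z (z - j%:R * s).
Proof.
elim: j z => [|j ih] z h1 h2 /=; first by rewrite mul0r subr0.
have js : 0 <= j%:R * s by rewrite mulr_ge0 // addr_ge0 // ltW.
move: h1; rewrite -natr1 mulrDl mul1r => h1.
split; first by go.
split; first by go.
split; first by go.
set z2 := (X in route _ _ _ _ _ X _).
have ez2 : z2 = z - s by rewrite /z2; facts; lra.
rewrite ez2; have -> : z - (j%:R * s + s) = z - s - j%:R * s by lra.
by apply: ih; go.
Qed.

Lemma route_word l z : inI c' d' x' y' l z ->
  route c d x y (word n m l) z (exch c' d' x' y' z).
Proof.
move=> zl; rewrite (exchE c'_gt0 d'_gt0 x'_gt0 y'_gt0 zl).
have ms : m.+1%:R * s = m%:R * s + s by rewrite -natr1 mulrDl mul1r.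
have nu : n.+1%:R * u = n%:R * u + u by rewrite -natr1 mulrDl mul1r.
have m0 : 0 <= m%:R * s by rewrite mulr_ge0 // addr_ge0 // ltW.
have n0 : 0 <= n%:R * u by rewrite mulr_ge0 // addr_ge0 // ltW.
have e3 : z + trans c d x y C + trans c d x y B2 + trans c d x y A2 = z + d + 2 * u.
  by facts; rewrite /=; lra.
have e2 : z + trans c d x y C + trans c d x y B2 = z + 2 * x + y - c.
  by facts; rewrite /=; lra.
(* After C and B2 the point is at [z + x + y + d + u], to the left of [B1] exactly when [z < s + u],
   that is, when [z] lies in C, D, [A1] or [A2] of the next level. *)
have cba : z < s + u -> 0 <= z -> route c d x y [:: C; B2; A2] z (z + d + 2 * u).
  by move=> h0 h1; split; [go|split; [go|split; [go|exact/esym]]].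
have cb : s + u <= z -> z < s + 2 * u -> route c d x y [:: C; B2] z (z + 2 * x + y - c).
  by move=> h0 h1; split; [go|split; [go|exact/esym]].
case: l zl; rewrite /inI /= => /andP[h1 h2].
- apply: (@route_cat _ _ _ _ _ [:: C; B2; A2] (flatten (nseq m [:: D; B2; A2]))); first by apply: cba; go.
  have -> : z + (2 * x' + 2 * y' + d') = z + d + 2 * u - m%:R * s by facts; lra.
  by apply: route_DBA; go.
- apply: (@route_cat _ _ _ _ _ [:: C; B2; A2] (flatten (nseq m.+1 [:: D; B2; A2]))); first by apply: cba; go.
  have -> : z + (2 * x' + 2 * y' - c') = z + d + 2 * u - m.+1%:R * s by facts; lra.
  by apply: route_DBA; go.
- apply: (@route_cat _ _ _ _ _ [:: C; B2; A2] (nseq n.+1 A1 ++ [:: A2])); first by apply: cba; go.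
  apply: route_cat; first by apply: route_A1; go.
  by split; [go | rewrite /=; facts; lra].
- apply: (@route_cat _ _ _ _ _ [:: C; B2; A2] (nseq n A1 ++ [:: A2])); first by apply: cba; go.
  apply: route_cat; first by apply: route_A1; go.
  by split; [go | rewrite /=; facts; lra].
- apply: (@route_cat _ _ _ _ _ [:: C; B2] (nseq n.+1 B1 ++ [:: B2; A2])); first by apply: cb; go.
  apply: route_cat; first by apply: route_B1; go.
  by split; [go | split; [go | rewrite /=; facts; lra]].
- apply: (@route_cat _ _ _ _ _ [:: C; B2] (nseq n B1 ++ [:: B2; A2])); first by apply: cb; go.
  apply: route_cat; first by apply: route_B1; go.
  by split; [go | split; [go | rewrite /=; facts; lra]].
Qed.

Let T_step l z : inI c d x y l z -> T z = z + trans c d x y l.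
Proof. by have [? ? ? ?] := lens_gt0; apply: exchE. Qed.

Let T_step2 l1 l2 z : inI c d x y l1 z ->
  inI c d x y l2 (z + trans c d x y l1) ->
  T (T z) = z + trans c d x y l1 + trans c d x y l2.
Proof. by move=> h1 h2; rewrite (T_step h1) (T_step h2). Qed.

Let T_step3 l1 l2 l3 z : inI c d x y l1 z ->
  inI c d x y l2 (z + trans c d x y l1) ->
  inI c d x y l3 (z + trans c d x y l1 + trans c d x y l2) ->
  T (T (T z)) = z + trans c d x y l1 + trans c d x y l2 + trans c d x y l3.
Proof. by move=> h1 h2 h3; rewrite (T_step2 h1 h2) (T_step h3). Qed.

(** Once all points are reached, the towers over the interval C fill the domain. *)
Let reached z := exists (w : R) (j : nat), 0 <= w < c /\ z = iter j T w.

Let reached_step z : reached z -> reached (T z).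
Proof. by move=> [w [j [wc ->]]]; exists w, j.+1. Qed.

Let reached_base z : 0 <= z < c -> reached z.
Proof. by move=> zc; exists z, 0%N. Qed.

(** The Archimedean property as an induction on strips of width [a]: width [s] along D, width [u]
    along [A1] and [B1]. *)
Let reached_bound (a : R) (P : R -> Prop) : 0 < a ->
  (forall j : nat, forall z, 0 <= z -> z < j%:R * a -> P z) ->
  forall z, 0 <= z -> P z.
Proof.
move=> a0 H z z0; apply: (H (Num.bound (z / a))) => //.
by rewrite -ltr_pdivrMr //; apply: archi_boundP; rewrite divr_ge0 // ltW.
Qed.

Let reached_C z : total c d x y - c <= z < total c d x y -> reached z.
Proof.
rewrite /total => /andP[z1 z2]; rewrite (_ : z = T (z - trans c d x y C)).
  by apply/reached_step/reached_base; rewrite /=; facts; lra.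
rewrite (@T_step C); first by lra.
by go.
Qed.

Let reached_CBA z : d + 2 * u <= z < d + 2 * u + s + u -> reached z.
Proof.
move=> /andP[h1 h2]; have -> : z = T (T (T (z - d - 2 * u))).
  by rewrite (@T_step3 C B2 A2); [rewrite /=; facts; lra|go..].
by do 3!apply: reached_step; apply: reached_base; facts; lra.
Qed.

Let reached_D z : inI c d x y D z -> reached z.
Proof.
rewrite /inI /= => /andP[h1 h2].
have s0 : 0 < s by rewrite addr_gt0.
(* Here [w] is the distance to the right end: DBA moves to the left, and the last strip of width [s]
   in D is covered by the image of CBA. *)
suff : forall w, 0 <= w -> w <= d -> reached (c + d - w).
  by move=> /(_ (c + d - z)); rewrite (_ : c + d - (c + d - z) = z); [apply; lra|lra].
apply: (reached_bound s0) => j; elim: j => [|j ih] w w0 wj return_word.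
  by rewrite mul0r in wj; facts; lra.
have [ws|sw] := leP w s.
  by apply: reached_CBA; facts; lra.
have -> : c + d - w = T (T (T (c + d - (w - s)))).
  by rewrite (@T_step3 D B2 A2); [rewrite /=; facts; lra|go..].
do 3!apply: reached_step; apply: ih; [lra| |lra].
by move: wj; rewrite -natr1 mulrDl mul1r; lra.
Qed.

Let reached_A1 z : inI c d x y A1 z -> reached z.
Proof.
rewrite /inI /= => /andP[h1 h2].
have u0 : 0 < u by rewrite addr_gt0.
suff : forall w, 0 <= w -> w < y -> reached (c + d + w).
  move=> /(_ (z - c - d)).
  by rewrite (_ : c + d + (z - c - d) = z); [apply; lra|lra].
apply: (reached_bound u0) => j; elim: j => [|j ih] w w0 wj wy.
  by rewrite mul0r in wj; facts; lra.
have [wu|uw] := ltP w u; first by apply: reached_CBA; facts; lra.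
have -> : c + d + w = T (c + d + (w - u)).
  by rewrite (@T_step A1); [rewrite /=; facts; lra | go].
apply/reached_step/ih; [lra| |lra].
by move: wj; rewrite -natr1 mulrDl mul1r; lra.
Qed.

Let reached_B1 z : inI c d x y B1 z -> reached z.
Proof.
rewrite /inI /= => /andP[h1 h2].
have u0 : 0 < u by rewrite addr_gt0.
suff : forall w, 0 <= w -> w < y -> reached (c + d + y + x + w).
  move=> /(_ (z - c - d - y - x)).
  by rewrite (_ : c + d + y + x + (z - c - d - y - x) = z); [apply; lra|lra].
apply: (reached_bound u0) => j; elim: j => [|j ih] w w0 wj wy.
  by rewrite mul0r in wj; facts; lra.
have [wu|uw] := ltP w u.
  have -> : c + d + y + x + w = T (T (w + s + u)).
    by rewrite (@T_step2 C B2); [rewrite /=; facts; lra|go..].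
  by do 2!apply: reached_step; apply: reached_base; facts; lra.
have -> : c + d + y + x + w = T (c + d + y + x + (w - u)).
  by rewrite (@T_step B1); [rewrite /=; facts; lra | go].
apply/reached_step/ih; [lra| |lra].
by move: wj; rewrite -natr1 mulrDl mul1r; lra.
Qed.

Lemma reached_total (z : R) : 0 <= z < total c d x y ->
  exists (w : R) (j : nat), 0 <= w < c /\ z = iter j T w.
Proof.
have [c0 d0 x0 y0] := lens_gt0.
(* Since [x = c + d + u], the interval [B2] consists of the last strip of the image of [B1], the
   image of D and the image of C. Likewise [A2] is the last strip of the image of [A1] followed by a
   part of the image of [B2]. *)
have B2_case w : inI c d x y B2 w -> reached w.
  rewrite /inI /= => /andP[h1 h2].
  have [wu|uw] := ltP w (c + d + y + x + y + u).
    have wB1 : inI c d x y B1 (w - u) by go.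
    by have := reached_step (reached_B1 wB1); rewrite (T_step wB1) /=;
      congr reached; facts; lra.
  have [return_word|dw] := ltP w (c + d + y + x + y + u + d).
    have wD : inI c d x y D (w - trans c d x y D) by go.
    by have := reached_step (reached_D wD); rewrite (T_step wD);
      congr reached; lra.
  by apply: reached_C; rewrite /total; facts; lra.
move=> /(inI_cover c0 d0 x0 y0)[[]] zl.
- by apply: reached_base; move: zl; rewrite /inI /=; lra.
- exact: reached_D.
- exact: reached_A1.
- have [wu|uw] := ltP z (c + d + y + u).
    have zA1 : inI c d x y A1 (z - u) by move: zl; rewrite /inI /= => /andP[? ?]; go.
    by have := reached_step (reached_A1 zA1); rewrite (T_step zA1) /=;
      congr reached; facts; lra.
  have zB2 : inI c d x y B2 (z - trans c d x y B2).
    by move: zl; rewrite /inI /= => /andP[? ?]; go.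
  by have := reached_step (B2_case _ zB2); rewrite (T_step zB2); congr reached; lra.
- exact: reached_B1.
- exact: B2_case.
Qed.

End Renormalization.

(** * Towers *)

Section Towers.
Variables (R : realType) (lc ld lx ly : nat -> R) (nn mm : nat -> nat).

(** The lengths of level [k] come from those of level [k.+1] with nonnegative coefficients, so a
    sequence of parameters can be fixed before any length is. *)
Definition renormalizable : Prop := forall k,
  [/\ [/\ 0 < lc k, 0 < ld k, 0 < lx k & 0 < ly k], (0 < mm k)%N, (0 < nn k)%N &
  [/\ lc k = lc k.+1 + ld k.+1 + 2 * (lx k.+1 + ly k.+1),
      ld k = (mm k)%:R * (lc k.+1 + ld k.+1) + ld k.+1,
      lx k = ((mm k)%:R + 1) * (lc k.+1 + ld k.+1) + ld k.+1
             + 3 * (lx k.+1 + ly k.+1) &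
      ly k = (nn k)%:R * (lx k.+1 + ly k.+1) + ly k.+1] ].

Definition Tk k := exch (lc k) (ld k) (lx k) (ly k).
Definition Jk k := total (lc k) (ld k) (lx k) (ly k).
Definition Ik k := inI (lc k) (ld k) (lx k) (ly k).
Definition return_word k := word (nn k) (mm k).
Definition itinerary k := route (lc k) (ld k) (lx k) (ly k).

Fixpoint ht k (l : letter) : nat :=
  if k is j.+1 then sumn [seq ht j l' | l' <- return_word j l] else 1%N.

Definition hts k (w : seq letter) := sumn [seq ht k l | l <- w].

Local Notation T := (Tk 0).

Hypothesis ren : renormalizable.

Let lc_gt0 k : 0 < lc k. Proof. by have [[]] := ren k. Qed.
Let ld_gt0 k : 0 < ld k. Proof. by have [[]] := ren k. Qed.
Let lx_gt0 k : 0 < lx k. Proof. by have [[]] := ren k. Qed.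
Let ly_gt0 k : 0 < ly k. Proof. by have [[]] := ren k. Qed.

Lemma Jk_succ k : Jk k.+1 = lc k.
Proof.
have [_ m0 n0 [Ec Ed Ex Ey]] := ren k.
exact: (total_renorm (lc_gt0 _) (ld_gt0 _) (lx_gt0 _) (ly_gt0 _) m0 n0 Ec Ed Ex Ey).
Qed.

Lemma Jk_decr k : Jk k.+1 < Jk k.
Proof.
rewrite Jk_succ /Jk /total; move: (ld_gt0 k) (lx_gt0 k) (ly_gt0 k) => ? ? ?; lra.
Qed.

Lemma Jk_gt0 k : 0 < Jk k.
Proof. by apply: lt_trans (Jk_decr k); rewrite Jk_succ. Qed.

Lemma Jk_le k j : (k <= j)%N -> Jk j <= Jk k.
Proof.
move=> kj; rewrite -(subnKC kj); elim: (j - k)%N => [|i ih]; first by rewrite addn0.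
by rewrite addnS (le_trans _ ih)// ltW // Jk_decr.
Qed.

Lemma Tk_in k z : 0 <= z < Jk k -> 0 <= Tk k z < Jk k.
Proof. exact: (exch_range (lc_gt0 _) (ld_gt0 _) (lx_gt0 _) (ly_gt0 _)). Qed.

Lemma Tk_iter_in k i z : 0 <= z < Jk k -> 0 <= iter i (Tk k) z < Jk k.
Proof. by move=> h; elim: i => //= i ih; apply: Tk_in. Qed.

Lemma Ik_J k l z : Ik k l z -> 0 <= z < Jk k.
Proof. exact: (inI_range (lc_gt0 _) (ld_gt0 _) (lx_gt0 _) (ly_gt0 _)). Qed.

Lemma Ik_cover k z : 0 <= z < Jk k -> exists l, Ik k l z.
Proof. exact: (inI_cover (lc_gt0 _) (ld_gt0 _) (lx_gt0 _) (ly_gt0 _)). Qed.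

Lemma Ik_uniq k l l' z : Ik k l z -> Ik k l' z -> l = l'.
Proof. exact: (inI_uniq (lc_gt0 _) (ld_gt0 _) (lx_gt0 _) (ly_gt0 _)). Qed.

Lemma TkE k l z : Ik k l z -> Tk k z = z + trans (lc k) (ld k) (lx k) (ly k) l.
Proof. exact: (exchE (lc_gt0 _) (ld_gt0 _) (lx_gt0 _) (ly_gt0 _)). Qed.

Lemma J_sub k z : 0 <= z < Jk k -> 0 <= z < Jk 0.
Proof. by move=> /andP[-> h]; apply: lt_le_trans (Jk_le (leq0n k)). Qed.

Lemma hts_cons k l w : hts k (l :: w) = (ht k l + hts k w)%N. Proof. by []. Qed.

Lemma itinerary_return_word k l z : Ik k.+1 l z -> itinerary k (return_word k l) z (Tk k.+1 z).
Proof.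
have [_ m0 n0 [Ec Ed Ex Ey]] := ren k.
exact: (route_word (lc_gt0 _) (ld_gt0 _) (lx_gt0 _) (ly_gt0 _) m0 n0 Ec Ed Ex Ey). Qed.

Lemma iter_ht k l z : Ik k l z -> iter (ht k l) T z = Tk k z.
Proof.
elim: k l z => [//|k ih] l z /itinerary_return_word; rewrite /= -/(hts k (return_word k l)).
move: (Tk k.+1 z) => z'; elim: (return_word k l) z => [|l' w ihw] z /=; first by move->.
by move=> [h1 h2]; rewrite hts_cons addnC iterD (ih _ _ h1) (TkE h1) (ihw _ h2).
Qed.

Lemma ht_gt0 k l : (0 < ht k l)%N.
Proof.
elim: k l => // k ih l /=; case: l => /=; have := ih C; lia.
Qed.

Lemma ltn_hts_cons k l w i : (i < hts k (l :: w))%N ->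
  (i < ht k l)%N \/ exists2 j, i = (j + ht k l)%N & (j < hts k w)%N.
Proof.
rewrite hts_cons; have [|h] := ltnP i (ht k l); first by left.
by right; exists (i - ht k l)%N; lia.
Qed.

Definition notC (l : letter) := if l is C then false else true.

(** Level [k.+1] lives on the interval labelled [C] at level [k]. The absence of [C] after the first
    letter says that the word describes a first return. *)
Lemma return_wordE k l : exists2 w, return_word k l = C :: w & all notC w.
Proof.
rewrite /return_word /word; case: l => /=; eexists; try reflexivity.
all: rewrite /= ?all_cat ?all_nseq /= ?orbT //; by elim: (mm k).
Qed.

(** An intermediate time is either inside a tower of level [k], where induction applies, or at a
    base whose letter is not [C], hence to the right of [lc k], which is [Jk k.+1]. *)
Lemma no_early_return k l z i : Ik k l z -> (0 < i < ht k l)%N ->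
  Jk k <= iter i T z.
Proof.
elim: k l z i => [|k ih] l z i; first by rewrite /=; lia.
move=> /itinerary_return_word; rewrite /= -/(hts k (return_word k l)); have [w -> nw] := return_wordE k l.
move=> [zC hr] /andP[i0 /ltn_hts_cons[ih1|[j -> jw]]].
  by apply: le_trans (ih C z i zC _); [exact/ltW/Jk_decr|rewrite i0].
rewrite iterD (iter_ht zC) (TkE zC) Jk_succ.
elim: w {zC} (z + _) j nw hr jw => // l' w ihw v j /= /andP[nl nw] [vl hr].
move=> /ltn_hts_cons[jl|[j' -> jw]]; last first.
  by rewrite iterD (iter_ht vl) (TkE vl); apply: ihw.
case: j jl => [|j] jl.
  move: vl nl; rewrite /= /Ik /inI; case: l' {hr jl} => //= /andP[? ?] _;
    move: (lc_gt0 k) (ld_gt0 k) (lx_gt0 k) (ly_gt0 k) => ? ? ? ?; lra.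
by rewrite -Jk_succ; apply: le_trans (ih l' v j.+1 vl jl); exact/ltW/Jk_decr.
Qed.

Lemma iter_translation k l z z' i : Ik k l z -> Ik k l z' -> (i <= ht k l)%N ->
  iter i T z' - iter i T z = z' - z.
Proof.
elim: k l z z' i => [|k ih] l z z' i zl zl' /=.
  case: i => [|[|//]] //= _; rewrite (TkE zl) (TkE zl'); lra.
rewrite -/(hts k (return_word k l)).
move: (itinerary_return_word zl) (itinerary_return_word zl'); move: (Tk _ z) (Tk _ z') => v v'.
elim: (return_word k l) z z' i {zl zl'} => [|l' w ihw] z z' i /=.
  by case: i.
move=> [zl hr] [zl' hr']; rewrite hts_cons => hi.
have [il|li] := leqP i (ht k l'); first exact: (ih l').
rewrite -(subnK (ltnW li)) !iterD (iter_ht zl) (iter_ht zl') (TkE zl) (TkE zl').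
by rewrite (ihw _ _ _ hr hr'); [lra|lia].
Qed.

Lemma T_inj z z' : 0 <= z < Jk 0 -> 0 <= z' < Jk 0 -> T z = T z' -> z = z'.
Proof. exact: (exch_inj (lc_gt0 _) (ld_gt0 _) (lx_gt0 _) (ly_gt0 _)). Qed.

Lemma T_surj z : 0 <= z < Jk 0 -> exists2 w, 0 <= w < Jk 0 & T w = z.
Proof. exact: (exch_surj (lc_gt0 _) (ld_gt0 _) (lx_gt0 _) (ly_gt0 _)). Qed.

Lemma iterT_inj i z z' : 0 <= z < Jk 0 -> 0 <= z' < Jk 0 ->
  iter i T z = iter i T z' -> z = z'.
Proof.
move=> h h'; elim: i => //= i ih /T_inj e; apply: ih.
by apply: e; apply: Tk_iter_in.
Qed.

(** Cancelling common iterates by injectivity leaves one base point as an iterate of the other;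
    before the return time this can only be the zeroth iterate. *)
Lemma floor_uniq k l l' z z' i i' : Ik k l z -> Ik k l' z' ->
  (i < ht k l)%N -> (i' < ht k l')%N -> iter i T z = iter i' T z' ->
  [/\ l = l', i = i' & z = z'].
Proof.
wlog ii' : l l' z z' i i' / (i <= i')%N.
  move=> H zl zl' hi hi' e; have [le|lt] := leqP i i'; first exact: H.
  by have [] := H l' l z' z i' i (ltnW lt) zl' zl hi' hi (esym e).
move=> zl zl' hi hi'; rewrite -(subnKC ii') iterD => /iterT_inj e.
have ez : z = iter (i' - i) T z'.
  by apply: e; [exact: J_sub (Ik_J zl)|apply: Tk_iter_in; exact: J_sub (Ik_J zl')].
have [i0|i0] := posnP (i' - i).
  have ezz : z = z' by rewrite ez i0.
  have el : l = l' by apply: (Ik_uniq zl); rewrite ezz.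
  by split => //; lia.
have := no_early_return zl' (i := (i' - i)%N); rewrite -ez => /(_ _).
have /andP[_ zJ] := Ik_J zl.
by rewrite leNgt zJ => H; have : false by apply: H; lia.
Qed.

Lemma reached_Jk k z : 0 <= z < Jk 0 ->
  exists w j, 0 <= w < Jk k /\ z = iter j T w.
Proof.
move=> zJ; elim: k => [|k [w [j [wJ ->]]]]; first by exists z, 0%N.
have : exists w' i, 0 <= w' < lc k /\ w = iter i (Tk k) w'.
  have [_ m0 n0 [Ec Ed Ex Ey]] := ren k.
  exact: (reached_total (lc_gt0 _) (ld_gt0 _) (lx_gt0 _) (ly_gt0 _) m0 n0 Ec Ed Ex Ey).
move=> [w' [i [w'J ->]]].
have H : forall i, exists i', iter i (Tk k) w' = iter i' T w'.
  elim=> [|i0 [i' e]]; first by exists 0%N.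
  have : 0 <= iter i0 (Tk k) w' < Jk k.
    apply: Tk_iter_in; move: w'J; rewrite -Jk_succ => /andP[-> h].
    exact: lt_trans (Jk_decr k).
  move=> /Ik_cover[l hl]; exists (ht k l + i')%N.
  by rewrite iterD -e (iter_ht hl).
have [i' ->] := H i.
by exists w', (j + i')%N; rewrite Jk_succ; split => //; rewrite iterD.
Qed.

Lemma floor_cover k z : 0 <= z < Jk 0 ->
  exists l w i, [/\ Ik k l w, (i < ht k l)%N & z = iter i T w].
Proof.
move=> /(reached_Jk k)[w [j [wJ ->]]].
elim/ltn_ind: j w wJ => j ih w wJ.
have [l wl] := Ik_cover wJ.
have [jl|lj] := ltnP j (ht k l); first by exists l, w, j.
have -> : iter j T w = iter (j - ht k l) T (Tk k w).
  by rewrite -(iter_ht wl) -iterD subnK.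
by apply: ih (Tk_in wJ); have := ht_gt0 k l; lia.
Qed.

Lemma itinerary_visit k w1 l w2 z z' : itinerary k (w1 ++ l :: w2) z z' ->
  exists i, Ik k l (iter i T z).
Proof.
elim: w1 z => [|l1 w1 ih] z /=; first by move=> [h _]; exists 0%N.
move=> [h /ih[i hi]]; exists (i + ht k l1)%N.
by rewrite iterD (iter_ht h) (TkE h).
Qed.

Lemma return_word_visit k l l' z w1 w2 : Ik k.+1 l z -> return_word k l = w1 ++ l' :: w2 ->
  exists i, Ik k l' (iter i T z).
Proof. by move=> /itinerary_return_word + e; rewrite e => /itinerary_visit. Qed.

Lemma visit_all k l z : 0 <= z < Jk 0 -> exists i, Ik k l (iter i T z).
Proof.
move=> zJ; have [l2 [w [i [wl il ez]]]] := floor_cover k.+2 zJ.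
have [l3 vl] := Ik_cover (Tk_in (Ik_J wl)).
have {wl} ev : iter (ht k.+2 l2 - i) T z = Tk k.+2 w.
  by rewrite ez -iterD subnK ?(iter_ht wl) // ltnW.
move: (Tk _ w) vl ev => v vl ev.
have visit_trans l0 : (exists i, Ik k l0 (iter i T v)) ->
    exists i, Ik k l0 (iter i T z).
  by move=> [j hj]; exists (j + (ht k.+2 l2 - i))%N; rewrite iterD ev.
apply: visit_trans.
have step1 l0 : l0 = C \/ l0 = B2 \/ l0 = A2 -> exists i, Ik k.+1 l0 (iter i T v).
  case=> [->|[->|->]].
  - by have [w1 e _] := return_wordE k.+1 l3; apply: (return_word_visit (w1 := [::]) vl); exact: e.
  - by case: l3 vl => vl; apply: (return_word_visit (w1 := [:: C]) vl).
  - case: l3 vl => vl.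
    + by apply: (return_word_visit (w1 := [:: C; B2]) vl).
    + by apply: (return_word_visit (w1 := [:: C; B2]) vl).
    + by apply: (return_word_visit (w1 := [:: C; B2]) vl).
    + by apply: (return_word_visit (w1 := [:: C; B2]) vl).
    + apply: (return_word_visit (w1 := [:: C; B2] ++ nseq (nn k.+1).+1 B1 ++ [:: B2]) (w2 := [::]) vl).
      by rewrite /return_word /word -!catA.
    + apply: (return_word_visit (w1 := [:: C; B2] ++ nseq (nn k.+1) B1 ++ [:: B2]) (w2 := [::]) vl).
      by rewrite /return_word /word -!catA.
have step2 l0 l1 : l0 = C \/ l0 = B2 \/ l0 = A2 ->
    (exists w1 w2, return_word k l0 = w1 ++ l1 :: w2) -> exists i, Ik k l1 (iter i T v).
  move=> /step1[i1 h1] [w1 [w2 e]]; have [i2 h2] := return_word_visit h1 e.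
  by exists (i2 + i1)%N; rewrite iterD.
have [_ m0 n0 _] := ren k.
case: l.
- by apply: (step2 C); [left|exists [::]; eexists].
- apply: (step2 C); first by left.
  by rewrite /return_word /word; case: (mm k) m0 => // m _; exists [:: C; B2; A2]; eexists.
- apply: (step2 A2); first by right; right.
  by rewrite /return_word /word; case: (nn k) n0 => // n _; exists [:: C; B2; A2]; eexists.
- by apply: (step2 C); [left|exists [:: C; B2]; eexists].
- apply: (step2 B2); first by right; left.
  by rewrite /return_word /word; case: (nn k) n0 => // n _; exists [:: C; B2]; eexists.
- by apply: (step2 C); [left|exists [:: C]; eexists].
Qed.

End Towers.

(** * Heights and Birkhoff sums *)

(* nn k makes the A1 towers dominate the towers over A2 at level k + 1 up to a
   proportion 2^-k, so that averages along them converge; mm k makes the C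
   towers at least k + 1 times as high as the A2 towers. *)
Definition nparam (k : nat) (s : nat * nat * nat * nat) : nat :=
  let: (c, d, A, a) := s in (2 ^ k * (c + d + 4 * A))%N.

Definition mparam (k : nat) (s : nat * nat * nat * nat) : nat :=
  let: (c, d, A, a) := s in
  ((k.+1 * (c + 3 * A + nparam k s * a)) %/ (d + 2 * A)).+1.

(** The parameters of a level depend on its heights, and these on earlier parameters, so the heights
    are computed by a recursion of their own. Four numbers suffice because [B1] and [B2] have the
    heights of [A1] and [A2]. *)
Fixpoint heights (k : nat) : nat * nat * nat * nat :=
  if k is j.+1 then
    let: (c, d, A, a) := heights j in
    let A' := (c + 3 * A + nparam j (heights j) * a)%N in
    let c' := (c + 2 * A + mparam j (heights j) * (d + 2 * A))%N in
    (c', c' + (d + 2 * A), A', A' + a)%N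
  else (1, 1, 1, 1)%N.

Definition nn k := nparam k (heights k).
Definition mm k := mparam k (heights k).
Definition h k l := ht nn mm k l.
Arguments h : simpl never.

Lemma sumn_map_nseq (f : letter -> nat) n l : sumn [seq f i | i <- nseq n l] = (n * f l)%N.
Proof. by elim: n => //= n ->; rewrite mulSn. Qed.

Lemma sumn_map_DBA (f : letter -> nat) n w :
  sumn [seq f i | i <- flatten (nseq n w)] = (n * sumn [seq f i | i <- w])%N.
Proof. by elim: n => //= n ih; rewrite map_cat sumn_cat ih mulSn. Qed.

Lemma hS k l : h k.+1 l = sumn [seq h k i | i <- word (nn k) (mm k) l].
Proof. by []. Qed.

Lemma heightsE k : heights k = (h k C, h k D, h k A2, h k A1) /\
  h k B2 = h k A2 /\ h k B1 = h k A1.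
Proof.
elim: k => // k [e [eB2 eB1]].
have -> : heights k.+1 =
    (h k C + 2 * h k A2 + mm k * (h k D + 2 * h k A2),
     h k C + 2 * h k A2 + mm k * (h k D + 2 * h k A2) + (h k D + 2 * h k A2),
     h k C + 3 * h k A2 + nn k * h k A1,
     h k C + 3 * h k A2 + nn k * h k A1 + h k A1)%N.
  by rewrite /mm /nn /= {1}e.
rewrite !hS /word !map_cat !sumn_cat !sumn_map_nseq !sumn_map_DBA /= eB2 eB1.
by split; [congr (_, _, _, _); rewrite ?mulSn; lia | rewrite ?mulSn; lia].
Qed.

Lemma h_B2 k : h k B2 = h k A2. Proof. by have [_ []] := heightsE k. Qed.
Lemma h_B1 k : h k B1 = h k A1. Proof. by have [_ []] := heightsE k. Qed.

Lemma nnE k : nn k = (2 ^ k * (h k C + h k D + 4 * h k A2))%N.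
Proof. by rewrite /nn /nparam; have [-> _] := heightsE k. Qed.

Lemma h_A2S k : h k.+1 A2 = (h k C + 3 * h k A2 + nn k * h k A1)%N.
Proof.
have [] := heightsE k.+1; rewrite /=; have [e _] := heightsE k.
by rewrite {1}e => -[_ _ <-] _.
Qed.

Lemma h_A1S k : h k.+1 A1 = (h k.+1 A2 + h k A1)%N.
Proof.
have [] := heightsE k.+1; rewrite /=; have [e _] := heightsE k.
by rewrite {1}e => -[_ _ <- <-] _.
Qed.

Lemma h_CS k : h k.+1 C = (h k C + 2 * h k A2 + mm k * (h k D + 2 * h k A2))%N.
Proof.
have [] := heightsE k.+1; rewrite /=; have [e _] := heightsE k.
by rewrite {1}e => -[<- _ _ _] _.
Qed.

Lemma h_DS k : h k.+1 D = (h k.+1 C + (h k D + 2 * h k A2))%N.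
Proof.
have [] := heightsE k.+1; rewrite /=; have [e _] := heightsE k.
by rewrite {1}e => -[<- <- _ _] _.
Qed.

Lemma mmE k : mm k = ((k.+1 * h k.+1 A2) %/ (h k D + 2 * h k A2)).+1.
Proof.
have [] := heightsE k.+1; rewrite /mm /=; have [e _] := heightsE k.
by rewrite {1}e => -[_ _ <- _] _; rewrite /mparam e.
Qed.

Lemma h_gt0 k l : (0 < h k l)%N.
Proof. exact: ht_gt0. Qed.

Lemma mm_gt0 k : (0 < mm k)%N. Proof. by rewrite mmE. Qed.

Lemma nn_ge k : (2 ^ k * (h k C + h k D + 4 * h k A2) <= nn k * h k A1)%N.
Proof. by rewrite nnE leq_pmulr // h_gt0. Qed.

Lemma nn_gt0 k : (0 < nn k)%N.
Proof. by rewrite nnE muln_gt0 expn_gt0 /= -addnA addn_gt0 h_gt0. Qed.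

Lemma h_A2_ge k : (2 ^ k * (h k C + h k D + 4 * h k A2) <= h k.+1 A2)%N.
Proof. by rewrite h_A2S; have := nn_ge k; lia. Qed.

Lemma h_C_ge k : (k.+1 * h k.+1 A2 <= h k.+1 C)%N.
Proof.
rewrite h_CS mmE; set f := (h k D + 2 * h k A2)%N.
have f0 : (0 < f)%N by rewrite addn_gt0 h_gt0.
have := divn_eq (k.+1 * h k.+1 A2) f; have := ltn_pmod (k.+1 * h k.+1 A2) f0.
by rewrite mulSn; lia.
Qed.

Lemma h_CD k : (h k C <= h k D)%N.
Proof. by case: k => [//|k]; rewrite h_DS leq_addr. Qed.

(** The bound that keeps [mm] from growing too fast: B2 A2 retains a share of order at least 1/k in
    every block DBA. *)
Lemma h_D_le k : (h k.+1 D <= (k + 3) * h k.+1 A2)%N.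
Proof.
rewrite h_DS h_CS mmE; set f := (h k D + 2 * h k A2)%N.
have := divn_eq (k.+1 * h k.+1 A2) f; have := h_A2_ge k.
have : (0 < 2 ^ k)%N by rewrite expn_gt0.
move: (2 ^ k)%N => p p0 hp; set q := ((_ * _) %/ f)%N => e.
have : (h k C + h k D + 4 * h k A2 <= h k.+1 A2)%N.
  by apply: leq_trans hp; rewrite leq_pmull.
by rewrite mulSn mulnDl; move: e; rewrite -addn1 mulnDl /f; lia.
Qed.

Lemma h_growth k : (2 ^ k * (h k C + h k D + 4 * h k A2) <= h k.+1 C)%N.
Proof.
apply: leq_trans (h_A2_ge k) _; apply: leq_trans (h_C_ge k).
by rewrite leq_pmull.
Qed.

Definition small (s : bool) := if s then A1 else B1.
Definition big (s : bool) := if s then A2 else B2.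

Section Birkhoff.
Variables (R : realType) (lc ld lx ly : nat -> R).
Hypothesis ren : renormalizable lc ld lx ly nn mm.

Local Notation T := (Tk lc ld lx ly 0).
Local Notation I := (Ik lc ld lx ly).
Local Notation J := (Jk lc ld lx ly).

(** The only regularity asked of an observable. Uniform continuity implies it because the floors of
    deep towers are short. *)
Definition flat (phi : R -> R) : Prop := forall e : R, 0 < e ->
  exists K : nat, forall k l z z' i, (K <= k)%N -> I k l z -> I k l z' ->
  (i < h k l)%N -> `|phi (iter i T z) - phi (iter i T z')| <= e.

Variables (phi : R -> R) (M : R).
Hypothesis phi_le : forall z, 0 <= z < J 0 -> `|phi z| <= M.

(** A sum and not an average: deviations add up along concatenated words, and changing [t] costs a
    term linear in [N]. *)
Definition deviation (t : R) (N : nat) (z : R) : R :=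
  \sum_(0 <= i < N) (phi (iter i T z) - t).

Local Notation dev := deviation.

Definition near_avg (k : nat) (l : letter) (e t : R) : Prop :=
  forall z, I k l z -> `|dev t (h k l) z| <= e * (h k l)%:R.

Lemma M_ge0 : 0 <= M.
Proof.
by apply: le_trans (phi_le (z := 0) _); rewrite ?normr_ge0 // lexx (Jk_gt0 ren).
Qed.

Lemma devD t N1 N2 z : dev t (N1 + N2) z = dev t N1 z + dev t N2 (iter N1 T z).
Proof.
rewrite /dev (big_cat_nat _ (n := N1)) //= ?leq_addr //; congr (_ + _).
rewrite -[X in \sum_(X <= _ < _) _]add0n big_addn addKn; apply: eq_bigr => i _.
by rewrite iterD.
Qed.

Lemma dev_shift t t' N z : dev t N z = dev t' N z + N%:R * (t' - t).
Proof.
rewrite /dev mulr_natl -[X in _ *+ X]subn0 -sumr_const_nat -big_split /=.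
by apply: eq_bigr => i _; lra.
Qed.

Lemma dev_le t N z : `|t| <= M -> 0 <= z < J 0 -> `|dev t N z| <= 2 * M * N%:R.
Proof.
move=> tM zJ; rewrite /dev (le_trans (ler_norm_sum _ _ _))//.
rewrite [leRHS](_ : _ = \sum_(0 <= i < N) (2 * M)); last first.
  by rewrite big_const_nat iter_addr subn0 addr0 mulr_natr.
apply: ler_sum => i _; apply: le_trans (ler_normB _ _) _.
have := phi_le (Tk_iter_in ren i zJ); lra.
Qed.

Lemma dev_route k w t (e : letter -> R) z z' :
  (forall l v, I k l v -> `|dev t (h k l) v| <= e l) ->
  itinerary lc ld lx ly k w z z' ->
  `|dev t (hts nn mm k w) z| <= \sum_(l <- w) e l.
Proof.
move=> he; elim: w z => [|l w ih] z /=.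
  by move=> _; rewrite /dev big_nil big_geq // normr0.
move=> [zl hr]; rewrite hts_cons big_cons devD (le_trans (ler_normD _ _))//.
rewrite lerD //; first exact: he.
by rewrite (iter_ht ren zl) (TkE ren zl); apply: ih.
Qed.

Lemma dev_word k l t (e : letter -> R) z :
  (forall l v, I k l v -> `|dev t (h k l) v| <= e l) ->
  I k.+1 l z ->
  `|dev t (h k.+1 l) z| <= \sum_(i <- word (nn k) (mm k) l) e i.
Proof. by move=> he /(itinerary_return_word ren) /(dev_route he). Qed.

Lemma sum_nseq (e : letter -> R) n l : \sum_(i <- nseq n l) e i = n%:R * e l.
Proof. by elim: n => [|n ih]; rewrite ?big_nil ?mul0r // /= big_cons ih -natr1; lra. Qed.

Lemma I_J0 k l z : I k l z -> 0 <= z < J 0.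
Proof. by move=> /(Ik_J ren)/(J_sub ren). Qed.

Let hR_gt0 k l : (0 : R) < (h k l)%:R. Proof. by rewrite ltr0n h_gt0. Qed.

(** Apart from at least [nn k] towers over [small s], the word crosses one tower over C and three of
    the height of [A2], where only the trivial bound [2 * M] is available. By the choice of [nn]
    these take up a share of at most [1 / 2 ^+ k]. *)
Lemma near_avg_side s k e v : 0 <= e -> `|v| <= M -> near_avg k (small s) e v ->
  near_avg k.+1 (small s) (e + 2 * M / 2 ^+ k) v /\
  near_avg k.+1 (big s) (e + 2 * M / 2 ^+ k) v.
Proof.
move=> e0 vM hA.
pose f (l : letter) := (match l, s with A1, true | B1, false => e
                       | _, _ => 2 * M end) * (h k l)%:R.
have hf l w : I k l w -> `|dev v (h k l) w| <= f l.
  case: l s hA @f => [] [] hA f wl; rewrite /f;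
    by [apply: hA | apply: dev_le => //; exact: I_J0 wl].
have M0 := M_ge0.
have p0 : (0 : R) < 2 ^+ k by rewrite exprn_gt0.
have key : 2 * M * (h k C + 3 * h k A2)%:R <= 2 * M / 2 ^+ k * (nn k * h k A1)%:R.
  rewrite -!mulrA; do 2!apply: ler_wpM2l => //.
  rewrite mulrC ler_pdivlMr // -natrX -natrM ler_nat.
  by have := nn_ge k; lia.
have n0 : 0 <= (h k C)%:R :> R by rewrite ler0n.
have n1 : 0 <= (h k A1)%:R :> R by rewrite ler0n.
have n2 : 0 <= (h k A2)%:R :> R by rewrite ler0n.
have q0 : 0 <= 2 * M / 2 ^+ k by rewrite divr_ge0 ?mulr_ge0 // ltW.
have n3 : 0 <= (nn k)%:R * (h k A1)%:R :> R by rewrite -natrM ler0n.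
move: key; rewrite natrD !natrM => key.
have g1 : 0 <= e * (h k C)%:R by rewrite mulr_ge0.
have g2 : 0 <= e * (h k A2)%:R by rewrite mulr_ge0.
have g3 : 0 <= 2 * M / 2 ^+ k * (h k C)%:R by rewrite mulr_ge0.
have g4 : 0 <= 2 * M / 2 ^+ k * (h k A2)%:R by rewrite mulr_ge0.
have g5 : 0 <= 2 * M / 2 ^+ k * (h k A1)%:R by rewrite mulr_ge0.
case: s {hA} @f hf => f hf; split=> z zl; apply: le_trans (dev_word hf zl) _;
  rewrite /word !big_cat !sum_nseq !big_cons !big_nil /f /= ?h_B2 ?h_B1 ?h_B2
    ?h_A1S h_A2S;
  rewrite -?[n in n.+1%:R]addn1 !natrD !natrM ?natrD ?natrM; lra.
Qed.

Lemma div_exp2_le (a e : R) : 0 < e -> 0 <= a ->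
  exists K : nat, forall k, (K <= k)%N -> a / 2 ^+ k <= e.
Proof.
move=> e0 a0; exists (Num.bound (a / e)) => k Kk.
rewrite ler_pdivrMr ?exprn_gt0 // mulrC -ler_pdivrMr // -natrX.
apply: le_trans (ltW (archi_boundP _)) _; first by rewrite divr_ge0 // ltW.
by rewrite ler_nat (leq_trans Kk) // ltnW // ltn_expl.
Qed.

Lemma div_nat_le (a e : R) : 0 < e -> 0 <= a ->
  exists K : nat, forall k, (K <= k)%N -> a <= e * k%:R.
Proof.
move=> e0 a0; exists (Num.bound (a / e)) => k Kk.
rewrite mulrC -ler_pdivrMr //.
apply: le_trans (ltW (archi_boundP _)) _; first by rewrite divr_ge0 // ltW.
by rewrite ler_nat.
Qed.

Lemma near_avg_le k l e e' t : e <= e' -> near_avg k l e t -> near_avg k l e' t.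
Proof.
by move=> ee' H z /H/le_trans; apply; rewrite ler_wpM2r.
Qed.

(** The value [v] is the average along one orbit segment, that of the left endpoint of the base;
    flatness carries it to the whole tower and [near_avg_side] to the next level. It depends on [k]:
    convergence will come from an invariant measure concentrated on the side. *)
Lemma near_avg_const (e : R) : flat phi -> 0 < e -> exists K : nat, forall k s,
  (K <= k)%N -> exists2 v, `|v| <= M & near_avg k (small s) e v /\ near_avg k (big s) e v.
Proof.
move=> level e0; have e20 : 0 < e / 2 by lra.
have [K1 HK1] := level _ e20.
have [K2 HK2] := div_exp2_le e20 (mulr_ge0 (ler0n R 2) M_ge0).
exists (maxn K1 K2).+1 => -[//|k] s; rewrite ltnS geq_max => /andP[k1 k2].
pose z0 := lft (lc k) (ld k) (lx k) (ly k) (small s).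
have z0I : I k (small s) z0.
  have [[? ? ? y0] _ _ _] := ren k.
  by rewrite /Ik /inI /z0 lexx /=; case: s @z0 => z0 /=; lra.
have hn0 : (0 : R) < (h k (small s))%:R by [].
pose v := (\sum_(0 <= i < h k (small s)) phi (iter i T z0)) / (h k (small s))%:R.
have vM : `|v| <= M.
  rewrite /v normrM [`|_^-1|]gtr0_norm ?invr_gt0 // ler_pdivrMr //.
  rewrite (le_trans (ler_norm_sum _ _ _))//.
  rewrite mulr_natr -[X in M *+ X]subn0 -sumr_const_nat.
  by apply: ler_sum => i _; apply/phi_le/Tk_iter_in => //; apply: I_J0 z0I.
exists v => //.
suff : near_avg k (small s) (e / 2) v.
  move=> /(near_avg_side (ltW e20) vM)[hs hb].
  by split; [move: hs|move: hb]; apply: near_avg_le; have := HK2 _ k2; lra.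
move=> z zI.
have -> : dev v (h k (small s)) z =
    \sum_(0 <= i < h k (small s)) (phi (iter i T z) - phi (iter i T z0)).
  rewrite /dev !sumrB; congr (_ - _).
  rewrite sumr_const_nat subn0 -[LHS]mulr_natr /v divfK //.
  by rewrite gt_eqF.
rewrite (le_trans (ler_norm_sum _ _ _))// mulr_natr -[X in _ *+ X]subn0 -sumr_const_nat.
rewrite big_seq [leRHS]big_seq; apply: ler_sum => i; rewrite mem_index_iota => hi.
exact: (HK1 k (small s)).
Qed.

(** * Averages along the towers over C and D and along the orbit of 0 *)

Section TwoLimits.
Variable th : bool -> R.
Hypothesis th_le : forall s, `|th s| <= M.
Hypothesis th_lim : forall s e, 0 < e -> exists K : nat, forall k, (K <= k)%N ->
  near_avg k (big s) e (th s).

Definition thm : R := (th true + th false) / 2.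

Lemma thm_le : `|thm| <= M.
Proof.
rewrite /thm; move: (th_le true) (th_le false); rewrite !ler_norml.
by move=> /andP[? ?] /andP[? ?]; apply/andP; split; lra.
Qed.

Lemma dev_block k X eta z b : I k X z ->
  near_avg k A2 eta (th true) -> near_avg k B2 eta (th false) ->
  I k B2 (iter (h k X) T z) -> I k A2 (iter (h k X + h k B2) T z) ->
  `|dev thm (h k X) z| <= b ->
  `|dev thm (h k X + h k B2 + h k A2) z| <= b + 2 * eta * (h k A2)%:R.
Proof.
move=> zX hA hB zB zA hb.
have := hB _ zB; have := hA _ zA; rewrite !devD.
rewrite [dev thm _ (iter (h k X) T z)](dev_shift _ (th false)).
rewrite [dev thm _ (iter (_ + _) T z)](dev_shift _ (th true)) h_B2.
move: hb; set p := dev _ _ _; set r := dev _ _ _; set q := dev _ _ _.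
rewrite !ler_norml /thm.
have -> : p + (q + (h k A2)%:R * (th false - (th true + th false) / 2)) +
   (r + (h k A2)%:R * (th true - (th true + th false) / 2)) = p + q + r by lra.
by move=> /andP[? ?] /andP[? ?] /andP[? ?]; apply/andP; split; lra.
Qed.

(* B2 and A2 have the same height, so a block X B2 A2 visits the two sides
   equally often. *)
Lemma dev_blocks k X eta Y n z z' : near_avg k A2 eta (th true) ->
  near_avg k B2 eta (th false) -> near_avg k X (eta + Y) thm ->
  itinerary lc ld lx ly k (flatten (nseq n [:: X; B2; A2])) z z' ->
  `|dev thm (n * (h k X + 2 * h k A2)) z| <=
    n%:R * (eta * (h k X + 2 * h k A2)%:R + Y * (h k X)%:R).
Proof.
move=> hA hB hX; elim: n z => [|n ih] z.
  by move=> _; rewrite mul0r /dev big_geq // normr0.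
rewrite [flatten _]/= => -[zX [zB [zA hr]]].
have eB : iter (h k X) T z = z + trans (lc k) (ld k) (lx k) (ly k) X.
  by rewrite (iter_ht ren zX) (TkE ren zX).
have eA : iter (h k X + h k B2) T z = z + trans (lc k) (ld k) (lx k) (ly k) X
    + trans (lc k) (ld k) (lx k) (ly k) B2.
  by rewrite addnC iterD eB (iter_ht ren zB) (TkE ren zB).
have eC : iter (h k X + h k B2 + h k A2) T z = z + trans (lc k) (ld k) (lx k) (ly k) X
    + trans (lc k) (ld k) (lx k) (ly k) B2 + trans (lc k) (ld k) (lx k) (ly k) A2.
  by rewrite addnC iterD eA (iter_ht ren zA) (TkE ren zA).
have eh : (h k X + 2 * h k A2 = h k X + h k B2 + h k A2)%N by rewrite h_B2; lia.
rewrite mulSn devD.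
have := ih _ hr; rewrite -eC -eh => ih'.
rewrite (le_trans (ler_normD _ _)) // -natr1 mulrDl mul1r [leRHS]addrC lerD //.
rewrite eh; apply: (le_trans (dev_block zX hA hB _ _ (hX _ zX))).
- by rewrite eB.
- by rewrite eA.
- by rewrite h_B2 !natrD; lra.
Qed.

Lemma itinerary_split k w1 w2 z z' : itinerary lc ld lx ly k (w1 ++ w2) z z' ->
  itinerary lc ld lx ly k w1 z (iter (hts nn mm k w1) T z) /\
  itinerary lc ld lx ly k w2 (iter (hts nn mm k w1) T z) z'.
Proof.
elim: w1 z => [|l w ih] z //= [zl /ih[h1 h2]].
rewrite hts_cons addnC iterD (iter_ht ren zl) (TkE ren zl).
by split => //; split.
Qed.

Lemma hts_blocks k X n :
  hts nn mm k (flatten (nseq n [:: X; B2; A2])) = (n * (h k X + 2 * h k A2))%N.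
Proof.
elim: n => // n ih; rewrite [flatten _]/= !hts_cons ih -!/(h k _) h_B2 mulSn; lia.
Qed.

Lemma itinerary_CD k l z : l = C \/ l = D -> I k.+1 l z ->
  let n := (mm k + (if l is D then 1 else 0))%N in
  h k.+1 l = (1 * (h k C + 2 * h k A2) + n * (h k D + 2 * h k A2))%N /\
  exists z', itinerary lc ld lx ly k (flatten (nseq 1 [:: C; B2; A2]) ++
                 flatten (nseq n [:: D; B2; A2])) z z'.
Proof.
case=> -> zl n; rewrite /n ?addn0 ?addn1; split; rewrite ?h_DS ?h_CS; try lia.
- by exists (Tk lc ld lx ly k.+1 z); apply: (itinerary_return_word ren zl).
- by exists (Tk lc ld lx ly k.+1 z); apply: (itinerary_return_word ren zl).
Qed.

(** The two sides compensate in each block X B2 A2, so the excess [Y] is carried by X alone, and X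
    fills at most [k / k.+1] of the block by [h_D_le]. *)
Lemma near_avg_CD_step k eta Y : (1 < k)%N -> 0 <= Y ->
  near_avg k A2 eta (th true) -> near_avg k B2 eta (th false) ->
  (forall X, X = C \/ X = D -> near_avg k X (eta + Y) thm) ->
  (forall X, X = C \/ X = D -> near_avg k.+1 X (eta + Y * (k%:R / k.+1%:R)) thm).
Proof.
move=> k1 Y0 hA hB hX X XCD z zX.
have [-> [z' /itinerary_split[h1 h2]]] := itinerary_CD XCD zX; move: (_ + _)%N h1 h2 => n h1 h2.
rewrite devD; rewrite hts_blocks in h1 h2.
have b1 := dev_blocks hA hB (hX _ (or_introl erefl)) h1.
have b2 := dev_blocks hA hB (hX _ (or_intror erefl)) h2.
have k0 : (0 : R) < k.+1%:R by [].
have hh X0 : X0 = C \/ X0 = D -> Y * (h k X0)%:R <=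
    Y * (k%:R / k.+1%:R) * (h k X0 + 2 * h k A2)%:R.
  move=> hX0; rewrite -mulrA ler_wpM2l // mulrAC ler_pdivlMr // -!natrM ler_nat.
  have : (h k X0 <= 2 * k * h k A2)%N.
    have : (h k X0 <= h k D)%N by case: hX0 => ->; rewrite ?h_CD.
    move/leq_trans; apply; case: k k1 {hA hB hX z' h1 h2 b1 b2 k0 zX} => // k k1.
    by apply: leq_trans (h_D_le k) _; rewrite leq_mul2r; lia.
  by rewrite mulnS mulnDr; lia.
have := hh C (or_introl erefl); have := hh D (or_intror erefl).
rewrite (le_trans (ler_normD _ _)) // natrD !natrM mulrDr.
rewrite lerD //.
  apply: le_trans b1 _; rewrite !mul1r mulrDl lerD2l; exact: hh (or_introl erefl).
apply: le_trans b2 _; rewrite mulrCA ler_wpM2l // mulrDl lerD2l.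
exact: hh (or_intror erefl).
Qed.

Lemma near_avg_CD (e : R) : 0 < e -> exists K : nat, forall k X, (K <= k)%N ->
  X = C \/ X = D -> near_avg k X e thm.
Proof.
move=> e0; have e20 : 0 < e / 2 by lra.
have [Ka HKa] := th_lim true e20.
have [Kb HKb] := th_lim false e20.
pose K := (Ka + Kb + 2)%N.
have M0 := M_ge0.
have K0 : (0 : R) < K%:R by rewrite ltr0n /K; lia.
(* The factors [k / k.+1] telescope; the induction starts at level [K] from the trivial bound
   [2 * M]. *)
have key j : forall X, X = C \/ X = D ->
    near_avg (K + j) X (e / 2 + 2 * M * K%:R / (K + j)%:R) thm.
  elim: j => [|j ih] X hX.
    move=> z zX; rewrite addn0 in zX *; rewrite -mulrA divff ?gt_eqF // mulr1.
    apply: le_trans (dev_le _ (thm_le) (I_J0 zX)) _.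
    by rewrite ler_wpM2r //; lra.
  rewrite addnS.
  have := @near_avg_CD_step (K + j) (e / 2) (2 * M * K%:R / (K + j)%:R) _ _ _ _ ih X hX.
  have n0 : ((K + j)%:R : R) != 0 by rewrite pnatr_eq0 /K; lia.
  rewrite (_ : _ / _ * (_ / _) = 2 * M * K%:R / (K + j).+1%:R); last first.
    by rewrite mulrA divfK.
  apply.
  - by rewrite /K; lia.
  - by rewrite divr_ge0 ?mulr_ge0 // ltW.
  - by apply: HKa; rewrite /K; lia.
  - by apply: HKb; rewrite /K; lia.
have [K' HK'] := div_nat_le e20 (mulr_ge0 (mulr_ge0 (ler0n R 2) M0) (ltW K0)).
exists (K + K')%N => k X kK hX.
have := key (k - K)%N X hX; rewrite subnKC; last by lia.
apply: near_avg_le.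
have k0 : (0 : R) < k%:R by rewrite ltr0n /K in kK *; lia.
have : 2 * M * K%:R / k%:R <= e / 2 by rewrite ler_pdivrMr // HK' //; lia.
lra.
Qed.

(* Only the last, incomplete block X B2 A2 contributes to the error: at most G
   along X and 2M at each point of B2 A2. *)
Lemma dev_prefix k eta G X n z z' r : 0 <= eta -> 0 <= G ->
  near_avg k A2 eta (th true) -> near_avg k B2 eta (th false) ->
  near_avg k X eta thm ->
  (forall v r, I k X v -> (r <= h k X)%N -> `|dev thm r v| <= G) ->
  itinerary lc ld lx ly k (flatten (nseq n [:: X; B2; A2])) z z' ->
  (r <= n * (h k X + 2 * h k A2))%N ->
  `|dev thm r z| <= eta * r%:R + (G + 4 * M * (h k A2)%:R).
Proof.
move=> eta0 G0 hA hB hX hG.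
have M0 := M_ge0.
set f := (h k X + 2 * h k A2)%N.
elim: n z r => [|n ih] z r.
  move=> _; rewrite mul0n leqn0 => /eqP ->.
  by rewrite /dev big_geq // normr0 mulr0 add0r addr_ge0 // mulr_ge0 // mulr_ge0.
rewrite [flatten _]/= -[[:: X, B2, A2 & _]]/(flatten (nseq 1 [:: X; B2; A2]) ++ flatten (nseq n [:: X; B2; A2])).
move=> /itinerary_split[h1 h2]; rewrite hts_blocks mul1n -/f in h1 h2.
have [fr|rf] := leqP f r => hrn.
  rewrite -(subnKC fr) devD natrD mulrDr (le_trans (ler_normD _ _)) // -addrA.
  rewrite lerD //; last by apply: ih h2 _; lia.
  have := dev_blocks (X := X) (eta := eta) (Y := 0) hA hB; rewrite addr0.
  by move=> /(_ _ _ _ hX h1); rewrite mul1n mul1r mul0r addr0.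
have zX : I k X z by case: h1.
have [rX|Xr] := leqP r (h k X).
  apply: (le_trans (hG _ _ zX rX)).
  by rewrite addrCA lerDl addr_ge0 // mulr_ge0 // mulr_ge0.
rewrite -(subnKC (ltnW Xr)) devD (le_trans (ler_normD _ _)) // natrD mulrDr -addrA.
rewrite lerD //; first exact: hX.
apply: le_trans (dev_le _ thm_le (Tk_iter_in ren _ (I_J0 zX))) _.
have : (r - h k X)%:R <= 2 * (h k A2)%:R :> R by rewrite -natrM ler_nat; lia.
move=> /(ler_wpM2l (mulr_ge0 (ler0n R 2) M0)).
have : 0 <= eta * (r - h k X)%:R by rewrite mulr_ge0.
lra.
Qed.

Lemma zero_C k : I k C 0.
Proof. by have [[c0 _ _ _] _ _ _] := ren k; rewrite /Ik /inI /= lexx add0r. Qed.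

(** The opening block C B2 A2 and the run of blocks D B2 A2 are each charged for one broken block,
    hence the factor 2. *)
Lemma dev_prefix_CD k eta G X z r : X = C \/ X = D -> 0 <= eta -> 0 <= G ->
  near_avg k A2 eta (th true) -> near_avg k B2 eta (th false) ->
  (forall Y, Y = C \/ Y = D -> near_avg k Y eta thm) ->
  (forall Y v r, Y = C \/ Y = D -> I k Y v -> (r <= h k Y)%N ->
    `|dev thm r v| <= G) ->
  I k.+1 X z -> (r <= h k.+1 X)%N ->
  `|dev thm r z| <= eta * r%:R + 2 * (G + 4 * M * (h k A2)%:R).
Proof.
move=> hX eta0 G0 hA hB hCD hG zX.
have M0 := M_ge0.
have H0 : 0 <= G + 4 * M * (h k A2)%:R by rewrite addr_ge0 // mulr_ge0 // mulr_ge0.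
have [-> [z' /itinerary_split[h1 h2]]] := itinerary_CD hX zX; move: (_ + _)%N h1 h2 => n h1 h2.
rewrite hts_blocks in h1 h2.
have hC : C = C \/ C = D by left.
have hD : D = C \/ D = D by right.
have [rC|Cr] := leqP r (1 * (h k C + 2 * h k A2)) => hr.
  apply: (le_trans (dev_prefix eta0 G0 hA hB (hCD _ hC) (fun v r => hG _ v r hC) h1 rC)).
  by lra.
rewrite -(subnKC (ltnW Cr)) devD (le_trans (ler_normD _ _)) // natrD mulrDr.
have := dev_prefix eta0 G0 hA hB (hCD _ hC) (fun v r => hG _ v r hC) h1 (leqnn _).
have := @dev_prefix k eta G D n _ _ (r - 1 * (h k C + 2 * h k A2)) eta0 G0 hA hB (hCD _ hD) (fun v r => hG _ v r hD) h2.
by move=> /(_ ltac:(lia)); lra.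
Qed.

(** Let [N] lie between the heights of the C towers of levels [k.+1] and [k.+2]. The trivial bound
    on a broken tower of level [k.+1] could be comparable to [N], so that tower is cut in turn into
    towers of level [k], whose heights are negligible by [h_growth]. *)
Lemma dev_zero (e : R) : 0 < e -> exists N0 : nat, forall N, (N0 <= N)%N ->
  `|dev thm N 0| <= e * N%:R.
Proof.
(* For large [N] the error terms add up to at most [9 * eta * N%:R], less than [e / 2 * N%:R]; the
   other half of [e] absorbs the constant [c0] coming from the initial levels. *)
move=> e0; have M0 := M_ge0; pose eta := e / 20.
have eta0 : 0 < eta by rewrite /eta; lra.
have [Ka HKa] := th_lim true eta0.
have [Kb HKb] := th_lim false eta0.
have [Kc HKc] := near_avg_CD eta0.
have [Kd HKd] := div_exp2_le eta0 (mulr_ge0 (ler0n R 16) M0).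
have [Ke HKe] := div_nat_le eta0 (mulr_ge0 (ler0n R 8) M0).
pose K := (Ka + Kb + Kc + Kd + Ke + 2)%N.
pose c0 := 2 * M * (h K C)%:R.
have c0_ge0 : 0 <= c0 by rewrite mulr_ge0 // mulr_ge0.
have key j : forall N, (N <= h (K + j) C)%N -> `|dev thm N 0| <= e / 2 * N%:R + c0.
  elim: j => [|j ih] N hN.
    rewrite addn0 in hN.
    apply: le_trans (dev_le N thm_le (z := 0) _) _; first exact: I_J0 (zero_C 0).
    have : 2 * M * N%:R <= c0 by rewrite ler_wpM2l ?mulr_ge0 // ler_nat.
    have : 0 <= e / 2 * N%:R by rewrite mulr_ge0 //; lra.
    lra.
  have [|hN'] := leqP N (h (K + j) C); first exact: ih.
  rewrite addnS in hN.
  have {ih} [k ek] : exists k, (K + j)%N = k.+1 by exists (K + j).-1; rewrite /K; lia.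
  rewrite ek in hN hN'.
  have kK : (Ka + Kb + Kc + Kd + Ke + 1 <= k)%N by rewrite /K in ek; lia.
  have near k0 : (k <= k0)%N -> [/\ near_avg k0 A2 eta (th true),
      near_avg k0 B2 eta (th false) &
      forall Y, Y = C \/ Y = D -> near_avg k0 Y eta thm].
    by move=> kk0; split; [apply: HKa|apply: HKb|move=> Y; apply: HKc]; lia.
  have [hA hB hCD] := near k (leqnn _).
  have [hA' hB' hCD'] := near k.+1 (leqnSn _).
  pose G := 2 * M * (h k D)%:R.
  have G0 : 0 <= G by rewrite mulr_ge0 // mulr_ge0.
  have hG Y v r : Y = C \/ Y = D -> I k Y v -> (r <= h k Y)%N -> `|dev thm r v| <= G.
    move=> hY vY hr; apply: le_trans (dev_le r thm_le (I_J0 vY)) _.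
    rewrite ler_wpM2l ?mulr_ge0 // ler_nat (leq_trans hr) //.
    by case: hY => ->; rewrite ?h_CD.
  pose G' := eta * (h k.+1 D)%:R + 2 * (G + 4 * M * (h k A2)%:R).
  have H4 k0 : 0 <= 4 * M * (h k0 A2)%:R by rewrite mulr_ge0 // mulr_ge0.
  have G'0 : 0 <= G'.
    by rewrite addr_ge0 // mulr_ge0 // ?addr_ge0 // ltW.
  have hG' Y v r : Y = C \/ Y = D -> I k.+1 Y v -> (r <= h k.+1 Y)%N ->
      `|dev thm r v| <= G'.
    move=> hY vY hr; apply: le_trans (dev_prefix_CD hY (ltW eta0) G0 hA hB hCD hG vY hr) _.
    rewrite lerD2r ler_wpM2l // ?(ltW eta0) // ler_nat (leq_trans hr) //.
    by case: hY => ->; rewrite ?h_CD.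
  have := dev_prefix_CD (or_introl erefl) (ltW eta0) G'0 hA' hB' hCD' hG' (zero_C k.+2) hN.
  move/le_trans; apply.
  have N0 : (0 : R) <= N%:R by [].
  have hNC : (h k.+1 C)%:R <= N%:R :> R by rewrite ler_nat ltnW.
  have hD3 : (h k.+1 D)%:R <= 3 * (h k.+1 C)%:R :> R.
    rewrite -natrM ler_nat (leq_trans (h_D_le k)) //.
    have := h_C_ge k; have : (1 <= k)%N by lia.
    by move=> k1 hc; apply: leq_trans (leq_mul (leqnn 3) hc); rewrite mulnA leq_mul2r; lia.
  have hA1 : 8 * M * (h k.+1 A2)%:R <= eta * (h k.+1 C)%:R.
    have : eta * (k.+1 * h k.+1 A2)%:R <= eta * (h k.+1 C)%:R.
      by rewrite ler_wpM2l ?(ltW eta0) // ler_nat h_C_ge.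
    apply: le_trans; rewrite natrM mulrA ler_wpM2r //.
    by apply: HKe; lia.
  have hg : 16 * M * (h k D + 4 * h k A2)%:R <= eta * (h k.+1 C)%:R.
    have hk : 16 * M / 2 ^+ k <= eta by apply: HKd; lia.
    have p0 : (0 : R) < 2 ^+ k by rewrite exprn_gt0.
    have hk' : 16 * M <= eta * 2 ^+ k by rewrite -ler_pdivrMr.
    apply: (@le_trans _ _ (eta * 2 ^+ k * (h k D + 4 * h k A2)%:R)).
      by rewrite ler_wpM2r.
    rewrite -mulrA ler_wpM2l ?(ltW eta0) // -natrX -natrM ler_nat.
    by apply: leq_trans (h_growth k); rewrite leq_mul2l -addnA leq_addl orbT.
  have ea : eta * (h k.+1 D)%:R <= eta * (3 * (h k.+1 C)%:R).
    by rewrite ler_wpM2l // ltW.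
  have eb : eta * (h k.+1 C)%:R <= eta * N%:R by rewrite ler_wpM2l // ltW.
  have pg : 0 <= M * (h k D)%:R by rewrite mulr_ge0.
  have pp : 0 <= M * (h k A2)%:R by rewrite mulr_ge0.
  have pN : 0 <= eta * N%:R by rewrite mulr_ge0 // ltW.
  have ee : e = 20 * eta by rewrite /eta; lra.
  move: hg; rewrite natrD natrM => hg.
  rewrite /G' /G ee; lra.
have e20 : 0 < e / 2 by lra.
have [N1 HN1] := div_nat_le e20 c0_ge0.
exists N1 => N hN.
have hk k : (k <= h k C)%N.
  case: k => // k; apply: leq_trans (h_growth k).
  apply: leq_trans (ltn_expl k (ltnSn 1)) _; rewrite leq_pmulr //.
  by rewrite -addnA addn_gt0 h_gt0.
have := key N N (leq_trans (leq_addl K N) (hk _)).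
have := HN1 N hN; lra.
Qed.

End TwoLimits.
End Birkhoff.

(** * Existence of lengths *)

Section Lengths.
Variable R : realType.

(** Dividing by [(nn j).+1] makes the seed of level [k.+1] produce at level [k] an interval [A1] of
    length exactly [seed k]; hence a deeper approximation can only increase the lengths. *)
Fixpoint seed (k : nat) : R := if k is j.+1 then seed j / (nn j).+1%:R else 1.

(* Lengths at level k when the intervals of level k + j are reduced to the two
   letters A1 and B1, each of length seed (k + j). *)
Fixpoint approx (j k : nat) : R * R * R * R :=
  if j is i.+1 then
    let: (c, d, x, y) := approx i k.+1 in
    (c + d + 2 * (x + y), (mm k)%:R * (c + d) + d,
     ((mm k)%:R + 1) * (c + d) + d + 3 * (x + y), (nn k)%:R * (x + y) + y)
  else (0, 0, 0, seed k).

Definition ac j k := (approx j k).1.1.1.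
Definition ad j k := (approx j k).1.1.2.
Definition ax j k := (approx j k).1.2.
Definition ay j k := (approx j k).2.

Lemma acS j k : ac j.+1 k = ac j k.+1 + ad j k.+1 + 2 * (ax j k.+1 + ay j k.+1).
Proof. by rewrite /ac /ad /ax /ay /=; case: approx => [[[]]]. Qed.
Lemma adS j k : ad j.+1 k = (mm k)%:R * (ac j k.+1 + ad j k.+1) + ad j k.+1.
Proof. by rewrite /ac /ad /ax /ay /=; case: approx => [[[]]]. Qed.
Lemma axS j k : ax j.+1 k = ((mm k)%:R + 1) * (ac j k.+1 + ad j k.+1) + ad j k.+1
             + 3 * (ax j k.+1 + ay j k.+1).
Proof. by rewrite /ac /ad /ax /ay /=; case: approx => [[[]]]. Qed.
Lemma ayS j k : ay j.+1 k = (nn k)%:R * (ax j k.+1 + ay j k.+1) + ay j k.+1.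
Proof. by rewrite /ac /ad /ax /ay /=; case: approx => [[[]]]. Qed.

Lemma seed_gt0 k : 0 < seed k.
Proof. by elim: k => //= k ih; rewrite divr_gt0. Qed.

Lemma seed_le1 k : seed k <= 1.
Proof.
elim: k => //= k ih; rewrite ler_pdivrMr // mul1r (le_trans ih) //.
by rewrite ler1n.
Qed.

Lemma approx_ge0 j k : [/\ 0 <= ac j k, 0 <= ad j k, 0 <= ax j k & 0 <= ay j k].
Proof.
elim: j k => [|j ih] k; first by split => //; apply/ltW/seed_gt0.
have [? ? ? ?] := ih k.+1; rewrite acS adS axS ayS.
by split; rewrite !addr_ge0 // ?mulr_ge0 // ?addr_ge0.
Qed.

Lemma approx_mono j k : [/\ ac j k <= ac j.+1 k, ad j k <= ad j.+1 k,
  ax j k <= ax j.+1 k & ay j k <= ay j.+1 k].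
Proof.
elim: j k => [|j ih] k.
  have [? ? ? ?] := approx_ge0 1 k; split => //.
  rewrite ayS /ay /ax /= add0r -[X in _ + X]mul1r -mulrDl natr1 mulrCA.
  by rewrite divff ?mulr1 // pnatr_eq0.
have [? ? ? ?] := ih k.+1; rewrite (acS j.+1 k) (acS j k) (adS j.+1 k) (adS j k) (axS j.+1 k) (axS j k)
  (ayS j.+1 k) (ayS j k).
have m0 : (0 : R) <= (mm k)%:R by [].
have n0 : (0 : R) <= (nn k)%:R by [].
split.
- by lra.
- by rewrite lerD // ler_wpM2l // lerD.
- rewrite lerD //; last by lra.
  by rewrite lerD // ler_wpM2l ?addr_ge0 // lerD.
- by rewrite lerD // ler_wpM2l // lerD.
Qed.

(** The area of an [A1] tower with base [seed k]; together with its [B1] twin it fills the domain of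
    the approximation of depth [k]. *)
Definition Hr k : R := (h k A1)%:R * seed k.

(** Heights and lengths are transformed by transposed matrices, so the total area of the towers is
    the same at all levels. It is evaluated at level [k + j], where only [A1] and [B1] are left. *)
Lemma approx_area j k : (h k C)%:R * ac j k + (h k D)%:R * ad j k
  + 2 * (h k A2)%:R * ax j k + 2 * (h k A1)%:R * ay j k = 2 * Hr (k + j).
Proof.
elim: j k => [|j ih] k.
  by rewrite /ac /ad /ax /ay /= addn0 /Hr; ring.
rewrite addnS -addSn -ih acS adS axS ayS h_DS h_CS h_A1S h_A2S.
rewrite !(natrD, natrM); ring.
Qed.

(** One level adds the letters other than [A1] in the word of [A1], which the choice of [nn] bounds
    by [1 / 2 ^+ k]; the right-hand side sums these increments from the initial value 1. *)
Lemma Hr_le k : Hr k <= 3 - 2 / 2 ^+ k.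
Proof.
elim: k => [|k ih]; first by rewrite /Hr /h /= expr0; lra.
have p0 : (0 : R) < 2 ^+ k by rewrite exprn_gt0.
have n0 : (0 : R) < (nn k).+1%:R by [].
suff : Hr k.+1 <= Hr k + 1 / 2 ^+ k.
  by rewrite exprS invfM mulrA divff ?mul1r //; lra.
rewrite /Hr h_A1S h_A2S /=.
have -> : (h k C + 3 * h k A2 + nn k * h k A1 + h k A1)%N =
  (h k C + 3 * h k A2 + (nn k).+1 * h k A1)%N by rewrite mulSn; lia.
rewrite natrD mulrDl addrC lerD //.
  rewrite natrM [leLHS](_ : _ = (h k A1)%:R * seed k) //.
  by move: n0; move: (nn k).+1%:R => N N0; field; rewrite gt_eqF.
rewrite ler_pdivlMr // mulrA mulrAC ler_pdivrMr // mul1r.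
have r0 := seed_gt0 k; have r1 := seed_le1 k.
apply: (@le_trans _ _ ((h k C + 3 * h k A2)%:R * 2 ^+ k)).
  by rewrite mulrAC -[leRHS]mulr1 ler_wpM2l // mulr_ge0 // ltW.
rewrite -natrX -natrM ler_nat nnE mulnC.
by apply: leqW; rewrite leq_mul2l; lia.
Qed.

Lemma approx_le6 j k : [/\ ac j k <= 6, ad j k <= 6, ax j k <= 6 & ay j k <= 6].
Proof.
have [c0 d0 x0 y0] := approx_ge0 j k.
have := approx_area j k; have := Hr_le (k + j).
have p0 : (0 : R) < 2 / 2 ^+ (k + j) by rewrite divr_gt0 // exprn_gt0.
have h1 l (v : R) : 0 <= v -> v <= (h k l)%:R * v.
  by move=> v0; rewrite ler_peMl // ler1n h_gt0.
move: (h1 C _ c0) (h1 D _ d0) (h1 A2 _ x0) (h1 A1 _ y0).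
by move=> *; split; lra.
Qed.

Definition Lc k : R := limn (ac ^~ k).
Definition Ld k : R := limn (ad ^~ k).
Definition Lx k : R := limn (ax ^~ k).
Definition Ly k : R := limn (ay ^~ k).

Lemma cvg_mono_bounded (u : nat -> R) b : (forall j, u j <= u j.+1) ->
  (forall j, u j <= b) -> u @ \oo --> limn u.
Proof.
move=> hm hb; apply: nondecreasing_is_cvgn; first exact/nondecreasing_seqP.
by exists b => _ [j _ <-].
Qed.

Lemma cvg_ac k : ac ^~ k @ \oo --> Lc k.
Proof.
by apply: (@cvg_mono_bounded _ 6) => j; [have [] := approx_mono j k | have [] := approx_le6 j k].
Qed.
Lemma cvg_ad k : ad ^~ k @ \oo --> Ld k.
Proof.
by apply: (@cvg_mono_bounded _ 6) => j; [have [] := approx_mono j k | have [] := approx_le6 j k].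
Qed.
Lemma cvg_ax k : ax ^~ k @ \oo --> Lx k.
Proof.
by apply: (@cvg_mono_bounded _ 6) => j; [have [] := approx_mono j k | have [] := approx_le6 j k].
Qed.
Lemma cvg_ay k : ay ^~ k @ \oo --> Ly k.
Proof.
by apply: (@cvg_mono_bounded _ 6) => j; [have [] := approx_mono j k | have [] := approx_le6 j k].
Qed.

Lemma L_eqn k :
  [/\ Lc k = Lc k.+1 + Ld k.+1 + 2 * (Lx k.+1 + Ly k.+1),
      Ld k = (mm k)%:R * (Lc k.+1 + Ld k.+1) + Ld k.+1,
      Lx k = ((mm k)%:R + 1) * (Lc k.+1 + Ld k.+1) + Ld k.+1
             + 3 * (Lx k.+1 + Ly k.+1) &
      Ly k = (nn k)%:R * (Lx k.+1 + Ly k.+1) + Ly k.+1].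
Proof.
have [hc hd hx hy] := And4 (@cvg_ac k.+1) (@cvg_ad k.+1) (@cvg_ax k.+1) (@cvg_ay k.+1).
have uniq (u v : nat -> R) (l l' : R) : u @ \oo --> l -> (forall j, u j.+1 = v j) ->
    v @ \oo --> l' -> l = l'.
  move=> hu e hv; have := hu; rewrite -cvg_shiftS.
  rewrite (_ : [sequence u n.+1]_n = v); last exact/funext.
  by move=> hu'; apply: cvg_unique hu' hv.
split.
- apply: (uniq (ac ^~ k) _ _ _ (@cvg_ac k) (fun j => acS j k)).
  by apply: cvgD; [apply: cvgD|apply: cvgMr; apply: cvgD].
- apply: (uniq (ad ^~ k) _ _ _ (@cvg_ad k) (fun j => adS j k)).
  by apply: cvgD => //; apply: cvgMr; apply: cvgD.
- apply: (uniq (ax ^~ k) _ _ _ (@cvg_ax k) (fun j => axS j k)).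
  apply: cvgD; last by apply: cvgMr; apply: cvgD.
  by apply: cvgD => //; apply: cvgMr; apply: cvgD.
- apply: (uniq (ay ^~ k) _ _ _ (@cvg_ay k) (fun j => ayS j k)).
  by apply: cvgD => //; apply: cvgMr; apply: cvgD.
Qed.

Lemma L_ge j k : [/\ ac j k <= Lc k, ad j k <= Ld k, ax j k <= Lx k & ay j k <= Ly k].
Proof.
have le_lim (u : nat -> R) (l : R) : (forall i, u i <= u i.+1) -> u @ \oo --> l ->
    limn u = l -> u j <= l.
  move=> hm hu <-; apply: nondecreasing_cvgn_le; first exact/nondecreasing_seqP.
  by apply/cvg_ex; exists l.
split.
- by apply: (le_lim (ac ^~ k) _ _ (@cvg_ac k)) => // i; have [] := approx_mono i k.
- by apply: (le_lim (ad ^~ k) _ _ (@cvg_ad k)) => // i; have [] := approx_mono i k.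
- by apply: (le_lim (ax ^~ k) _ _ (@cvg_ax k)) => // i; have [] := approx_mono i k.
- by apply: (le_lim (ay ^~ k) _ _ (@cvg_ay k)) => // i; have [] := approx_mono i k.
Qed.

(** Comparison with the seeds makes only [Ly] positive; the equations pass positivity from deeper
    levels on to [Lc], [Ld] and [Lx]. *)
Lemma L_renormalizable : renormalizable Lc Ld Lx Ly nn mm.
Proof.
have ge0 k : [/\ 0 <= Lc k, 0 <= Ld k, 0 <= Lx k & 0 < Ly k].
  have [? ? ? ?] := L_ge 0 k; split => //.
  by apply: lt_le_trans (seed_gt0 k) _.
move=> k; have [Ec Ed Ex Ey] := L_eqn k.
split; [|exact: mm_gt0|exact: nn_gt0|by []].
have [c0 d0 x0 y0] := ge0 k.+1.
have [_ _ _ yk] := ge0 k.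
have c1 : 0 < Lc k.+1.
  by have [-> _ _ _] := L_eqn k.+1; have [? ? ? ?] := ge0 k.+2; lra.
have m0 : (0 : R) < (mm k)%:R by rewrite ltr0n mm_gt0.
have mc : 0 < (mm k)%:R * (Lc k.+1 + Ld k.+1) by rewrite mulr_gt0 //; lra.
by split => //; lra.
Qed.

(** The domain has the limit of [2 * Hr j] as its length, and [Ly k] is at least [seed k]. Deep
    towers over [A1] and [B1] thus cover almost everything. *)
Lemma L_area (e : R) : 0 < e -> exists K : nat, forall k, (K <= k)%N ->
  Jk Lc Ld Lx Ly 0 - e <= 2 * ((h k A1)%:R * Ly k).
Proof.
move=> e0.
have hcv : (fun j => 2 * Hr j) @ \oo --> Jk Lc Ld Lx Ly 0.
  rewrite (_ : (fun j => _) = fun j => ac j 0 + ad j 0 + 2 * ax j 0 + 2 * ay j 0).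
    apply: cvgD; last by apply: cvgMr; apply: cvg_ay.
    apply: cvgD; last by apply: cvgMr; apply: cvg_ax.
    by apply: cvgD; [apply: cvg_ac|apply: cvg_ad].
  by apply/funext => j; rewrite -{1}[j]add0n -approx_area /h /=; lra.
have /cvgrPdist_le/(_ e e0)[K _ HK] := hcv.
exists K => k Kk; have := HK k Kk; rewrite ler_norml => /andP[_].
have [_ _ _] := L_ge 0 k; rewrite [ay 0 k]/= => hy.
have : Hr k <= (h k A1)%:R * Ly k by rewrite ler_wpM2l.
lra.
Qed.

End Lengths.

(** * Probability measures on the line *)

Section Generic.
Variable R : realType.
Notation RT := (measurableTypeR R).
Notation prob := (probability RT R).

Lemma conditional_prob d (S : measurableType d) (P0 : probability S R)
    (m : {measure set S -> \bar R}) (B : set S) (r : R) :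
  measurable B -> m B = r%:E -> 0 < r ->
  exists P : probability S R,
    forall E, measurable E -> P E = (m (E `&` B) * (r^-1)%:E)%E.
Proof.
move=> mB mBr r0; exists (mnormalize (mrestr m mB) P0) => E mE.
pose m' : {measure set S -> \bar R} := mrestr m mB.
have e : m' [set: S] = r%:E by rewrite /m' /= /mrestr setTI.
have key : mnormalize m' P0 E = (m' E * (fine (m' [set: S]))^-1%:E)%E.
  by rewrite /mnormalize ifF // e eqe gt_eqF.
by rewrite [LHS]key e.
Qed.

(** Real-valued masses, so that linear arithmetic applies. *)
Definition pr (nu : prob) (E : set RT) : R := fine (nu E).

Lemma prE (nu : prob) E : measurable E -> nu E = (pr nu E)%:E.
Proof. by move=> mE; rewrite /pr fineK // fin_num_measure. Qed.

Lemma pr_ge0 (nu : prob) E : 0 <= pr nu E.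
Proof. by rewrite /pr fine_ge0. Qed.

Lemma pr_le1 (nu : prob) E : measurable E -> pr nu E <= 1.
Proof. by move=> mE; rewrite -lee_fin -prE // probability_le1. Qed.

Lemma pr_le (nu : prob) E F : measurable E -> measurable F -> E `<=` F ->
  pr nu E <= pr nu F.
Proof. by move=> mE mF EF; rewrite -lee_fin -!prE // le_measure // inE. Qed.

Lemma pr0 (nu : prob) : pr nu set0 = 0.
Proof. by rewrite /pr measure0. Qed.

Lemma pr_setU (nu : prob) E F : measurable E -> measurable F -> [disjoint E & F] ->
  pr nu (E `|` F) = pr nu E + pr nu F.
Proof.
move=> mE mF /disj_set2P EF; apply: EFin_inj.
rewrite EFinD -!prE //; last exact: measurableU.
by rewrite measureU.
Qed.

Lemma pr_leU (nu : prob) E F : measurable E -> measurable F ->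
  pr nu (E `|` F) <= pr nu E + pr nu F.
Proof.
move=> mE mF; rewrite -lee_fin EFinD -!prE //; last exact: measurableU.
exact: measureU2.
Qed.

Lemma pr_setD (nu : prob) E F : measurable E -> measurable F ->
  pr nu (E `\` F) = pr nu E - pr nu (E `&` F).
Proof.
move=> mE mF; apply/eqP; rewrite eq_sym subr_eq eq_sym; apply/eqP.
rewrite addrC -pr_setU; [|exact: measurableI|exact: measurableD|].
  by rewrite setUC setDE -setIUr setUCl setIT.
by apply/disj_set2P; rewrite setDE setIACA setICr setI0.
Qed.

(** Open left rays are stable under intersection and generate the Borel sets. As ramps approximate
    their indicators, measures can be compared through integrals of continuous functions. *)
Lemma measure_ray_eq (m1 m2 : {measure set RT -> \bar R}) :
  (m1 setT < +oo)%E ->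
  (forall x : R, m1 `]-oo, x[%classic = m2 `]-oo, x[%classic) ->
  forall E, measurable E -> m1 E = m2 E.
Proof.
move=> mT h E mE.
have := @measure_unique _ R RT (@RGenInftyO.G R)
  (fun n => `]-oo, n%:R[%classic).
move=> /(_ _ _ _ _ m1 m2 _ _ E mE); apply => //.
- exact: RGenInftyO.measurableE.
- move=> _ _ [x ->] [y ->]; exists (Num.min x y).
  by apply/seteqP; split => z /=; rewrite !in_itv /= lt_min => /andP.
- by move=> n; exists n%:R.
- apply/seteqP; split => // x _; exists (Num.bound `|x|) => //=.
  by rewrite in_itv /= (le_lt_trans (ler_norm _)) // archi_boundP.
- by move=> _ [x ->].
- move=> k; apply: le_lt_trans mT; apply: le_measure => //; rewrite ?inE //.
Qed.

(* Continuous functions increasing with n to the indicator of ]-oo, x[. *)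
Definition ramp (x : R) (n : nat) (z : R) : R :=
  Num.min 1 (Num.max 0 (n%:R * (x - z))).

Lemma ramp_ge0 x n z : 0 <= ramp x n z.
Proof. by rewrite /ramp le_min ler01 le_max lexx. Qed.

Lemma ramp_le1 x n z : ramp x n z <= 1.
Proof. by rewrite /ramp ge_min lexx. Qed.

Lemma ramp_eq0 x n z : x <= z -> ramp x n z = 0.
Proof.
move=> xz; rewrite /ramp; have h : n%:R * (x - z) <= 0.
  by rewrite mulr_ge0_le0 // subr_le0.
by rewrite (max_idPl h); apply/min_idPr.
Qed.

Lemma ramp_eq1 x n z : z <= x - n.+1%:R^-1 -> ramp x n.+1 z = 1.
Proof.
move=> zx; rewrite /ramp; apply/min_idPl; rewrite le_max; apply/orP; right.
rewrite mulrC -ler_pdivrMr // div1r; move: zx; move: (_^-1) => t ?; lra.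
Qed.

Lemma ramp_lip x n z z' : `|ramp x n z - ramp x n z'| <= n%:R * `|z - z'|.
Proof.
have clip (a b : R) : `|Num.min 1 (Num.max 0 a) - Num.min 1 (Num.max 0 b)| <= `|a - b|.
  have := ler_norm (a - b); have := ler_norm (b - a); rewrite (distrC b a).
  move: (`|a - b|) => t h1 h2; rewrite ler_norml.
  case: (leP 0 a) => ?; case: (leP 0 b) => ?;
    case: (leP 1 a) => ?; case: (leP 1 b) => ?; case: (leP (1 : R) 0) => ?;
    by apply/andP; split; lra.
apply: le_trans (clip _ _) _.
rewrite -mulrBr normrM ger0_norm // ler_wpM2l //.
by rewrite (_ : x - z - (x - z') = z' - z); [rewrite distrC|lra].
Qed.

Lemma measurable_ramp x n : measurable_fun setT (ramp x n : RT -> RT).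
Proof.
apply: measurable_minr; first exact: measurable_cst.
apply: measurable_maxr; first exact: measurable_cst.
apply: measurable_funM; first exact: measurable_cst.
by apply: measurable_funB; [exact: measurable_cst|exact: measurable_id].
Qed.

(** * Continuous functions with compact support in a subset of the line *)

Section CompactSupport.
Variables (X : set R) (f : R -> R).
Hypotheses (fc : {within X, continuous f}) (fs : compactly_supported X f).

Let supp := X `&` closure (X `&` [set x | f x != 0]).

Let f_off x : X x -> ~ supp x -> f x = 0.
Proof.
move=> Xx nx; have [//|fx] := eqVneq (f x) 0.
by exfalso; apply: nx; split => //; apply: subset_closure.
Qed.

Let f_near x e : X x -> 0 < e -> exists2 r : R, 0 < r &
  forall y, X y -> `|x - y| < r -> `|f x - f y| <= e.
Proof.
move=> Xx e0; have /subspace_continuousP/(_ x Xx)/cvgrPdist_le/(_ e e0) := fc.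
rewrite /within /= => /nbhs_ballP[r /= r0 H]; exists r => // y Xy xy.
exact: H.
Qed.

(** Since [X] may fail to be compact, the covering argument runs over the support; if neither point
    lies there, both values are 0. *)
Lemma compact_support_unif (e : R) : 0 < e -> exists2 dl : R, 0 < dl &
  forall a b, X a -> X b -> `|a - b| < dl -> `|f a - f b| <= e.
Proof.
move=> e0; have e20 : 0 < e / 2 by lra.
have /compact_near_coveringP cs : compact supp := fs.
have H : \forall dl \near 0^'+, supp `<=` [set x | X x ->
    forall b, X b -> `|x - b| < dl -> `|f x - f b| <= e].
  apply: cs => x [Xx _]; have [r r0 hr] := f_near Xx e20.
  exists (ball x (r / 2), [set dl : R | dl < r / 2]).
    split; last by apply: nbhs_right_lt; lra.
    by apply: nbhsx_ballx; lra.
  move=> [x' dl] [/= xx' dlr] Xx' b Xb x'b.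
  have hx' := hr x' Xx' ltac:(by apply: lt_le_trans xx' _; lra).
  have hb : `|f x - f b| <= e / 2.
    apply: hr => //; apply: le_lt_trans (ler_distD x' _ _) _.
    by move: xx'; rewrite /ball /=; lra.
  by rewrite (le_trans (ler_distD (f x) _ _)) // distrC; lra.
have [dl [dl0 Hdl]] : exists dl : R, 0 < dl /\ supp `<=` [set x | X x ->
    forall b, X b -> `|x - b| < dl -> `|f x - f b| <= e].
  by apply: (@filter_ex _ (0^'+)); apply: filterI H; exact: nbhs_right_gt.
exists dl => // a b Xa Xb ab.
have [sa|na] := pselect (supp a); first exact: Hdl.
have [sb|nb] := pselect (supp b); first by rewrite distrC; apply: Hdl => //; rewrite distrC.
by rewrite !f_off // subrr normr0 ltW.
Qed.

Lemma compact_support_bounded : exists M : R, forall x, X x -> `|f x| <= M.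
Proof.
have /compact_near_coveringP cs : compact supp := fs.
have H : \forall M \near +oo, supp `<=` [set x | X x -> `|f x| <= M].
  apply: cs => x [Xx _]; have [r r0 hr] := f_near Xx ltr01.
  exists (ball x r, [set M : R | `|f x| + 1 < M]).
    by split; [exact: nbhsx_ballx|exact: nbhs_pinfty_gt].
  move=> [x' M] [/= xx' HM] Xx'; have := hr x' Xx' xx'.
  have := ler_distD 0 (f x') (f x); have := ler_dist_dist (f x) (f x').
  by rewrite ler_norml => /andP[? ?] _ ?; lra.
have [M [M0 HM]] : exists M : R, 0 < M /\ supp `<=` [set x | X x -> `|f x| <= M].
  by apply: (@filter_ex _ (+oo)); apply: filterI H; exact: nbhs_pinfty_gt.
exists M => x Xx; have [sx|nx] := pselect (supp x); first exact: HM.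
by rewrite f_off // normr0 ltW.
Qed.

End CompactSupport.

Lemma lebesgue_translate (t : R) (E : set RT) : measurable E ->
  lebesgue_measure ((fun z : RT => z + t) @^-1` E) = lebesgue_measure E.
Proof.
have mt : measurable_fun setT (fun z : RT => z + t : RT).
  by apply: measurable_funD; [exact: measurable_id|exact: measurable_cst].
move=> mE; rewrite -[LHS]/(pushforward lebesgue_measure (fun z : RT => z + t : RT) E).
apply/esym/lebesgue_measure_unique => //= _ [[a b]] _ <-.
rewrite /pushforward (_ : _ @^-1` _ = `]a - t, b - t]%classic); last first.
  by apply/seteqP; split => z /=; rewrite !in_itv /= ltrBlDr lerBrDr.
rewrite !lebesgue_measure_itv /= !lte_fin ltrD2r; case: ifP => // _.
by rewrite -!EFinB; congr (_%:E); lra.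
Qed.

End Generic.

(** * Invariant measures and towers *)

Definition letter_rank (l : letter) : 'I_6 :=
  match l with
  | C => @Ordinal 6 0 isT | D => @Ordinal 6 1 isT | A1 => @Ordinal 6 2 isT
  | A2 => @Ordinal 6 3 isT | B1 => @Ordinal 6 4 isT | B2 => @Ordinal 6 5 isT
  end.

Definition letters := [:: C; D; A1; A2; B1; B2].

Lemma letter_rankK : cancel letter_rank (fun i : 'I_6 => nth C letters i).
Proof. by case. Qed.

HB.instance Definition _ := Countable.copy letter (can_type letter_rankK).
Fact letters_enum : Finite.axiom letters. Proof. by case. Qed.
HB.instance Definition _ := fintype.isFinite.Build letter letters_enum.

Section Columns.
Variables (R : realType) (lc ld lx ly : nat -> R).
Hypothesis ren : renormalizable lc ld lx ly nn mm.

Notation RT := (measurableTypeR R).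
Notation prob := (probability RT R).
Local Notation T := (Tk lc ld lx ly 0).
Local Notation I := (Ik lc ld lx ly).
Local Notation J := (Jk lc ld lx ly).
Local Notation lftk k l := (lft (lc k) (ld k) (lx k) (ly k) l).
Local Notation lenk k l := (len (lc k) (ld k) (lx k) (ly k) l).

Definition idom : set R := `[0, J 0[.

Lemma idomE z : idom z <-> 0 <= z < J 0.
Proof. by rewrite /idom /= in_itv. Qed.

Lemma exch_idom z : idom z -> idom (T z).
Proof. by rewrite !idomE; apply: (Tk_in ren). Qed.

Lemma iter_idom i z : idom z -> idom (iter i T z).
Proof. by rewrite !idomE; apply: (Tk_iter_in ren). Qed.

Lemma measurable_idom : measurable (idom : set RT).
Proof. exact: measurable_itv. Qed.

Definition level k l i : set R := [set iter i T z | z in [set z | I k l z]].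

Lemma lenk_gt0 k l : 0 < lenk k l.
Proof. by have [[? ? ? ?] _ _ _] := ren k; case: l. Qed.

Lemma lftk_I k l : I k l (lftk k l).
Proof. by rewrite /Ik /inI lexx ltrDl lenk_gt0. Qed.

(** The bound includes [i = h k l], the image of the base under the return map; at level 0 this
    gives the intervals after the exchange. *)
Lemma level_itv k l i : (i <= h k l)%N ->
  level k l i = `[iter i T (lftk k l), iter i T (lftk k l) + lenk k l[%classic.
Proof.
move=> ih; have tr z : I k l z -> iter i T z = iter i T (lftk k l) + (z - lftk k l).
  by move=> zl; have := iter_translation ren (lftk_I k l) zl ih; lra.
apply/seteqP; split => z /=; rewrite in_itv /=.
  move=> [w wl <-]; rewrite (tr w wl).
  by move: wl; rewrite /Ik /inI => /andP[? ?]; apply/andP; split; lra.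
move=> /andP[z1 z2]; set p := iter _ _ _ in z1 z2 tr.
have zl : I k l (z - p + lftk k l) by rewrite /Ik /inI; apply/andP; split; lra.
by exists (z - p + lftk k l) => //; rewrite tr //; lra.
Qed.

Lemma measurable_level k l i : (i <= h k l)%N -> measurable (level k l i : set RT).
Proof. by move=> /level_itv ->; apply: measurable_itv. Qed.

Lemma level_X k l i : level k l i `<=` idom.
Proof. by move=> _ [z zl <-]; apply: iter_idom; apply/idomE; apply: I_J0 zl. Qed.

Lemma level_disj k l l' i i' : (i < h k l)%N -> (i' < h k l')%N ->
  (l, i) != (l', i') -> [disjoint level k l i & level k l' i'].
Proof.
move=> hi hi' /eqP ne; apply/disj_set2P; rewrite -subset0 => z [[w wl <-] [w' wl' e]].
by have [el ei _] := floor_uniq ren wl wl' hi hi' (esym e); apply: ne; rewrite el ei.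
Qed.

Lemma preimage_level k l i : idom `&` T @^-1` level k l i.+1 = level k l i.
Proof.
apply/seteqP; split => z.
  move=> [/idomE Xz [w wl e]]; exists w => //.
  apply: (T_inj ren) => //; apply: (Tk_iter_in ren); exact: I_J0 wl.
by move=> zl; split; [exact: level_X zl|case: zl => w wl <-; exists w].
Qed.

Section Invariant.
Variable nu : prob.
Hypothesis inv : invariant_prob idom T nu.

Lemma pr_level k l i : (i <= h k l)%N -> pr nu (level k l i) = pr nu (level k l 0).
Proof.
elim: i => // i ih hi; have [_ H] := inv.
apply: etrans (ih (ltnW hi)); congr fine.
have := H (level k l i.+1) (measurable_level hi) (@level_X k l i.+1).
by rewrite preimage_level => ->.
Qed.

(** Initial parts of towers serve to estimate the points that enter the A side at a new level: they
    sit at the bottom. *)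
Definition subtower k l n : set R := \big[setU/set0]_(i < n) level k l i.
Definition tower k l := subtower k l (h k l).
Definition towers k (s : seq letter) : set R := \big[setU/set0]_(l <- s) tower k l.

Lemma subtowerS k l n : subtower k l n.+1 = subtower k l n `|` level k l n.
Proof. by rewrite /subtower big_ord_recr. Qed.

Lemma measurable_subtower k l n : (n <= h k l)%N -> measurable (subtower k l n : set RT).
Proof.
by move=> hn; apply: bigsetU_measurable => i _; apply: measurable_level; rewrite ltnW // (leq_trans (ltn_ord i)).
Qed.

Lemma measurable_tower k l : measurable (tower k l : set RT).
Proof. exact: measurable_subtower. Qed.

Lemma measurable_towers k s : measurable (towers k s : set RT).
Proof. by apply: bigsetU_measurable => l _; apply: measurable_tower. Qed.

Lemma subtowerP k l n z : subtower k l n z <-> exists w i, [/\ I k l w, (i < n)%N & z = iter i T w].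
Proof.
rewrite /subtower -bigcup_mkord; split.
  by move=> [i /= hi [w wl <-]]; exists w, i.
by move=> [w [i [wl hi ->]]]; exists i => //; exists w.
Qed.

Lemma towersP k s z : towers k s z <-> exists2 l, l \in s & tower k l z.
Proof.
elim: s => [|l s ih].
  by rewrite /towers big_nil; split => // -[].
rewrite /towers big_cons -/(towers k s); split.
  move=> [zl|/ih[l' ls zl']]; first by exists l; rewrite ?mem_head.
  by exists l'; rewrite // in_cons ls orbT.
move=> [l']; rewrite in_cons => /orP[/eqP -> ?|ls zl']; first by left.
by right; apply/ih; exists l'.
Qed.

Lemma towers_letters k : towers k letters = idom.
Proof.
apply/seteqP; split => z.
  move=> /towersP[l _ /subtowerP[w [i [wl _ ->]]]]; apply: (level_X (k := k) (l := l) (i := i)).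
  by exists w.
move=> /idomE/(floor_cover ren k)[l [w [i [wl hi ->]]]].
apply/towersP; exists l; last by apply/subtowerP; exists w, i.
by case: l {wl hi}.
Qed.

Lemma subtowerS_disj k l n : (n < h k l)%N -> [disjoint subtower k l n & level k l n].
Proof.
move=> hn; apply/disj_set2P; rewrite -subset0 => z [/subtowerP[w [i [wl hi ->]]] zn].
have := @level_disj k l l i n (ltn_trans hi hn) hn.
rewrite xpair_eqE eqxx /= (ltn_eqF hi) => /(_ isT)/disj_set2P.
by rewrite -subset0; apply; split; [exists w|exact: zn].
Qed.

Lemma towers_disj k l s : l \notin s -> [disjoint tower k l & towers k s].
Proof.
move=> ls; apply/disj_set2P; rewrite -subset0 => z [/subtowerP[w [i [wl hi ->]]]].
move=> /towersP[l' ls' /subtowerP[w' [i' [wl' hi' e]]]].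
have [el _ _] := floor_uniq ren wl wl' hi hi' e.
by move: ls; rewrite el ls'.
Qed.

Lemma pr_towersU k l s : l \notin s ->
  pr nu (towers k (l :: s)) = pr nu (tower k l) + pr nu (towers k s).
Proof.
move=> ls; rewrite {1}/towers big_cons -/(towers k s) pr_setU //.
- exact: measurable_tower.
- exact: measurable_towers.
- exact: towers_disj.
Qed.

Lemma pr_towersE k s : uniq s -> pr nu (towers k s) = \sum_(l <- s) pr nu (tower k l).
Proof.
elim: s => [_|l s ih /= /andP[ls us]]; first by rewrite /towers !big_nil pr0.
by rewrite pr_towersU // big_cons ih.
Qed.

Lemma pr_subtowerE k l n : (n <= h k l)%N -> pr nu (subtower k l n) = n%:R * pr nu (level k l 0).
Proof.
elim: n => [_|n ih hn]; first by rewrite /subtower big_ord0 pr0 mul0r.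
rewrite subtowerS pr_setU.
- by rewrite ih 1?ltnW // pr_level 1?ltnW // -natr1 mulrDl mul1r.
- by apply: measurable_subtower; rewrite ltnW.
- by apply: measurable_level; rewrite ltnW.
- exact: subtowerS_disj.
Qed.

Lemma pr_idom : pr nu idom = 1.
Proof. by rewrite /pr; have [-> _] := inv. Qed.

Lemma pr_total k : \sum_(l <- letters) pr nu (tower k l) = 1.
Proof. by rewrite -(pr_towersE k (s := letters)) // towers_letters pr_idom. Qed.

Section Integral.
Variables (phi : R -> R) (M : R).
Hypothesis phi_le : forall z, idom z -> `|phi z| <= M.
Hypothesis phi_meas : measurable_fun (idom : set RT) (phi : RT -> RT).

Local Notation dev := (deviation lc ld lx ly phi).
Local Notation near_avg := (near_avg lc ld lx ly phi).

Lemma phi_integrable t E : measurable (E : set RT) -> E `<=` idom ->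
  nu.-integrable E (EFin \o (fun z => phi z - t)).
Proof.
move=> mE EX; apply: measurable_bounded_integrable => //.
- by rewrite (le_lt_trans (probability_le1 nu mE)) // ltry.
- apply: measurable_funB; last exact: measurable_cst.
  exact: (measurable_funS measurable_idom EX phi_meas).
- exists (M + `|t|); split; first exact: num_real.
  move=> x hx z Ez /=; apply: le_trans (ltW hx); apply: le_trans (ler_normB _ _) _.
  by rewrite lerD2r phi_le //; apply: EX.
Qed.

Lemma integral_level k l i t w : 0 <= w -> (i <= h k l)%N ->
  (forall z z', I k l z -> I k l z' -> `|phi (iter i T z) - phi (iter i T z')| <= w) ->
  `|\int[nu]_(z in level k l i) (phi z - t)
    - pr nu (level k l 0) * (phi (iter i T (lftk k l)) - t)| <= w * pr nu (level k l 0).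
Proof.
move=> w0 hi hw; set p := phi (iter i T _).
have mE := measurable_level hi.
have ic r : nu.-integrable (level k l i) (EFin \o (fun z : R => r)).
  apply: measurable_bounded_integrable => //.
    by rewrite (le_lt_trans (probability_le1 nu mE)) // ltry.
  by exists `|r|; split; [exact: num_real|move=> x hx z _ /=; exact: ltW].
have cst r : (\int[nu]_(z in level k l i) r) = r * pr nu (level k l 0).
  by rewrite Rintegral_cst // -(pr_level hi).
have ip := phi_integrable t mE (@level_X k l i).
have h1 : (p - t - w) * pr nu (level k l 0) <= \int[nu]_(z in level k l i) (phi z - t).
  rewrite -cst; apply: le_Rintegral => // _ [z zl <-].
  by have := hw _ _ zl (lftk_I k l); rewrite -/p ler_norml => /andP[? ?]; lra.
have h2 : \int[nu]_(z in level k l i) (phi z - t) <= (p - t + w) * pr nu (level k l 0).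
  rewrite -cst; apply: le_Rintegral => // _ [z zl <-].
  by have := hw _ _ zl (lftk_I k l); rewrite -/p ler_norml => /andP[? ?]; lra.
by rewrite ler_norml; apply/andP; split; lra.
Qed.

Lemma integral_towerU (E F : set R) t : measurable (E : set RT) ->
  measurable (F : set RT) -> E `<=` idom -> F `<=` idom -> [disjoint E & F] ->
  \int[nu]_(z in E `|` F) (phi z - t) =
  \int[nu]_(z in E) (phi z - t) + \int[nu]_(z in F) (phi z - t).
Proof.
move=> mE mF EX FX EF; apply: Rintegral_setU => //.
apply: phi_integrable; first exact: measurableU.
by move=> z [/EX|/FX].
Qed.

Lemma subtowerX k l n : subtower k l n `<=` idom.
Proof.
move=> z /subtowerP[w [i [wl _ ->]]]; apply: (level_X (k := k) (l := l) (i := i)).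
by exists w.
Qed.

Lemma towersX k s : towers k s `<=` idom.
Proof. by move=> z /towersP[l _]; apply: (@subtowerX k l (h k l)). Qed.

(** Invariance gives all floors the mass of the base, so the integral is that mass times a Birkhoff
    sum, up to the oscillation [w] on floors. *)
Lemma integral_subtowerE k l n t w : 0 <= w -> (n <= h k l)%N ->
  (forall i z z', (i < h k l)%N -> I k l z -> I k l z' ->
    `|phi (iter i T z) - phi (iter i T z')| <= w) ->
  `|\int[nu]_(z in subtower k l n) (phi z - t)
    - pr nu (level k l 0) * dev t n (lftk k l)| <= w * pr nu (subtower k l n).
Proof.
move=> w0 + hw; elim: n => [_|n ih hn].
  by rewrite /subtower big_ord0 Rintegral_set0 /deviation big_geq // mulr0 subr0 normr0 pr0 mulr0.
have hn' := ltnW hn.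
have := ih hn'; have := @integral_level k l n t w w0 hn' (fun z z' => hw n z z' hn).
rewrite subtowerS integral_towerU; [|exact: measurable_subtower|exact: measurable_level|
  exact: subtowerX|exact: level_X|exact: subtowerS_disj].
rewrite -subtowerS (pr_subtowerE hn) (pr_subtowerE hn') /deviation big_nat_recr //= -natr1.
move: (Rintegral _ _ _) (Rintegral _ _ _) => a b.
rewrite !ler_norml => /andP[? ?] /andP[? ?]; apply/andP; split; lra.
Qed.

Lemma integral_tower k l t w e : 0 <= w -> near_avg k l e t ->
  (forall i z z', (i < h k l)%N -> I k l z -> I k l z' ->
    `|phi (iter i T z) - phi (iter i T z')| <= w) ->
  `|\int[nu]_(z in tower k l) (phi z - t)| <= (e + w) * pr nu (tower k l).
Proof.
move=> w0 hA hw; have := @integral_subtowerE k l (h k l) t w w0 (leqnn _) hw.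
have := hA _ (lftk_I k l); rewrite -/(tower k l) {2 3}/tower (pr_subtowerE (leqnn _)).
move: (pr_ge0 nu (level k l 0)); set p := pr nu _; move: (dev _ _ _) => q p0 hq.
have : `|p * q| <= p * (e * (h k l)%:R) by rewrite normrM ger0_norm // ler_wpM2l.
move: (Rintegral _ _ _) => a.
rewrite !ler_norml => /andP[? ?] /andP[? ?]; apply/andP; split; lra.
Qed.

Lemma integral_towers k (t e : letter -> R) w : 0 <= w ->
  (forall l, near_avg k l (e l) (t l)) ->
  (forall l i z z', (i < h k l)%N -> I k l z -> I k l z' ->
    `|phi (iter i T z) - phi (iter i T z')| <= w) ->
  `|\int[nu]_(z in idom) phi z - \sum_(l <- letters) t l * pr nu (tower k l)|
    <= \sum_(l <- letters) (e l + w) * pr nu (tower k l).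
Proof.
move=> w0 hA hw.
have intE E : measurable (E : set RT) -> E `<=` idom ->
    \int[nu]_(z in E) phi z = \int[nu]_(z in E) (phi z - 0).
  by move=> mE EX; apply: eq_Rintegral => z _; rewrite subr0.
rewrite -(towers_letters k).
have : uniq letters by [].
elim: letters => [_|l s ih /= /andP[ls us]].
  by rewrite /towers !big_nil Rintegral_set0 subr0 normr0.
have {}ih := ih us.
rewrite !big_cons.
have -> : \int[nu]_(z in towers k (l :: s)) phi z =
    \int[nu]_(z in tower k l) phi z + \int[nu]_(z in towers k s) phi z.
  rewrite (intE (towers k (l :: s))) ?(intE (tower k l)) ?(intE (towers k s));
    do ?[exact: measurable_towers|exact: measurable_tower|exact: towersX|exact: subtowerX].
  rewrite {1}/towers big_cons -/(towers k s); apply: integral_towerU => //.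
  - exact: measurable_tower.
  - exact: measurable_towers.
  - exact: subtowerX.
  - exact: towersX.
  - exact: towers_disj.
have hl := integral_tower w0 (hA l) (hw l).
have e1 : \int[nu]_(z in tower k l) (phi z - t l) =
    \int[nu]_(z in tower k l) phi z - t l * pr nu (tower k l).
  have mc := measurable_tower k l.
  have ip := phi_integrable 0 mc (@subtowerX k l (h k l)).
  rewrite RintegralB //.
  - by rewrite Rintegral_cst.
  - by have := ip; apply: eq_integrable => // z _ /=; rewrite subr0.
  - apply: measurable_bounded_integrable => //.
      by rewrite (le_lt_trans (probability_le1 nu mc)) // ltry.
    by exists `|t l|; split; [exact: num_real|move=> x hx z _ /=; exact: ltW].
move: hl ih; rewrite e1.
move: (Rintegral _ _ _) (Rintegral _ _ _) (bigop _ _ _) (bigop _ _ _) => a b c0 d0.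
by rewrite !ler_norml => /andP[? ?] /andP[? ?]; apply/andP; split; lra.
Qed.

End Integral.
End Invariant.
End Columns.

(** * Invariant measures concentrated on one side *)

Section Limits.
Variables (R : realType) (lc ld lx ly : nat -> R).
Hypothesis ren : renormalizable lc ld lx ly nn mm.
Hypothesis area : forall e : R, 0 < e -> exists K : nat, forall k, (K <= k)%N ->
  Jk lc ld lx ly 0 - e <= 2 * ((h k A1)%:R * ly k).

Notation RT := (measurableTypeR R).
Notation prob := (probability RT R).
Local Notation T := (Tk lc ld lx ly 0).
Local Notation I := (Ik lc ld lx ly).
Local Notation J := (Jk lc ld lx ly).
Local Notation X := (idom lc ld lx ly).
Local Notation tower := (tower lc ld lx ly).
Local Notation towers := (towers lc ld lx ly).
Local Notation near_avg := (near_avg lc ld lx ly).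
Local Notation flat := (flat lc ld lx ly).
Local Notation inv := (invariant_prob X T).

Lemma J_gt0 : 0 < J 0. Proof. exact: Jk_gt0 ren 0%N. Qed.

Lemma J_le k : J k <= J 0 / 2 ^+ k.
Proof.
elim: k => [|k ih]; first by rewrite expr0 divr1.
have [[c0 d0 x0 y0] m0 n0 [Ec Ed Ex Ey]] := ren k.
have [[c1 d1 x1 y1] _ _ _] := ren k.+1.
have : 2 * J k.+1 <= J k.
  have : 0 <= (mm k)%:R * (lc k.+1 + ld k.+1) by rewrite mulr_ge0 //; lra.
  by rewrite (Jk_succ ren) /Jk /total; lra.
rewrite exprSr invfM mulrA; lra.
Qed.

Lemma J_small (e : R) : 0 < e -> exists K : nat, forall k, (K <= k)%N -> J k <= e.
Proof.
move=> e0; have [K HK] := div_exp2_le e0 (ltW J_gt0).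
by exists K => k /HK; apply: le_trans (J_le k).
Qed.

Lemma unif_flat (phi : R -> R) : (forall e : R, 0 < e -> exists2 dl : R, 0 < dl &
    forall a b, X a -> X b -> `|a - b| < dl -> `|phi a - phi b| <= e) ->
  flat phi.
Proof.
move=> hu e e0; have [dl dl0 hd] := hu e e0.
have dl20 : 0 < dl / 2 by lra.
have [K HK] := J_small dl20; exists K => k l z z' i Kk zl zl' hi.
apply: hd.
- by apply: (iter_idom ren); apply/idomE; exact: (I_J0 ren zl).
- by apply: (iter_idom ren); apply/idomE; exact: (I_J0 ren zl').
rewrite -distrC (iter_translation ren zl zl' (ltnW hi)).
have := HK k Kk; move: (Ik_J ren zl) (Ik_J ren zl') => /andP[? ?] /andP[? ?] ?.
by rewrite ltr_norml; apply/andP; split; lra.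
Qed.

Definition side k s := towers k [:: small s; big s].

Lemma pr_side nu k s : pr nu (side k s) = pr nu (tower k (small s)) + pr nu (tower k (big s)).
Proof.
rewrite /side (pr_towersE ren) //; last by case: s.
by rewrite big_cons big_seq1.
Qed.

Definition pr_CD (nu : prob) k := pr nu (tower k C) + pr nu (tower k D).

Lemma pr_sides nu k : inv nu ->
  pr nu (side k true) + pr nu (side k false) + pr_CD nu k = 1.
Proof.
move=> hnu; rewrite -(pr_total ren hnu k) !pr_side /pr_CD /=.
by rewrite /letters !big_cons big_nil; lra.
Qed.

Section Phi.
Variables (phi : R -> R) (M : R).
Hypothesis phi_le : forall z, X z -> `|phi z| <= M.
Hypothesis phi_meas : measurable_fun (X : set RT) (phi : RT -> RT).
Hypothesis phi_flat : flat phi.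

Let phi_le' z : 0 <= z < J 0 -> `|phi z| <= M.
Proof. by move=> /idomE; apply: phi_le. Qed.

Definition concentrated (nu : prob) s := forall e : R, 0 < e ->
  exists K : nat, forall k, (K <= k)%N -> 1 - pr nu (side k s) <= e.

Lemma near_avg_shift k l e t t' : near_avg phi k l e t ->
  near_avg phi k l (e + `|t - t'|) t'.
Proof.
move=> H z zl; rewrite (dev_shift _ _ _ _ _ t' t) (le_trans (ler_normD _ _)) //.
rewrite mulrDl lerD ?H // normrM ger0_norm // mulrC distrC //.
Qed.

(** At level [k] the averages along side [s] are close to some [v]. Integration over the towers,
    where those off the side have vanishing mass, shows that [v] is close to the integral, which no
    longer depends on [k]. *)
Lemma near_avg_integral nu s : inv nu -> concentrated nu s -> forall e : R, 0 < e ->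
  exists K : nat, forall k, (K <= k)%N ->
    near_avg phi k (small s) e (\int[nu]_(z in X) phi z) /\
    near_avg phi k (big s) e (\int[nu]_(z in X) phi z).
Proof.
move=> hnu hc e e0; have M0 := M_ge0 ren phi_le'.
pose e1 := e / 4; have e10 : 0 < e1 by rewrite /e1; lra.
have [K1 HK1] := near_avg_const ren phi_le' phi_flat e10.
have [K2 HK2] := phi_flat e10.
(* Of the [3 * e1] below, one comes from the towers off the side, as [2 * M * e2 <= e1], one from
   the averages on the side and one from the oscillation on floors. *)
pose e2 := e1 / (2 * M + 1); have e20 : 0 < e2 by rewrite divr_gt0 //; lra.
have [K3 HK3] := hc _ e20.
exists (K1 + K2 + K3)%N => k kK.
have [v vM [hs hb]] := HK1 k s ltac:(lia).
suff hv : `|v - \int[nu]_(z in X) phi z| <= 3 * e1.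
  have h2 : e1 + `|v - \int[nu]_(z in X) phi z| <= e by rewrite /e1 in hv *; lra.
  by split; apply: near_avg_le h2 _; apply: near_avg_shift.
have hw l i z z' : (i < h k l)%N -> I k l z -> I k l z' ->
    `|phi (iter i T z) - phi (iter i T z')| <= e1.
  by move=> hi zl zl'; apply: (HK2 k l) => //; lia.
pose ee (l : letter) := if (l == small s) || (l == big s) then e1 else 2 * M.
have hA l : near_avg phi k l (ee l) v.
  rewrite /ee; have [/orP[/eqP ->|/eqP ->] //|_] := ifP.
  by move=> z zl; apply: (dev_le ren phi_le') => //; exact: (I_J0 ren zl).
have := integral_towers ren hnu phi_le phi_meas (ltW e10) hA hw.
have := HK3 k ltac:(lia); have := pr_sides k hnu; have := pr_total ren hnu k.
rewrite !pr_side /pr_CD /ee /letters !big_cons !big_nil.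
have p0 l := pr_ge0 nu (tower k l).
move: (p0 C) (p0 D) (p0 A1) (p0 A2) (p0 B1) (p0 B2).
have e2M : e2 * (2 * M) <= e1.
  by rewrite /e2 -mulrA ler_piMr ?(ltW e10) // mulrC ler_pdivrMr; lra.
have M1 : 0 <= 2 * M by rewrite mulr_ge0.
case: s hc HK3 hs hb @ee hA => hc HK3 hs hb ee hA; rewrite /= ?addr0;
  move: (Rintegral _ _ _) (pr nu (tower k C)) (pr nu (tower k D)) (pr nu (tower k A1))
   (pr nu (tower k A2)) (pr nu (tower k B1)) (pr nu (tower k B2)) => a p1 p2 p3 p4 p5 p6.
- move=> h1 h2 h3 h4 h5 h6 htot _ hside.
  have : 2 * M * (p1 + p2 + p5 + p6) <= 2 * M * e2 by rewrite ler_wpM2l //; lra.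
  have ev : v = v * (p1 + (p2 + (p3 + (p4 + (p5 + p6))))) by rewrite htot mulr1.
  have ee1 : e1 = e1 * (p1 + (p2 + (p3 + (p4 + (p5 + p6))))) by rewrite htot mulr1.
  have q p : 0 <= p -> 0 <= e1 * p by move=> ?; rewrite mulr_ge0 // ltW.
  move: (q _ h1) (q _ h2) (q _ h3) (q _ h4) (q _ h5) (q _ h6) => q1 q2 q3 q4 q5 q6.
  by rewrite !ler_norml => ? /andP[? ?]; apply/andP; split; lra.
- move=> h1 h2 h3 h4 h5 h6 htot _ hside.
  have : 2 * M * (p1 + p2 + p3 + p4) <= 2 * M * e2 by rewrite ler_wpM2l //; lra.
  have ev : v = v * (p1 + (p2 + (p3 + (p4 + (p5 + p6))))) by rewrite htot mulr1.
  have ee1 : e1 = e1 * (p1 + (p2 + (p3 + (p4 + (p5 + p6))))) by rewrite htot mulr1.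
  have q p : 0 <= p -> 0 <= e1 * p by move=> ?; rewrite mulr_ge0 // ltW.
  move: (q _ h1) (q _ h2) (q _ h3) (q _ h4) (q _ h5) (q _ h6) => q1 q2 q3 q4 q5 q6.
  by rewrite !ler_norml => ? /andP[? ?]; apply/andP; split; lra.
Qed.

End Phi.
End Limits.

(** * The two components of Lebesgue measure *)

Section Lebesgue.
Variables (R : realType) (lc ld lx ly : nat -> R).
Hypothesis ren : renormalizable lc ld lx ly nn mm.
Hypothesis area : forall e : R, 0 < e -> exists K : nat, forall k, (K <= k)%N ->
  Jk lc ld lx ly 0 - e <= 2 * ((h k A1)%:R * ly k).

Notation RT := (measurableTypeR R).
Notation prob := (probability RT R).
Local Notation T := (Tk lc ld lx ly 0).
Local Notation I := (Ik lc ld lx ly).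
Local Notation J := (Jk lc ld lx ly).
Local Notation X := (idom lc ld lx ly).
Local Notation level := (level lc ld lx ly).
Local Notation subtower := (subtower lc ld lx ly).
Local Notation tower := (tower lc ld lx ly).
Local Notation towers := (towers lc ld lx ly).
Local Notation side := (side lc ld lx ly).
Local Notation pr_CD := (pr_CD lc ld lx ly).
Local Notation concentrated := (concentrated lc ld lx ly).
Local Notation inv := (invariant_prob X T).

Lemma pr_big (nu : prob) (E : letter -> set R) (s : seq letter) : uniq s ->
  (forall l, measurable (E l : set RT)) ->
  (forall l l', l != l' -> [disjoint E l & E l']) ->
  pr nu (\big[setU/set0]_(l <- s) E l) = \sum_(l <- s) pr nu (E l).
Proof.
move=> us mE dE; elim: s us => [_|l s ih /= /andP[ls us]].
  by rewrite !big_nil pr0.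
rewrite !big_cons pr_setU ?ih //; first exact: bigsetU_measurable.
apply/disj_set2P; rewrite -subset0 => z [zl].
elim: s {ih us} ls => [|l' s ih]; first by rewrite big_nil.
rewrite in_cons negb_or => /andP[ll' ls]; rewrite big_cons => -[zl'|]; last exact: ih.
by have /disj_set2P := dE _ _ ll'; rewrite -subset0; apply.
Qed.

Lemma uniform_prob_exists : exists mu : prob,
  forall E, measurable (E : set RT) -> mu E = (lebesgue_measure (E `&` X) * (J 0)^-1%:E)%E.
Proof.
have leJ : lebesgue_measure (X : set RT) = (J 0)%:E.
  by rewrite /idom lebesgue_measure_itv /= lte_fin (J_gt0 ren) oppr0 adde0.
exact: (conditional_prob (dirac (0 : RT)) (measurable_idom lc ld lx ly) leJ (J_gt0 ren)).
Qed.

Lemma measurable_preimage B : measurable (B : set RT) ->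
  measurable (X `&` T @^-1` B : set RT).
Proof.
move=> mB; pose t l := trans (lc 0) (ld 0) (lx 0) (ly 0) l.
rewrite (_ : _ `&` _ = \big[setU/set0]_(l <- letters)
    (level 0 l 0 `&` (fun z : RT => z + t l) @^-1` B)).
  apply: bigsetU_measurable => l _; apply: measurableI.
    exact: (measurable_level ren (leq0n _)).
  rewrite -[X in measurable X]setTI.
  have mt : measurable_fun setT (fun z : RT => z + t l : RT).
    by apply: measurable_funD; [exact: measurable_id|exact: measurable_cst].
  exact: mt.
have levelT l z : level 0 l 0 z -> T z = z + t l.
  by move=> [w wl <-]; apply: (TkE ren).
rewrite -bigcup_seq; apply/seteqP; split => z.
  move=> [Xz Bz]; have [l zl] := Ik_cover ren (proj1 (idomE _ _ _ _ z) Xz).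
  have zl' : level 0 l 0 z by exists z.
  exists l; first by case: l {zl zl'}.
  by split => //=; rewrite -(levelT _ _ zl').
move=> [l _ [zl Bz]]; split; first exact: (level_X ren zl).
by rewrite /= (levelT _ _ zl).
Qed.

Section Uniform.
Variable mu : prob.
Hypothesis muE : forall E, measurable (E : set RT) ->
  mu E = (lebesgue_measure (E `&` X) * (J 0)^-1%:E)%E.

Local Notation lenk k l := (len (lc k) (ld k) (lx k) (ly k) l).

Lemma muE_sub E : measurable (E : set RT) -> E `<=` X ->
  mu E = (lebesgue_measure E * (J 0)^-1%:E)%E.
Proof. by move=> mE EX; rewrite muE //; move/setIidPl: EX => ->. Qed.

Lemma mu_X : mu X = 1%E.
Proof.
have J0 := J_gt0 ren.
rewrite muE_sub //; last exact: measurable_idom.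
rewrite /idom lebesgue_measure_itv /= lte_fin J0 oppr0 adde0 -EFinM divff //.
by rewrite gt_eqF.
Qed.

Lemma mu_level k l : pr mu (level k l 0) = lenk k l / J 0.
Proof.
have h0 : (0 <= h k l)%N by [].
rewrite /pr muE_sub; [|exact: (measurable_level ren h0)|exact: (level_X ren)].
rewrite (level_itv ren h0) lebesgue_measure_itv /= lte_fin ltrDl (lenk_gt0 ren).
by rewrite -EFinB -EFinM /=; congr (_ / _); lra.
Qed.

(* On I_l the map T is the translation by t_l, and both the I_l and the T I_l
   partition X. *)
Lemma mu_invariant : inv mu.
Proof.
split=> [|B mB BX]; first exact: mu_X.
have h01 l : h 0 l = 1%N by [].
have mf i l : (i <= 1)%N -> measurable (level 0 l i : set RT).
  by move=> hi; apply: (measurable_level ren); rewrite h01.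
have levelT l z : level 0 l 0 z -> T z = z + trans (lc 0) (ld 0) (lx 0) (ly 0) l.
  by move=> [w wl <-]; apply: (TkE ren).
pose P l := X `&` T @^-1` B `&` level 0 l 0; pose Q l := B `&` level 0 l 1.
have PE l : P l = (fun z : RT => z + trans (lc 0) (ld 0) (lx 0) (ly 0) l) @^-1` Q l.
  apply/seteqP; split => z /=.
    move=> [[Xz Bz] zl]; rewrite -(levelT l z zl); split => //.
    by case: zl => w wl <-; exists w.
  set t := trans _ _ _ _ _; move=> [Bz [w wl e]].
  have ew : z = w by move: e => /=; rewrite (TkE ren wl) -/t; lra.
  rewrite ew; have wX : X w by apply/idomE; exact: (I_J0 ren wl).
  split; last by exists w.
  by split=> //=; rewrite (TkE ren wl) -/t -ew.
have mQ l : measurable (Q l : set RT) by apply: measurableI => //; exact: mf.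
have mP l : measurable (P l : set RT).
  rewrite PE -[X in measurable X]setTI.
  have mt : measurable_fun setT (fun z : RT => z + trans (lc 0) (ld 0) (lx 0) (ly 0) l : RT).
    by apply: measurable_funD; [exact: measurable_id|exact: measurable_cst].
  exact: mt.
have PQ l : pr mu (P l) = pr mu (Q l).
  rewrite /pr !muE_sub //; [|by move=> z [/BX]|by move=> z [[]]].
  by rewrite PE lebesgue_translate.
have Xcov z : X z -> exists l, level 0 l 0 z.
  by move=> /idomE/(Ik_cover ren)[l zl]; exists l, z.
have Xcov1 z : X z -> exists l, level 0 l 1 z.
  move=> /idomE/(T_surj ren)[w wX <-]; have [l wl] := Ik_cover ren wX.
  by exists l, w.
have dP l l' : l != l' -> [disjoint P l & P l'].
  move=> ll'; apply/disj_set2P; rewrite -subset0 => z [[_ zl] [_ zl']].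
  have := @level_disj _ _ _ _ _ ren 0 l l' 0 0 isT isT; rewrite xpair_eqE eqxx andbT => /(_ ll').
  by move=> /disj_set2P; rewrite -subset0; apply; split; [exact: zl|exact: zl'].
have dQ l l' : l != l' -> [disjoint Q l & Q l'].
  move=> ll'; apply/disj_set2P; rewrite -subset0 => z [[_ [w wl ez]] [_ [w' wl' ez']]].
  have ww' : w = w'.
    apply: (T_inj ren); [exact: (I_J0 ren wl)|exact: (I_J0 ren wl')|].
    by move: ez ez' => /= -> ->.
  by move/eqP: ll'; apply; apply: (Ik_uniq ren wl); rewrite ww'.
have mBT := measurable_preimage mB.
rewrite !prE //; congr (_%:E).
transitivity (pr mu (\big[setU/set0]_(l <- letters) P l)).
  congr (pr mu _); apply/seteqP; split => z.
    move=> [Xz Bz]; have [l zl] := Xcov z Xz.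
    by rewrite -bigcup_seq; exists l => //=; case: l {zl}.
  by rewrite -bigcup_seq => -[l _ []].
rewrite pr_big // (eq_bigr (fun l => pr mu (Q l))); last by move=> l _; exact: PQ.
rewrite -pr_big //; congr (pr mu _); apply/seteqP; split => z.
  by rewrite -bigcup_seq => -[l _ []].
move=> Bz; have [l zl] := Xcov1 z (BX z Bz).
by rewrite -bigcup_seq; exists l => //=; case: l {zl}.
Qed.

Lemma mu_tower k l : pr mu (tower k l) = (h k l)%:R * (lenk k l / J 0).
Proof. by rewrite (pr_subtowerE ren mu_invariant (leqnn _)) mu_level. Qed.

Lemma mu_side_sym k : pr mu (side k true) = pr mu (side k false).
Proof. by rewrite !(pr_side ren) /= !mu_tower h_B1 h_B2. Qed.

Lemma mu_side_le k s : pr mu (side k s) <= 1 / 2.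
Proof.
have := pr_sides ren k mu_invariant; have := mu_side_sym k.
have : 0 <= pr_CD mu k by rewrite addr_ge0 ?pr_ge0.
by case: s; lra.
Qed.

Lemma mu_pC (e : R) : 0 < e -> exists K : nat, forall k, (K <= k)%N -> pr_CD mu k <= e.
Proof.
move=> e0; have J0 := J_gt0 ren.
have [K HK] := area (mulr_gt0 e0 J0); exists K => k /HK hk.
have := pr_sides ren k mu_invariant; have := mu_side_sym k.
have := pr_side ren mu k true; rewrite /= !mu_tower /=.
have : 1 - e <= 2 * ((h k A1)%:R * (ly k / J 0)).
  rewrite !mulrA ler_pdivlMr // mulrBl mul1r; move: hk; rewrite !mulrA; lra.
have : 0 <= (h k A2)%:R * (lx k / J 0).
  have [[_ _ x0 _] _ _ _] := ren k.
  by rewrite mulr_ge0 // divr_ge0 // ltW.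
lra.
Qed.

Lemma route_towers k w s z z' j : itinerary lc ld lx ly k w z z' -> all (mem s) w ->
  (j < hts nn mm k w)%N -> towers k s (iter j T z).
Proof.
elim: w z j => [|l w ih] z j //= [zl hr] /andP[ls ws].
move=> /ltn_hts_cons[jl|[j' -> jw]].
  by apply/towersP; exists l => //; apply/subtowerP; exists z, j.
by rewrite iterD (iter_ht ren zl) (TkE ren zl); apply: ih.
Qed.

(** The words of [A1] and [A2] begin with C B2 and use only the letters [A1] and [A2] from there
    on. *)
Lemma sideA_step k l z i : l = A1 \/ l = A2 -> I k.+1 l z ->
  (h k C + h k B2 <= i < h k.+1 l)%N -> side k true (iter i T z).
Proof.
move=> hl zl /andP[i1 i2].
have [w ew ws] : exists2 w, word (nn k) (mm k) l = [:: C; B2] ++ w &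
    all (mem [:: A1; A2]) w.
  case: hl => ->; [exists (A2 :: nseq (nn k).+1 A1 ++ [:: A2])
                  |exists (A2 :: nseq (nn k) A1 ++ [:: A2])] => //;
    by rewrite /= all_cat all_nseq /= orbT.
have := itinerary_return_word ren zl; rewrite /return_word ew => /(itinerary_split ren)[_ hr].
have eh : h k.+1 l = (h k C + h k B2 + hts nn mm k w)%N.
  by rewrite hS ew map_cat sumn_cat /= addn0.
have e2 : hts nn mm k [:: C; B2] = (h k C + h k B2)%N by rewrite /hts /= addn0.
rewrite -(subnK i1) iterD -e2; apply: route_towers hr ws _.
by rewrite e2; lia.
Qed.

(** Only the floors of C B2 at the bottom are new, a share of at most [1 / 2 ^+ k] of the height.
    These bounds are summable, as in the Borel-Cantelli lemma. *)
Lemma mu_sideA_step k : pr mu (side k.+1 true `\` side k true) <= 1 / 2 ^+ k.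
Proof.
pose n := (h k C + h k B2)%N.
have nA2 : (n <= h k.+1 A2)%N by rewrite h_A2S /n h_B2; lia.
have nA1 : (n <= h k.+1 A1)%N by rewrite h_A1S (leq_trans nA2) // leq_addr.
have mA1 := measurable_subtower ren nA1; have mA2 := measurable_subtower ren nA2.
have mS k0 s : measurable (side k0 s : set RT) by apply: (measurable_towers ren).
apply: (@le_trans _ _ (pr mu (subtower k.+1 A1 n `|` subtower k.+1 A2 n))).
  apply: pr_le; [exact: measurableD|exact: measurableU|].
  move=> z [/towersP[l]]; rewrite !inE => hl /subtowerP[w [i [wl hi ->]]] nz.
  have hl' : l = A1 \/ l = A2 by case/orP: hl => /eqP ->; [left|right].
  have i_n : (i < n)%N.
    rewrite ltnNge; apply/negP => ni; apply: nz; apply: (sideA_step hl' wl).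
    by rewrite ni.
  by case: hl' wl => -> wl; [left|right]; apply/subtowerP; exists w, i.
apply: le_trans (pr_leU mu mA1 mA2) _.
rewrite (pr_subtowerE ren mu_invariant nA1) (pr_subtowerE ren mu_invariant nA2) -mulrDr.
have p0 l : 0 <= pr mu (level k.+1 l 0) := pr_ge0 mu _.
have hs : (h k.+1 A2)%:R * (pr mu (level k.+1 A1 0) + pr mu (level k.+1 A2 0)) <= 1.
  have := pr_le1 mu (mS k.+1 true); rewrite (pr_side ren) /=.
  rewrite (pr_subtowerE ren mu_invariant (leqnn _)) (pr_subtowerE ren mu_invariant (leqnn _)).
  apply: le_trans; rewrite mulrDr lerD2r ler_wpM2r // ler_nat h_A1S leq_addr //.
rewrite ler_pdivlMr ?exprn_gt0 //; apply: le_trans hs.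
rewrite mulrAC ler_wpM2r ?addr_ge0 // -natrX -natrM ler_nat.
apply: leq_trans (h_A2_ge k); rewrite mulnC leq_mul2l /n h_B2; lia.
Qed.

Definition tailA K : set R := \bigcup_(j in [set: nat]) side (K + j) true.
(** The limsup of the A sides; by [mu_limA_sub] it lies in each deep A side up to a small
    measure. *)
Definition limA : set R := \bigcap_(K in [set: nat]) tailA K.

Lemma measurable_side k s : measurable (side k s : set RT).
Proof. exact: (measurable_towers ren). Qed.

Lemma measurable_tailA K : measurable (tailA K : set RT).
Proof. by apply: bigcupT_measurable => j; apply: measurable_side. Qed.

Lemma measurable_limA : measurable (limA : set RT).
Proof. by apply: bigcapT_measurable => K; apply: measurable_tailA. Qed.

(** Level [K + n.+1] adds at most [1 / 2 ^+ (K + n)], a geometric series with sum [2 / 2 ^+ K];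
    continuity from below passes to the whole union. *)
Lemma mu_tailA K : pr mu (tailA K `\` side K true) <= 2 / 2 ^+ K.
Proof.
have bigE n : \big[setU/set0]_(j < n) side (K + j) true =
    \bigcup_(j < n) side (K + j) true by rewrite (bigcup_mkord n (fun j => side (K + j) true)).
pose F n := (\big[setU/set0]_(j < n.+1) side (K + j) true) `\` side K true.
have mF n : measurable (F n : set RT).
  by apply: measurableD; [apply: bigsetU_measurable => j _|]; apply: measurable_side.
have FE : \bigcup_n F n = tailA K `\` side K true.
  apply/seteqP; split => z.
    move=> [n _ []]; rewrite bigE => -[j _ zj] nz; split => //.
    by exists j.
  by move=> [[j _ zj] nz]; exists j => //; split => //; rewrite bigE; exists j => /=.
have hF n : pr mu (F n) <= 2 / 2 ^+ K - 2 / 2 ^+ (K + n).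
  elim: n => [|n ih].
    by rewrite /F big_ord1 addn0 setDv pr0 subrr.
  have := mu_sideA_step (K + n); rewrite -addnS => hs.
  apply: (@le_trans _ _ (pr mu (F n `|` (side (K + n.+1) true `\` side (K + n) true)))).
    apply: pr_le => //.
      by apply: measurableU => //; apply: measurableD; apply: measurable_side.
    move=> z [+ nz]; rewrite big_ord_recr /= => -[zn|zn]; first by left.
    have [h0|h0] := pselect (side (K + n) true z); last by right.
    left; split => //; rewrite bigE; exists n => //=.
  apply: le_trans (pr_leU mu (mF n) _) _.
    by apply: measurableD; apply: measurable_side.
  rewrite addnS exprS invfM (mulrA 2) divff ?mul1r //.
  move: ih hs; rewrite -addnS; move: (2 / 2 ^+ K) => a; lra.
have Fmono : {homo F : n m / (n <= m)%N >-> (n <= m)%O}.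
  move=> n m nm; apply/subsetPset => z [zn nz]; split => //.
  by move: zn; rewrite !bigE => -[j /= jn zj]; exists j => //=; apply: leq_trans jn _.
have mtl : measurable (tailA K `\` side K true : set RT).
  by apply: measurableD; [apply: measurable_tailA|apply: measurable_side].
have hcv := nondecreasing_cvg_mu (mu := mu) mF.
rewrite FE in hcv; have {}hcv := hcv mtl Fmono.
rewrite -lee_fin -prE //; apply: (cvge_to_le hcv).
apply: nearW => n /=; rewrite prE // lee_fin (le_trans (hF n)) //.
by rewrite gerBl divr_ge0 // exprn_ge0.
Qed.

Lemma mu_limA_sub K : pr mu (limA `\` side K true) <= 2 / 2 ^+ K.
Proof.
apply: le_trans (mu_tailA K); apply: pr_le.
- by apply: measurableD; [apply: measurable_limA|apply: measurable_side].
- by apply: measurableD; [apply: measurable_tailA|apply: measurable_side].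
- by move=> z [zl nz]; split => //; apply: zl.
Qed.

Lemma mu_limA : pr mu limA = 1 / 2.
Proof.
apply/eqP; rewrite eq_le; apply/andP; split; apply/ler_addgt0Pr => e e0.
  have [K HK] := div_exp2_le e0 (ler0n R 2).
  have := HK K (leqnn _); have := mu_limA_sub K; have := mu_side_le K true.
  have : pr mu limA <= pr mu (side K true) + pr mu (limA `\` side K true).
    apply: le_trans (pr_leU _ _ _); rewrite ?setDE; last first.
    - by apply: measurableD; [apply: measurable_limA|apply: measurable_side].
    - exact: measurable_side.
    apply: pr_le.
    - exact: measurable_limA.
    - by apply: measurableU; [apply: measurable_side|apply: measurableD; [apply: measurable_limA|apply: measurable_side]].
    - by move=> z zl; have [?|?] := pselect (side K true z); [left|right].
  lra.
have e20 : 0 < e / 2 by lra.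
have [K0 HK0] := mu_pC e20.
(* For the lower bound, a tail contains its first side, which has nearly half of the mass by
   symmetry and [mu_pC], and the tails decrease to [limA]. *)
have tail_ge K : 1 / 2 - e <= pr mu (tailA (K0 + K)).
  have h1 : pr mu (side (K0 + K) true) <= pr mu (tailA (K0 + K)).
    apply: pr_le; [exact: measurable_side|exact: measurable_tailA|].
    by move=> z zs; exists 0%N => //; rewrite addn0.
  have := pr_sides ren (K0 + K) mu_invariant; have := mu_side_sym (K0 + K).
  have := HK0 (K0 + K)%N (leq_addr _ _); lra.
have hcv : (mu \o (fun K => tailA (K0 + K))) @ \oo --> mu (\bigcap_K tailA (K0 + K)).
  apply: nonincreasing_cvg_mu.
  - by rewrite (le_lt_trans (probability_le1 mu (measurable_tailA _))) // ltry.
  - by move=> K; apply: measurable_tailA.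
  - by apply: bigcapT_measurable => K; apply: measurable_tailA.
  - move=> n m nm; apply/subsetPset => z [j _ zj]; exists (m - n + j)%N => //.
    by rewrite (_ : (K0 + n + (m - n + j))%N = (K0 + m + j)%N) //; lia.
have eqL : \bigcap_K tailA (K0 + K) = limA.
  apply/seteqP; split => z zl K _; last exact: zl.
  have [j _ zj] := zl K Logic.I; exists (K0 + j)%N => //.
  by rewrite (_ : (K + (K0 + j))%N = (K0 + K + j)%N) //; lia.
rewrite eqL in hcv; rewrite -lerBlDr -lee_fin -prE; last exact: measurable_limA.
apply: (cvge_to_ge hcv); apply: nearW => K /=.
by rewrite prE ?lee_fin //; exact: measurable_tailA.
Qed.

Definition pre0 : set R := \bigcup_n (X `&` [set z | iter n T z = 0]).

Lemma measurable_pre0n n : measurable (X `&` [set z | iter n T z = 0] : set RT) /\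
  mu (X `&` [set z | iter n T z = 0]) = 0%E.
Proof.
have [[w [Xw w0]]|nw] := pselect (exists w, X w /\ iter n T w = 0).
  have -> : X `&` [set z | iter n T z = 0] = [set w].
    apply/seteqP; split => z.
      move=> [/idomE Xz z0]; apply: (iterT_inj ren (i := n) Xz (proj1 (idomE _ _ _ _ w) Xw)).
      by rewrite w0.
    by move=> ->.
  have mw : measurable ([set w] : set RT) by apply: measurable_set1.
  split => //; rewrite muE_sub //; last by move=> _ ->.
  by rewrite lebesgue_measure_set1 mul0e.
have -> : X `&` [set z | iter n T z = 0] = set0.
  by apply/seteqP; split => z // [Xz z0]; apply: nw; exists z.
by split; [exact: measurable0|rewrite measure0].
Qed.

Lemma measurable_pre0 : measurable (pre0 : set RT).
Proof. by apply: bigcupT_measurable => n; have [] := measurable_pre0n n. Qed.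

Lemma mu_pre0 : pr mu pre0 = 0.
Proof.
have : mu.-negligible pre0.
  apply: negligible_bigcup => n; exists (X `&` [set z | iter n T z = 0]).
  by have [? ?] := measurable_pre0n n; split.
by move=> /negligibleP h; rewrite /pr h //; exact: measurable_pre0.
Qed.

(** Top floors are mapped into [[0, J k[], so a step ending at or beyond [J k] stays inside one
    tower. When [T z] is positive, this happens at all deep levels. *)
Lemma side_T k s z : X z -> J k <= T z -> side k s z <-> side k s (T z).
Proof.
move=> Xz hJ; have up l : tower k l z -> tower k l (T z).
  move=> /subtowerP[w [i [wl hi ez]]]; apply/subtowerP.
  have [hi1|] := ltnP i.+1 (h k l); first by exists w, i.+1; rewrite ez.
  move=> hi1; have ei : i.+1 = h k l by apply/eqP; rewrite eqn_leq hi.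
  have eT : T z = Tk lc ld lx ly k w by rewrite -(iter_ht ren wl) -/(h k l) -ei /= -ez.
  have := Tk_in ren (Ik_J ren wl); rewrite -eT => /andP[_].
  by rewrite ltNge hJ.
split.
  by move=> /towersP[l ls zl]; apply/towersP; exists l => //; apply: up.
move=> /towersP[l ls /subtowerP[w [i [wl hi ew]]]].
have [l' [w' [i' [wl' hi' ew']]]] := floor_cover ren k (proj1 (idomE lc ld lx ly z) Xz).
have zl' : tower k l' z by apply/subtowerP; exists w', i'.
have /subtowerP[w2 [i2 [wl2 hi2 ew2]]] := up l' zl'.
have [el _ _] := floor_uniq ren wl2 wl hi2 hi (etrans (esym ew2) ew).
by apply/towersP; exists l => //; rewrite -el.
Qed.

Lemma limA_T z : X z -> T z != 0 -> limA z <-> limA (T z).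
Proof.
move=> Xz Tz0; have T0 : 0 < T z.
  by rewrite lt_def Tz0; have /idomE/andP[] := exch_idom ren Xz.
have [K0 HK0] := J_small ren T0.
have tailT K : tailA (K0 + K) z <-> tailA (K0 + K) (T z).
  by split=> -[j _ zj]; exists j => //; apply/(side_T true Xz) => //; apply: HK0; lia.
have limE w : limA w <-> forall K, tailA (K0 + K) w.
  split=> [wl K|H K _]; first exact: wl.
  have [j _ zj] := H K; exists (K0 + j)%N => //.
  by rewrite (_ : (K + (K0 + j))%N = (K0 + K + j)%N) //; lia.
by split=> /limE H; apply/limE => K; apply/tailT.
Qed.

Lemma limA_0 : ~ limA 0.
Proof.
move=> /(_ 0%N Logic.I)[j _ /towersP[l ls /subtowerP[w [i [wl hi e]]]]].
have := floor_uniq ren (zero_C ren (0 + j)) wl (h_gt0 (0 + j) C) hi e.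
by move=> [el _ _]; move: ls; rewrite -el.
Qed.

Lemma limA_X : limA `<=` X.
Proof. by move=> z /(_ 0%N Logic.I)[j _]; apply: (towersX ren). Qed.

(* limA is invariant except at the preimage of 0: T^-1(0) lies on top of all
   the towers over A2. *)
Definition compA (s : bool) : set R := if s then limA `\` pre0 else X `\` (limA `\` pre0).

Lemma measurable_compA s : measurable (compA s : set RT).
Proof.
have h : measurable (limA `\` pre0 : set RT).
  by apply: measurableD; [exact: measurable_limA|exact: measurable_pre0].
by case: s => //=; apply: measurableD => //; exact: measurable_idom.
Qed.

Lemma compA_X s : compA s `<=` X.
Proof. by case: s => z [] // /limA_X. Qed.

Lemma compA_T s z : X z -> compA s z <-> compA s (T z).
Proof.
suff H : X z -> compA true z <-> compA true (T z).
  case: s => // Xz; split=> -[_ nz].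
    by split; [exact: (exch_idom ren Xz)|move/(H Xz)].
  by split => // /(H Xz).
move=> Xz; have preT : pre0 (T z) -> pre0 z.
  by move=> [n _ [_ e]]; exists n.+1 => //; split => //; rewrite /mkset iterSr.
have pre00 w : X w -> w = 0 -> pre0 w by move=> Xw w0; exists 0%N.
split=> -[zl nz].
  have Tz0 : T z != 0.
    by apply/eqP => e; apply/nz/preT/pre00 => //; exact: (exch_idom ren Xz).
  by split; [apply/(limA_T Xz Tz0)|move/preT].
have Tz0 : T z != 0.
  by apply/eqP => e; apply/nz/pre00 => //; exact: (exch_idom ren Xz).
have zlA : limA z by apply/(limA_T Xz Tz0).
split => // -[[|n] _ [_ e]].
  by apply: limA_0; rewrite /= in e; rewrite -e.
by apply: nz; exists n => //; split; [exact: (exch_idom ren Xz)|rewrite /mkset -iterSr].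
Qed.

Lemma compA_inv s : X `&` T @^-1` compA s = compA s.
Proof.
apply/seteqP; split => z; first by move=> [Xz] /(compA_T s Xz).
by move=> zs; have Xz := compA_X zs; split => //; apply/(compA_T s Xz).
Qed.

Lemma mu_compA s : pr mu (compA s) = 1 / 2.
Proof.
have mL := measurable_limA; have mP := measurable_pre0.
have hT : pr mu (compA true) = 1 / 2.
  rewrite /= pr_setD // mu_limA [pr mu (_ `&` _)](_ : _ = 0) ?subr0 //.
  apply/eqP; rewrite eq_le pr_ge0 andbT -mu_pre0; apply: pr_le => //.
  exact: measurableI.
case: s => //; rewrite [compA false]/= pr_setD; last exact: (measurable_compA true).
  rewrite (_ : _ `&` _ = compA true) ?hT ?(pr_idom mu_invariant); first by lra.
  by apply/seteqP; split => z; [case|move=> zz; split => //; exact: compA_X zz].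
exact: measurable_idom.
Qed.

Lemma compA_exists (s : bool) : exists nu : prob, forall E, measurable (E : set RT) ->
  nu E = (mu (E `&` compA s) * ((1 / 2)^-1)%:E)%E.
Proof.
have e : mu (compA s) = (1 / 2)%:E by rewrite (prE _ (measurable_compA s)) mu_compA.
have half0 : (0 : R) < 1 / 2 by lra.
exact: (conditional_prob (dirac (0 : RT)) (measurable_compA s) e half0).
Qed.

Section Component.
Variables (s : bool) (nu : prob).
Hypothesis nuE : forall E, measurable (E : set RT) ->
  nu E = (mu (E `&` compA s) * ((1 / 2)^-1)%:E)%E.

Let pr_nu E : measurable (E : set RT) -> pr nu E = 2 * pr mu (E `&` compA s).
Proof.
move=> mE; rewrite /pr nuE // prE; last by apply: measurableI => //; exact: measurable_compA.
by rewrite /= mulrC; congr (_ * _); lra.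
Qed.

Lemma comp_invariant : inv nu.
Proof.
split=> [|B mB BX].
  rewrite prE; last exact: measurable_idom.
  rewrite pr_nu ?(setIidr (compA_X (s := s))) ?mu_compA; last exact: measurable_idom.
  by congr (_%:E); lra.
have mS := measurable_compA s; have mP := measurable_preimage mB.
rewrite !prE // !pr_nu //; congr ((2 * _)%:E).
have mBS : measurable (B `&` compA s : set RT) by apply: measurableI.
have [_ H] := mu_invariant.
have : mu (X `&` T @^-1` (B `&` compA s)) = mu (B `&` compA s).
  by apply: H => // z [/BX].
rewrite /pr => <-; congr (fine (mu _)).
by rewrite -{1}(compA_inv s) preimage_setI setIACA setIid setIA.
Qed.

(** For the A component this is [mu_limA_sub]. A point of the B component off the B side lies in a
    tower over C or D, or else in the A side without being in the A component; both sets are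
    small. *)
Lemma comp_concentrated : concentrated nu s.
Proof.
move=> e e0; have e40 : 0 < e / 8 by lra.
have [K1 HK1] := div_exp2_le e40 (ler0n R 2).
have [K2 HK2] := mu_pC e40.
exists (K1 + K2)%N => k kK.
have mS := measurable_compA s; have ms := measurable_side k s.
have mC := measurable_compA true; have mk := measurable_side k true.
have mf := measurable_side k false.
have -> : 1 - pr nu (side k s) = 2 * (pr mu (compA s) - pr mu (side k s `&` compA s)).
  by rewrite mu_compA pr_nu //; lra.
rewrite [side k s `&` _]setIC -pr_setD //.
have hA : pr mu (compA true `\` side k true) <= e / 8.
  apply: le_trans (HK1 k _); last by lia.
  apply: le_trans (mu_limA_sub k); apply: pr_le.
  - exact: measurableD.
  - by apply: measurableD => //; apply: measurable_limA.
  - by move=> z [[? _] ?].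
case: s mS ms => mS ms; first by lra.
(* The component has measure 1/2 and is nearly contained in the side, whose measure is at most
   1/2. *)
have hB : pr mu (side k true `\` compA true) <= e / 8.
  rewrite pr_setD // setIC; have := mu_side_le k true; have := hA.
  by rewrite pr_setD // mu_compA; lra.
have hC := HK2 k ltac:(lia).
have mCC := measurableU _ _ (measurable_tower ren k C) (measurable_tower ren k D).
have mD : measurable (side k true `\` compA true : set RT) by apply: measurableD.
apply: (@le_trans _ _ (2 * (e / 8 + e / 8))); last by lra.
rewrite ler_wpM2l //; apply: (@le_trans _ _ (pr mu ((side k true `\` compA true) `|`
  (tower k C `|` tower k D)))).
  apply: pr_le; [exact: measurableD|exact: measurableU|].
  move=> z [[Xz nz] nf].
  have [st|nt] := pselect (side k true z); first by left.
  right; move: Xz nf nt; rewrite -(towers_letters ren k) => /towersP[l _ zl] nf nt.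
  have inS l0 s0 : l0 \in [:: small s0; big s0] -> tower k l0 z -> side k s0 z.
    by move=> h0 h1; apply/towersP; exists l0.
  case: l zl => zl; [by left|by right|..]; exfalso;
    first [exact: (nt (inS A1 true isT zl)) | exact: (nt (inS A2 true isT zl))
          |exact: (nf (inS B1 false isT zl)) | exact: (nf (inS B2 false isT zl))].
apply: le_trans (pr_leU _ mD mCC) _; rewrite lerD //.
apply: le_trans hC; apply: pr_leU; exact: measurable_tower ren _ _.
Qed.

Lemma comp_self s' : pr nu (compA s') = if s' == s then 1 else 0.
Proof.
have mS := measurable_compA s'.
rewrite pr_nu //; have [->|ne] := eqVneq s' s.
  by rewrite setIid mu_compA; lra.
rewrite (_ : _ `&` _ = set0) ?pr0 ?mulr0 //.
apply/seteqP; split => z //; case: s' s ne {mS} => [] [] // _ [].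
- by move=> h [_]; apply.
- by move=> [_ +] h; apply.
Qed.

End Component.
End Uniform.
End Lebesgue.

(** * Ergodic measures and genericity *)

Section Conclusion.
Variables (R : realType) (lc ld lx ly : nat -> R).
Hypothesis ren : renormalizable lc ld lx ly nn mm.
Hypothesis area : forall e : R, 0 < e -> exists K : nat, forall k, (K <= k)%N ->
  Jk lc ld lx ly 0 - e <= 2 * ((h k A1)%:R * ly k).

Notation RT := (measurableTypeR R).
Notation prob := (probability RT R).
Local Notation T := (Tk lc ld lx ly 0).
Local Notation I := (Ik lc ld lx ly).
Local Notation J := (Jk lc ld lx ly).
Local Notation X := (idom lc ld lx ly).
Local Notation tower := (tower lc ld lx ly).
Local Notation near_avg := (near_avg lc ld lx ly).
Local Notation flat := (flat lc ld lx ly).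
Local Notation side := (side lc ld lx ly).
Local Notation pr_CD := (pr_CD lc ld lx ly).
Local Notation concentrated := (concentrated lc ld lx ly).
Local Notation compA := (compA lc ld lx ly).
Local Notation dev := (deviation lc ld lx ly).
Local Notation inv := (invariant_prob X T).

Variable mu : prob.
Hypothesis muE : forall E, measurable (E : set RT) ->
  mu E = (lebesgue_measure (E `&` X) * (J 0)^-1%:E)%E.
Variable nus : bool -> prob.
Hypothesis nusE : forall s E, measurable (E : set RT) ->
  nus s E = (mu (E `&` compA s) * ((1 / 2)^-1)%:E)%E.

(** The target lies on a floor over some [l]; the orbit visits the base of that tower and climbs to
    the same floor, whose length is at most [e]. *)
Lemma T_minimal : minimal_on X T.
Proof.
move=> z Xz w Xw; rewrite /closure /= => B /nbhs_ballP[e /= e0 Be].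
have [K HK] := J_small ren e0.
have [l [v [i [vl hi ew]]]] := floor_cover ren K (proj1 (idomE _ _ _ _ w) Xw).
have [j zj] := visit_all ren K l (proj1 (idomE _ _ _ _ z) Xz).
exists (iter i T (iter j T z)); split; first by exists (i + j)%N => //; rewrite iterD.
apply: Be; rewrite /ball /= ew (iter_translation ren zj vl (ltnW hi)).
have := HK K (leqnn _); move: (Ik_J ren vl) (Ik_J ren zj) => /andP[? ?] /andP[? ?] ?.
by rewrite ltr_norml; apply/andP; split; lra.
Qed.

Section Phi.
Variables (phi : R -> R) (M : R).
Hypothesis phi_le : forall z, X z -> `|phi z| <= M.
Hypothesis phi_meas : measurable_fun (X : set RT) (phi : RT -> RT).
Hypothesis phi_flat : flat phi.

Let phi_le' z : 0 <= z < J 0 -> `|phi z| <= M.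
Proof. by move=> /idomE; apply: phi_le. Qed.

Definition theta s := \int[nus s]_(z in X) phi z.

Lemma nus_inv s : inv (nus s).
Proof. exact: (comp_invariant ren area muE (@nusE s)). Qed.

Lemma nus_conc s : concentrated (nus s) s.
Proof. exact: (comp_concentrated ren area muE (@nusE s)). Qed.

Lemma theta_lim s (e : R) : 0 < e -> exists K : nat, forall k, (K <= k)%N ->
  near_avg phi k (small s) e (theta s) /\ near_avg phi k (big s) e (theta s).
Proof.
exact: (near_avg_integral ren phi_le phi_meas phi_flat (nus_inv s) (@nus_conc s)).
Qed.

Let th_lim s (e : R) : 0 < e -> exists K : nat, forall k, (K <= k)%N ->
  near_avg phi k (big s) e (theta s).
Proof. by move=> /(theta_lim s)[K HK]; exists K => k /HK[]. Qed.

Lemma theta_le s : `|theta s| <= M.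
Proof.
have mX := measurable_idom lc ld lx ly.
have ic (nu : prob) r : nu.-integrable X (EFin \o (fun z : R => r)).
  apply: measurable_bounded_integrable => //.
    by rewrite (le_lt_trans (probability_le1 nu mX)) // ltry.
  by exists `|r|; split; [exact: num_real|move=> x hx z _ /=; exact: ltW].
have ip : (nus s).-integrable X (EFin \o phi).
  have := phi_integrable (nus s) phi_le phi_meas 0 mX (@subset_refl _ X).
  by apply: eq_integrable => // z _ /=; rewrite subr0.
have cst r : (\int[nus s]_(z in X) r) = r.
  by rewrite Rintegral_cst // -[fine _]/(pr (nus s) X) (pr_idom (nus_inv s)) mulr1.
rewrite ler_norml /theta; apply/andP; split.
  rewrite -[leLHS]cst; apply: (le_Rintegral mX (ic _ _) ip) => z /phi_le.
  by rewrite ler_norml => /andP[].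
rewrite -[leRHS]cst; apply: (le_Rintegral mX ip (ic _ _)) => z /phi_le.
by rewrite ler_norml => /andP[].
Qed.

Definition limit_avg (l : letter) : R :=
  match l with A1 | A2 => theta true | B1 | B2 => theta false
             | C | D => thm theta end.

Lemma near_all (e : R) : 0 < e -> exists K : nat, forall k l, (K <= k)%N ->
  near_avg phi k l e (limit_avg l).
Proof.
move=> e0; have [K1 H1] := theta_lim true e0; have [K2 H2] := theta_lim false e0.
have [K3 H3] := near_avg_CD ren phi_le' theta_le th_lim e0.
exists (K1 + K2 + K3)%N => k l kK.
have [h1 h2] := H1 k ltac:(lia); have [h3 h4] := H2 k ltac:(lia).
case: l => //=; apply: H3; try lia; by [left|right].
Qed.

(** The weight of the A side, the towers over C and D being split evenly because [limit_avg] is the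
    mean there. It is the same for all observables. *)
Definition tau (nu : prob) k := pr nu (side k true) + pr_CD nu k / 2.

Lemma integral_tau nu (e : R) : inv nu -> 0 < e -> exists K : nat, forall k, (K <= k)%N ->
  `|\int[nu]_(z in X) phi z - (tau nu k * theta true + (1 - tau nu k) * theta false)| <= e.
Proof.
move=> hnu e0; have e20 : 0 < e / 2 by lra.
have [K1 H1] := near_all e20; have [K2 H2] := phi_flat e20.
exists (K1 + K2)%N => k kK.
have hA l : near_avg phi k l (e / 2) (limit_avg l) by apply: H1; lia.
have hw l i z z' : (i < h k l)%N -> I k l z -> I k l z' ->
    `|phi (iter i T z) - phi (iter i T z')| <= e / 2.
  by move=> hi zl zl'; apply: (H2 k l) => //; lia.
have := integral_towers ren hnu phi_le phi_meas (ltW e20) hA hw.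
have := pr_sides ren k hnu; rewrite /tau /pr_CD !(pr_side ren) /letters /limit_avg /thm.
rewrite !big_cons !big_nil /= !addr0.
move: (Rintegral _ _ _) (pr nu (tower k C)) (pr nu (tower k D)) (pr nu (tower k A1))
   (pr nu (tower k A2)) (pr nu (tower k B1)) (pr nu (tower k B2)) => a p1 p2 p3 p4 p5 p6.
move: (theta true) (theta false) => t f htot.
have ee1 : e = e * (p3 + p4 + (p5 + p6) + (p1 + p2)) by rewrite htot mulr1.
have ff1 : f = f * (p3 + p4 + (p5 + p6) + (p1 + p2)) by rewrite htot mulr1.
by rewrite !ler_norml => /andP[? ?]; apply/andP; split; lra.
Qed.

Lemma integral_mu : \int[mu]_(z in X) phi z = thm theta.
Proof.
have hmu := mu_invariant ren muE.
apply/eqP; rewrite -subr_eq0 -normr_le0; apply/ler_addgt0Pr => e e0; rewrite add0r.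
have [K HK] := integral_tau hmu e0; have := HK K (leqnn _).
have := pr_sides ren K hmu; have := mu_side_sym ren muE K.
(* By symmetry of the sides the weight is exactly 1/2 at every level. *)
rewrite /thm => h1 h2; have -> : tau mu K = 1 / 2 by rewrite /tau; lra.
by rewrite (_ : 1 / 2 * _ + _ = (theta true + theta false) / 2) //; lra.
Qed.

Lemma generic_avg :
  (fun N : nat => N%:R^-1 * \sum_(0 <= i < N) phi (iter i T 0)) @ \oo -->
    \int[mu]_(z in X) phi z.
Proof.
rewrite integral_mu; apply/cvgrPdist_le => e e0.
have [N0 HN0] := dev_zero ren phi_le' theta_le th_lim e0.
exists N0.+1 => // N /= hN.
have N_gt0 : (0 : R) < N%:R by rewrite ltr0n; lia.
have := HN0 N (ltnW hN); rewrite /deviation sumrB sumr_const_nat subn0.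
rewrite -[thm theta *+ N]mulr_natr; set S := bigop _ _ _ => hS.
rewrite distrC (_ : N%:R^-1 * S - _ = N%:R^-1 * (S - thm theta * N%:R)).
  by rewrite normrM gtr0_norm ?invr_gt0 // mulrC ler_pdivrMr.
by rewrite mulrBr mulrCA mulVf ?mulr1 // gt_eqF.
Qed.

End Phi.

Lemma ramp_flat x n : flat (ramp x n).
Proof.
apply: (unif_flat ren) => e e0.
exists (e / n.+1%:R); first by rewrite divr_gt0.
move=> a b _ _ ab; apply: le_trans (ramp_lip _ _ _ _) _.
have n0 : (0 : R) < n.+1%:R by [].
move: ab; rewrite ltr_pdivlMr // => /ltW; apply: le_trans.
by rewrite mulrC ler_wpM2l // ler_nat.
Qed.

Lemma ramp_bound x n z : X z -> `|ramp x n z| <= 1.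
Proof. by move=> _; rewrite ger0_norm ?ramp_ge0 ?ramp_le1. Qed.

Lemma ramp_meas x n : measurable_fun (X : set RT) (ramp x n : RT -> RT).
Proof. by apply: measurable_funTS; exact: measurable_ramp. Qed.

Lemma pr_IX (nu : prob) E : inv nu -> measurable (E : set RT) -> pr nu (E `&` X) = pr nu E.
Proof.
move=> hnu mE; have mX := measurable_idom lc ld lx ly.
have mD := measurableD mE mX; have hD := pr_setD nu mE mX.
have dXE : [disjoint X & E `\` X].
  by apply/disj_set2P; rewrite setDE setICA setICr setI0.
have := pr_setU nu mX mD dXE; rewrite (pr_idom hnu).
have := pr_le1 nu (measurableU _ _ mX mD); have := pr_ge0 nu (E `\` X); lra.
Qed.

Lemma integral_indic_X (nu : prob) E : inv nu -> measurable (E : set RT) ->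
  \int[nu]_(z in X) (\1_E z : R) = pr nu E.
Proof.
move=> hnu mE; rewrite -(pr_IX hnu mE) /pr /Rintegral integral_indic //.
exact: measurable_idom.
Qed.

Lemma integrable_ramp (nu : prob) x n : nu.-integrable X (EFin \o ramp x n).
Proof.
have mX := measurable_idom lc ld lx ly.
have := phi_integrable nu (@ramp_bound x n) (@ramp_meas x n) 0 mX (@subset_refl _ X).
by apply: eq_integrable => // z _ /=; rewrite subr0.
Qed.

Lemma integrable_indic_X (nu : prob) E : measurable (E : set RT) ->
  nu.-integrable X (EFin \o (\1_E : R -> R)).
Proof.
move=> mE; have mX := measurable_idom lc ld lx ly.
apply: measurable_bounded_integrable => //.
  by rewrite (le_lt_trans (probability_le1 nu mX)) // ltry.
exists 1; split; first exact: num_real.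
by move=> r hr z _ /=; rewrite indicE ger0_norm // (le_trans _ (ltW hr)) // lern1 leq_b1.
Qed.

Lemma integral_ramp_cvg (nu : prob) x : inv nu ->
  (fun n => \int[nu]_(z in X) ramp x n.+1 z) @ \oo --> pr nu `]-oo, x[%classic.
Proof.
move=> hnu; have mX := measurable_idom lc ld lx ly.
have mray (y : R) : measurable (`]-oo, y[%classic : set RT) by exact: measurable_itv.
have mrayc (y : R) : measurable (`]-oo, y]%classic : set RT) by exact: measurable_itv.
have up n : \int[nu]_(z in X) ramp x n.+1 z <= pr nu `]-oo, x[%classic.
  rewrite -(integral_indic_X hnu (mray x)).
  apply: (le_Rintegral mX (integrable_ramp _ _ _) (integrable_indic_X _ (mray x))) => z _.
  rewrite indicE; case: (boolP (z \in _)) => [_|]; first exact: ramp_le1.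
  rewrite notin_setE /= in_itv /= => /negP; rewrite -leNgt => xz.
  by rewrite ramp_eq0.
have dn n : pr nu `]-oo, x - n.+1%:R^-1]%classic <= \int[nu]_(z in X) ramp x n.+1 z.
  rewrite -(integral_indic_X hnu (mrayc _)).
  apply: (le_Rintegral mX (integrable_indic_X _ (mrayc _)) (integrable_ramp _ _ _)) => z _.
  rewrite indicE; case: (boolP (z \in _)) => [|_]; last exact: ramp_ge0.
  by rewrite inE /= in_itv /= => zx; rewrite ramp_eq1.
have cv : (fun n => pr nu `]-oo, x - n.+1%:R^-1]%classic) @ \oo --> pr nu `]-oo, x[%classic.
  apply: fine_cvg; rewrite -prE //.
  have e : \bigcup_n `]-oo, x - n.+1%:R^-1]%classic = `]-oo, x[%classic :> set R.
    apply/seteqP; split => z /=.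
      move=> [n _] /=; rewrite !in_itv /= => /le_lt_trans; apply.
      by rewrite ltrBlDr ltrDl invr_gt0.
    rewrite in_itv /= => zx; have xz0 : 0 < x - z by rewrite subr_gt0.
    exists (Num.bound (x - z)^-1) => //=; rewrite in_itv /= lerBrDl -lerBrDr.
    rewrite invf_ple ?posrE //.
    have y0 : 0 < (x - z)^-1 by rewrite invr_gt0.
    by apply: le_trans (ltW (archi_boundP (ltW y0))) _; rewrite ler_nat.
  rewrite -e; apply: nondecreasing_cvg_mu => //; first by rewrite e.
  move=> n m nm; apply/subsetPset => z /=; rewrite !in_itv /= => /le_trans; apply.
  by rewrite lerD2l lerN2 lef_pV2 ?posrE // ler_nat.
apply: squeeze_cvgr cv (cvg_cst _).
by apply: nearW => n; rewrite dn up.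
Qed.

(** If ramps could not tell the measures apart, they would agree on rays, hence on [compA true], to
    which they give masses 1 and 0. *)
Lemma nus_distinct : exists x n,
  \int[nus true]_(z in X) ramp x n.+1 z != \int[nus false]_(z in X) ramp x n.+1 z.
Proof.
apply: contrapT => H.
have eqr x n : \int[nus true]_(z in X) ramp x n.+1 z = \int[nus false]_(z in X) ramp x n.+1 z.
  by apply/eqP/negPn/negP => h; apply: H; exists x, n.
have rays x : nus true `]-oo, x[%classic = nus false `]-oo, x[%classic.
  rewrite !prE; [|exact: measurable_itv..]; congr (_%:E).
  apply: cvg_unique (integral_ramp_cvg (nus_inv true)) _ => //.
  have -> : (fun n => \int[nus true]_(z in X) ramp x n.+1 z) =
      (fun n => \int[nus false]_(z in X) ramp x n.+1 z).
    by apply/funext => n; apply: eqr.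
  exact: integral_ramp_cvg (nus_inv false).
have mC := measurable_compA ren muE true.
have hT : (nus true setT < +oo)%E by rewrite probability_setT ltry.
have : pr (nus true) (compA true) = pr (nus false) (compA true).
  by congr fine; exact: (measure_ray_eq (m1 := nus true) (m2 := nus false) hT rays mC).
rewrite !(comp_self ren area muE (@nusE _)) /= => /eqP.
by rewrite oner_eq0.
Qed.

(** A ramp separating the two measures determines the only possible weight [t]. The weights
    [tau nu k] converge to it, and since they are common to all observables, [t] is right for all
    ramps, then for rays and Borel sets. *)
Lemma inv_combination nu : inv nu -> exists2 t : R, 0 <= t <= 1 &
  forall E, measurable (E : set RT) -> pr nu E = t * pr (nus true) E + (1 - t) * pr (nus false) E.
Proof.
move=> hnu; have [x0 [n0 hne]] := nus_distinct.
have itau x n e (e0 : 0 < e) :=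
  integral_tau (@ramp_bound x n.+1) (@ramp_meas x n.+1) (@ramp_flat x n.+1) hnu e0.
set a := Rintegral _ _ _ in hne; set b := Rintegral _ _ _ in hne.
pose t := (\int[nu]_(z in X) ramp x0 n0.+1 z - b) / (a - b).
have ab0 : 0 < `|a - b| by rewrite normr_gt0 subr_eq0.
have tcv (e : R) : 0 < e -> exists K : nat, forall k, (K <= k)%N -> `|t - tau nu k| <= e.
  move=> e0; have [K HK] := itau x0 n0 _ (mulr_gt0 e0 ab0).
  exists K => k /HK; rewrite /theta -/a -/b -ler_pdivrMr // -normfV -normrM.
  congr (`|_| <= e); rewrite /t.
  have d0 : a - b != 0 by rewrite subr_eq0.
  by move: (Rintegral _ _ _) d0 => c0 d0; field.
have tau01 k : 0 <= tau nu k <= 1.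
  have := pr_sides ren k hnu; have := pr_ge0 nu (side k true).
  have := pr_ge0 nu (side k false).
  have : 0 <= pr_CD nu k by rewrite addr_ge0 ?pr_ge0.
  by rewrite /tau => ? ? ? ?; apply/andP; split; lra.
have t01 : 0 <= t <= 1.
  apply/andP; split; apply/ler_addgt0Pr => e /tcv[K HK];
  have := HK K (leqnn _); have := tau01 K; rewrite ler_norml => /andP[? ?] /andP[? ?]; lra.
exists t => //.
have hI x n : \int[nu]_(z in X) ramp x n.+1 z =
    t * \int[nus true]_(z in X) ramp x n.+1 z + (1 - t) * \int[nus false]_(z in X) ramp x n.+1 z.
  have := theta_le (@ramp_bound x n.+1) (@ramp_meas x n.+1) true.
  have := theta_le (@ramp_bound x n.+1) (@ramp_meas x n.+1) false.
  rewrite /theta; set u := Rintegral _ _ _; set v := Rintegral _ _ _ => hu hv.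
  apply/eqP; rewrite -subr_eq0 -normr_le0; apply/ler_addgt0Pr => e e0; rewrite add0r.
  have e40 : 0 < e / 4 by lra.
  have [K1 H1] := itau x n _ e40; have [K2 H2] := tcv _ e40.
  have := H1 (K1 + K2)%N (leq_addr _ _); have := H2 (K1 + K2)%N (leq_addl _ _).
  rewrite /theta -/u -/v; move: (tau _ _) (Rintegral _ _ _) => k c0 h1 h2.
  have -> : c0 - (t * v + (1 - t) * u) =
    (c0 - (k * v + (1 - k) * u)) + ((k - t) * v + (t - k) * u) by lra.
  apply: le_trans (ler_normD _ _) _.
  have : `|(k - t) * v + (t - k) * u| <= e / 4 + e / 4.
    apply: le_trans (ler_normD _ _) _; rewrite !normrM (distrC k t); apply: lerD.
      by rewrite -[leRHS]mulr1 ler_pM.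
    by rewrite -[leRHS]mulr1 ler_pM.
  lra.
have hray x : pr nu `]-oo, x[%classic =
    t * pr (nus true) `]-oo, x[%classic + (1 - t) * pr (nus false) `]-oo, x[%classic.
  apply: cvg_unique (integral_ramp_cvg hnu) _ => //.
  have -> : (fun n => \int[nu]_(z in X) ramp x n.+1 z) =
      (fun n => t * \int[nus true]_(z in X) ramp x n.+1 z +
                (1 - t) * \int[nus false]_(z in X) ramp x n.+1 z).
    by apply/funext => n; apply: hI.
  by apply: cvgD; apply: cvgMr; apply: integral_ramp_cvg; apply: nus_inv.
have /andP[t0 t1] := t01; have t1' : 0 <= 1 - t by lra.
pose m : {measure set RT -> \bar R} := measure_add
  (mscale (NngNum t0) (nus true)) (mscale (NngNum t1') (nus false)).
have mE E : measurable (E : set RT) ->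
    m E = (t * pr (nus true) E + (1 - t) * pr (nus false) E)%:E.
  by move=> hE; rewrite [LHS]measure_addE EFinD !EFinM -!prE //.
move=> E hE; apply: EFin_inj; rewrite -prE // -mE //.
have hT : (nu setT < +oo)%E by rewrite probability_setT ltry.
apply: (measure_ray_eq (m1 := nu) (m2 := m) hT) => //.
move=> x; have mr : measurable (`]-oo, x[%classic : set RT) by exact: measurable_itv.
by rewrite (mE _ mr) -hray; exact: prE.
Qed.

Lemma borel_prob_eqP (m1 m2 : prob) :
  (forall E, measurable (E : set RT) -> pr m1 E = pr m2 E) -> borel_prob_eq m1 m2.
Proof. by move=> H E mE; rewrite !prE // H. Qed.

Lemma compA_meas s : measurable (compA s : set RT).
Proof. exact: (measurable_compA ren muE s). Qed.

Lemma nus_self s s' : pr (nus s) (compA s') = if s' == s then 1 else 0.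
Proof. exact: (comp_self ren area muE (@nusE s)). Qed.

Lemma nus_neq : ~ borel_prob_eq (nus true) (nus false).
Proof.
move=> /(_ _ (compA_meas true)) e.
have : pr (nus true) (compA true) = pr (nus false) (compA true) by rewrite /pr e.
by rewrite !nus_self => /eqP; rewrite oner_eq0.
Qed.

(** In the decomposition of [nu] the other component gives side [s] a mass tending to 0, so its
    weight must vanish. *)
Lemma inv_concentrated nu s : inv nu -> concentrated nu s -> borel_prob_eq nu (nus s).
Proof.
move=> hnu hc; have [t /andP[t0 t1] ht] := inv_combination hnu.
have hs : concentrated (nus s) s := @nus_conc s.
suff hst : if s then t = 1 else t = 0.
  by apply: borel_prob_eqP => E mE; rewrite ht //; case: s hst {hc hs} => ->; lra.
have hside k s' : pr nu (side k s') =
    t * pr (nus true) (side k s') + (1 - t) * pr (nus false) (side k s').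
  exact: ht (measurable_side ren k s').
have c1 := @nus_conc (~~ s).
have key (e : R) : 0 < e -> (if s then 1 - t else t) <= e.
  move=> e0; have e20 : 0 < e / 2 by lra.
  have [K1 H1] := hc _ e20; have [K2 H2] := c1 _ e20.
  pose k := (K1 + K2)%N; have := H1 k (leq_addr _ _); have := H2 k (leq_addl _ _).
  have p1 (m : prob) s' : 0 <= pr m (side k s') <= 1.
    by rewrite pr_ge0 pr_le1 //; apply: (measurable_side ren).
  have psum m : inv m -> pr m (side k true) + pr m (side k false) <= 1.
    move=> hm; have := pr_sides ren k hm.
    have : 0 <= pr_CD m k by rewrite addr_ge0 ?pr_ge0.
    lra.
  have /andP[a0 a1] := p1 (nus true) s; have /andP[b0 b1] := p1 (nus false) s.
  have := psum _ (nus_inv true); have := psum _ (nus_inv false).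
  rewrite (hside k s); move: a0 a1 b0 b1; case: s {hc hs hside c1 H1 H2 p1 psum} => /=.
    move=> a0 a1 b0 b1 hf _ hc2 hn.
    have : (1 - t) * pr (nus false) (side k true) <= (1 - t) * (e / 2).
      by rewrite ler_wpM2l //; lra.
    have : t * pr (nus true) (side k true) <= t by rewrite ler_piMr.
    have : (1 - t) * (e / 2) <= e / 2 by rewrite ler_piMl //; lra.
    lra.
  move=> a0 a1 b0 b1 _ hf hc2 hn.
  have : t * pr (nus true) (side k false) <= t * (e / 2).
    by rewrite ler_wpM2l //; lra.
  have : (1 - t) * pr (nus false) (side k false) <= 1 - t by rewrite ler_piMr //; lra.
  have : t * (e / 2) <= e / 2 by rewrite ler_piMl //; lra.
  lra.
have : (if s then 1 - t else t) <= 0 by apply/ler_addgt0Pr => e /key; rewrite add0r.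
by case: s {hc hs c1 key} => ?; lra.
Qed.

(** Conditioning [nus s] on an invariant set [B] of positive mass gives an invariant probability
    still concentrated on side [s], hence [nus s] itself; evaluating at [B] gives mass 1. *)
Lemma nus_ergodic s : ergodic_prob X T (nus s).
Proof.
split; first exact: nus_inv.
move=> B mB BX invB; have b0 := pr_ge0 (nus s) B; have b1 := pr_le1 (nus s) mB.
have [bz|bnz] := eqVneq (pr (nus s) B) 0; first by left; rewrite prE // bz.
right; have bpos : 0 < pr (nus s) B by rewrite lt_def bnz.
have [nu nuE] : exists nu : prob, forall E, measurable (E : set RT) ->
    nu E = (nus s (E `&` B) * ((pr (nus s) B)^-1)%:E)%E.
  exact: (conditional_prob (dirac (0 : RT)) mB (prE (nus s) mB) bpos).
have pnu E : measurable (E : set RT) -> pr nu E = pr (nus s) (E `&` B) / pr (nus s) B.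
  by move=> mE; rewrite [LHS]/pr nuE // (prE (nus s) (measurableI _ _ mE mB)).
have mX := measurable_idom lc ld lx ly.
have hnu : inv nu.
  split=> [|E mE EX].
    by rewrite prE // pnu // setIC (setIidl BX) divff.
  have mP := measurable_preimage ren mE.
  rewrite !prE // !pnu //; congr ((_ / _)%:E).
  have [_ H] := nus_inv s.
  have mEB : measurable (E `&` B : set RT) by apply: measurableI.
  have : nus s (X `&` T @^-1` (E `&` B)) = nus s (E `&` B) by apply: H => // z [/EX].
  by rewrite /pr => <-; rewrite -{1}invB preimage_setI setIACA setIid setIA.
have hc : concentrated nu s.
  move=> e e0; have [K HK] := @nus_conc s _ (mulr_gt0 e0 bpos); exists K => k /HK.
  have ms := measurable_side ren k s.
  rewrite pnu // => h1.
  have : pr (nus s) B - pr (nus s) (side k s `&` B) <= 1 - pr (nus s) (side k s).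
    have mD : measurable (B `\` side k s : set RT) by apply: measurableD.
    rewrite setIC -pr_setD // lerBrDr -pr_setU //.
      by apply: pr_le1; apply: measurableU.
    by apply/disj_set2P; rewrite setDE -setIA setICl setI0.
  move=> h2; have -> : 1 - pr (nus s) (side k s `&` B) / pr (nus s) B =
    (pr (nus s) B - pr (nus s) (side k s `&` B)) / pr (nus s) B.
    by rewrite mulrBl divff.
  by rewrite ler_pdivrMr //; apply: le_trans h1.
have := inv_concentrated hnu hc mB; rewrite prE // pnu // setIid divff // prE //.
Qed.

(** The weight of [nus true] is the mass of the invariant set [compA true], so ergodicity makes it 0
    or 1. *)
Lemma ergodic_nus nu : ergodic_prob X T nu ->
  borel_prob_eq nu (nus true) \/ borel_prob_eq nu (nus false).
Proof.
move=> [hnu herg]; have [t _ ht] := inv_combination hnu.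
have mC := compA_meas true.
have tE : pr nu (compA true) = t by rewrite ht // !nus_self /=; lra.
have [h0|h1] := herg _ mC (@compA_X _ _ _ _ _ ren true) (compA_inv ren true).
- right; apply: borel_prob_eqP => E mE; rewrite ht // -tE /pr h0 /=; lra.
- left; apply: borel_prob_eqP => E mE; rewrite ht // -tE /pr h1 /=; lra.
Qed.

Lemma mu_generic : generic_measure X T mu.
Proof.
exists 0; first by apply/idomE; rewrite lexx (J_gt0 ren).
move=> f fc fs; have [M fM] := compact_support_bounded fc fs.
apply: (generic_avg fM).
- exact: subspace_continuous_measurable_fun (measurable_idom lc ld lx ly) fc.
- apply: (unif_flat ren); exact: compact_support_unif.
Qed.

Lemma mu_not_ergodic : ~ ergodic_prob X T mu.
Proof.
move=> [_ /(_ _ (compA_meas true) (@compA_X _ _ _ _ _ ren true) (compA_inv ren true))].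
have := mu_compA ren area muE true; rewrite /pr => h [e|e]; move: h; rewrite e /=; lra.
Qed.

Theorem exchange_dynamics :
  [/\ minimal_on X T /\ ~ uniquely_ergodic X T,
      (exists mu1 mu2 : prob,
        [/\ ergodic_prob X T mu1, ergodic_prob X T mu2, ~ borel_prob_eq mu1 mu2 &
            forall nu : prob, ergodic_prob X T nu ->
              borel_prob_eq nu mu1 \/ borel_prob_eq nu mu2]) &
      (exists nu : prob, [/\ inv nu, generic_measure X T nu & ~ ergodic_prob X T nu])].
Proof.
split.
- split; first exact: T_minimal.
  move=> [m hm um]; apply: nus_neq => E mE.
  by rewrite (um _ (nus_inv true)) // (um _ (nus_inv false)).
- exists (nus true), (nus false); split; [exact: nus_ergodic|exact: nus_ergodic|exact: nus_neq|].
  exact: ergodic_nus.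
- exists mu; split; [exact: mu_invariant ren _ muE|exact: mu_generic|exact: mu_not_ergodic].
Qed.

End Conclusion.

(** * The interval exchange transformation *)

Definition bottom_rank (l : letter) : 'I_6 :=
  match l with
  | A2 => @Ordinal 6 0 isT | A1 => @Ordinal 6 1 isT | B2 => @Ordinal 6 2 isT
  | B1 => @Ordinal 6 3 isT | D => @Ordinal 6 4 isT | C => @Ordinal 6 5 isT
  end.

Lemma letter_rank_bij : bijective letter_rank.
Proof.
exists (fun i : 'I_6 => nth C letters i); first exact: letter_rankK.
by case=> -[|[|[|[|[|[|//]]]]]] ?; apply: val_inj.
Qed.

Lemma bottom_rank_bij : bijective bottom_rank.
Proof.
exists (fun i : 'I_6 => nth C [:: A2; A1; B2; B1; D; C] i); first by case.
by case=> -[|[|[|[|[|[|//]]]]]] ?; apply: val_inj.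
Qed.

Lemma sum_letter (R : realType) (F : letter -> R) (P : pred letter) :
  \sum_(l | P l) F l = \sum_(l <- letters | P l) F l.
Proof.
apply: perm_big; apply: uniq_perm; rewrite ?index_enum_uniq // => l.
by rewrite mem_index_enum; case: l.
Qed.

Section Data.
Variables (R : realType) (c d x y : R).
Hypotheses (c_gt0 : 0 < c) (d_gt0 : 0 < d) (x_gt0 : 0 < x) (y_gt0 : 0 < y).

Lemma len_gt0 l : 0 < len c d x y l.
Proof. by case: l. Qed.

Definition exch_data : iet_data R letter 6 :=
  IETData len_gt0 letter_rank_bij bottom_rank_bij.

Lemma exch_total : iet_total exch_data = total c d x y.
Proof. by rewrite /iet_total sum_letter /letters !big_cons big_nil /= /total; lra. Qed.

Lemma exch_top_left l : iet_top_left exch_data l = lft c d x y l.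
Proof.
rewrite /iet_top_left sum_letter /letters !big_cons big_nil.
by case: l => /=; rewrite ?addr0; lra.
Qed.

Lemma exch_bot_left l :
  iet_bot_left exch_data l = lft c d x y l + trans c d x y l.
Proof.
rewrite /iet_bot_left sum_letter /letters !big_cons big_nil.
by case: l => /=; lra.
Qed.

Lemma iet_map_exch (z : R) : 0 <= z < total c d x y ->
  iet_map exch_data z = exch c d x y z.
Proof.
move=> /(inI_cover c_gt0 d_gt0 x_gt0 y_gt0)[l zl]; rewrite /iet_map.
case: pickP => [a|/(_ l)]; rewrite exch_top_left => za.
  by rewrite (exchE c_gt0 d_gt0 x_gt0 y_gt0 za) exch_bot_left; lra.
by move: zl; rewrite /inI za.
Qed.

End Data.

(** * Transfer between maps that agree on the domain *)

Section Agree.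
Variables (R : realType) (X : set R) (T1 T2 : R -> R).
Hypothesis T2_X : forall z, X z -> X (T2 z).
Hypothesis T12 : forall z, X z -> T1 z = T2 z.

Lemma agree_iter n z : X z -> iter n T1 z = iter n T2 z.
Proof.
move=> Xz; suff [-> _] : iter n T1 z = iter n T2 z /\ X (iter n T2 z) by [].
elim: n => //= n [-> Xn]; split; [exact: T12|exact: T2_X].
Qed.

Lemma agree_preimage B : X `&` T1 @^-1` B = X `&` T2 @^-1` B.
Proof. by apply/seteqP; split => z [Xz] /=; rewrite T12. Qed.

Lemma agree_invariant : invariant_prob X T1 = invariant_prob X T2.
Proof.
apply/funext => mu; apply/propext.
by split=> -[mX H]; split => // B mB BX; rewrite -(H B) // agree_preimage.
Qed.

Lemma agree_ergodic : ergodic_prob X T1 = ergodic_prob X T2.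
Proof.
apply/funext => mu; apply/propext; rewrite /ergodic_prob agree_invariant.
by split=> -[mX H]; split => // B mB BX e; apply: H => //;
  rewrite ?agree_preimage // -agree_preimage.
Qed.

Lemma agree_minimal : minimal_on X T2 -> minimal_on X T1.
Proof.
move=> H z Xz w Xw; rewrite (_ : forward_orbit T1 z = forward_orbit T2 z).
  exact: H.
by apply/seteqP; split => _ [n _ <-]; exists n => //; rewrite agree_iter.
Qed.

Lemma agree_generic mu : generic_measure X T2 mu -> generic_measure X T1 mu.
Proof.
move=> [z Xz H]; exists z => // f fc fs.
rewrite (_ : (fun N : nat => _) = fun N : nat => N%:R^-1 * \sum_(0 <= i < N) f (iter i T2 z)).
  exact: H.
by apply/funext => N; congr (_ * _); apply: eq_bigr => i _; rewrite agree_iter.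
Qed.

End Agree.

Theorem theorem1 (R : realType) :
  exists (A : finType) (D : iet_data R A 6),
    let X := iet_dom D in
    let T := iet_map D in
    [/\ minimal_on X T /\ ~ uniquely_ergodic X T,
        (exists mu1 mu2 : probability (measurableTypeR R) R,
          [/\ ergodic_prob X T mu1, ergodic_prob X T mu2,
              ~ borel_prob_eq mu1 mu2 &
              forall nu : probability (measurableTypeR R) R,
                ergodic_prob X T nu ->
                borel_prob_eq nu mu1 \/ borel_prob_eq nu mu2]) &
        (exists mu : probability (measurableTypeR R) R,
          [/\ invariant_prob X T mu, generic_measure X T mu &
              ~ ergodic_prob X T mu])].
Proof.
have ren := L_renormalizable R.
have [[c0 d0 x0 y0] _ _ _] := ren 0%N.
exists letter, (exch_data c0 d0 x0 y0) => X T.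
have eX : X = idom (@Lc R) (@Ld R) (@Lx R) (@Ly R).
  by rewrite /X /iet_dom exch_total.
have TX z : X z -> X (Tk (@Lc R) (@Ld R) (@Lx R) (@Ly R) 0 z).
  by rewrite eX; apply: exch_idom.
have TT z : X z -> T z = Tk (@Lc R) (@Ld R) (@Lx R) (@Ly R) 0 z.
  by rewrite eX => /idomE zX; apply: iet_map_exch.
have [mu muE] := uniform_prob_exists ren.
have [nu1 nu1E] := compA_exists ren (@L_area R) muE true.
have [nu2 nu2E] := compA_exists ren (@L_area R) muE false.
have nusE s E : measurable (E : set (measurableTypeR R)) ->
    (if s then nu1 else nu2) E = (mu (E `&` compA (@Lc R) (@Ld R) (@Lx R) (@Ly R) s) * ((1/2)^-1)%:E)%E.
  by case: s; [exact: nu1E|exact: nu2E].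
have := @exchange_dynamics R _ _ _ _ ren (@L_area R) mu muE
  (fun s => if s then nu1 else nu2) nusE.
rewrite -eX => -[[hmin hue] herg [nu [hinv hgen hnerg]]].
split.
- split; first exact: (agree_minimal TX TT hmin).
  by rewrite /uniquely_ergodic (agree_invariant TT).
- by rewrite (agree_ergodic TT).
- exists nu; rewrite (agree_invariant TT) (agree_ergodic TT).
  split; [exact: hinv| |exact: hnerg].
  exact: (agree_generic TX TT hgen).
Qed.
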